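(* Let $0<q\le1$. Then $$\mathcal{L}^{1,q}(\mathcal{C})^{\ast}\approx\mathfrak{M}.$$ Moreover, for a measure $\mu$ on $\mathbb{R}^n$, $$\|\mu\|_{\mathfrak{M}}=\inf\{a>0:\ |\mu|^{\ast}(E)\le a\cdot\mathcal{C}(E)\ \text{ for all subsets } E\subseteq\mathbb{R}^n\}$$ (with $\inf\emptyset=\infty$).
   Context: Fix $n\in\mathbb{N}$, $0<\alpha<\infty$, $1<s\le n/\alpha$. Let $G_\alpha=\mathcal{F}^{-1}[(1+|\cdot|^2)^{-\alpha/2}]$ be the Bessel kernel on $\mathbb{R}^n$. For $E\subseteq\mathbb{R}^n$ the Bessel capacity is $\mathcal{C}(E)=\inf\{\|f\|_{L^s(\mathbb{R}^n)}^s: f\ge 0,\ G_\alpha\ast f\ge 1\text{ on }E\}$. $C_0$ is the space of compactly supported continuous real functions on $\mathbb{R}^n$. A measure $\mu$ on $\mathbb{R}^n$ means (Bourbaki convention) a continuous linear functional on $C_0$ with its inductive limit topology, i.e. a (signed) Radon measure; $|\mu|$ is its total variation, and $|\mu|^\ast$ the associated outer measure, $|\mu|^\ast(E)=\inf\{|\mu|(G): G\supseteq E\text{ open}\}$. Define $$\|\mu\|_{\mathfrak{M}}=\sup_K\frac{|\mu|(K)}{\mathcal{C}(K)},$$ supremum over all compact $K\subseteq\mathbb{R}^n$ with $\mathcal{C}(K)\ne0$; $\mathfrak{M}$ is the set of measures $\mu$ on $\mathbb{R}^n$ with $\|\mu\|_{\mathfrak{M}}<\infty$. For $0<p,q<\infty$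 the capacitary Lorentz space $L^{p,q}(\mathcal{C})$ consists of functions $f$ on $\mathbb{R}^n$ with $\|f\|_{L^{p,q}(\mathcal{C})}=p^{1/q}\left(\int_0^\infty\mathcal{C}(\{|f|>t\})^{q/p}t^q\frac{dt}{t}\right)^{1/q}<\infty$ (functions equal outside a set of capacity zero are identified). $\mathcal{L}^{p,q}(\mathcal{C})$ is the closure (completion) of $C_0$ in $L^{p,q}(\mathcal{C})$ with respect to the quasi-norm $\|\cdot\|_{L^{p,q}(\mathcal{C})}$. $\mathcal{L}^{1,q}(\mathcal{C})^\ast\approx\mathfrak{M}$ means: for every continuous linear functional $\mathcal{L}$ on $\mathcal{L}^{1,q}(\mathcal{C})$ there is a unique $\mu\in\mathfrak{M}$ with $\mathcal{L}(f)=\int_{\mathbb{R}^n}f\,d\mu$ for all $f\in\mathcal{L}^{1,q}(\mathcal{C})$; conversely every $\mu\in\mathfrak{M}$ defines by this formula a continuous linear functional on $\mathcal{L}^{1,q}(\mathcal{C})$; and there is a constant $c>0$ with $c^{-1}\|\mu\|_{\mathfrak{M}}\le\|\mathcal{L}\|\le c\|\mu\|_{\mathfrak{M}}$ for all such pairs. *)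

(* Defs.v *)
From HB Require Import structures.
From mathcomp Require Import all_boot all_order all_algebra.
From mathcomp Require Import all_classical all_reals all_analysis.

Set Implicit Arguments.
Unset Strict Implicit.
Unset Printing Implicit Defensive.

Import Order.TTheory GRing.Theory Num.Theory.
Import numFieldNormedType.Exports.

Local Open Scope classical_set_scope.
Local Open Scope ring_scope.

(* R^n is 'rV[R]_n with its product topology.  It is measured by the product
   sigma-algebra (generated by the coordinates), which is its Borel
   sigma-algebra; this mirrors the library's instance on n.-tuple T. *)

Definition rV_display : measure_display.
Proof. by constructor. Qed.

Section measurable_rV.
Variables (R : realType) (n : nat).

Let coord_rV : 'I_n -> 'rV[R]_n -> measurableTypeR R := fun i x => x ord0 i.

Let rV_set0 : g_sigma_preimage coord_rV set0.
Proof. exact: sigma_algebra0. Qed.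

Let rV_setC A : g_sigma_preimage coord_rV A -> g_sigma_preimage coord_rV (~` A).
Proof. exact: sigma_algebraC. Qed.

Let rV_bigcup (F : _^nat) : (forall i, g_sigma_preimage coord_rV (F i)) ->
  g_sigma_preimage coord_rV (\bigcup_i (F i)).
Proof. exact: sigma_algebra_bigcup. Qed.

HB.instance Definition _ := @isMeasurable.Build rV_display
  'rV[R]_n (g_sigma_preimage coord_rV) rV_set0 rV_setC rV_bigcup.

Lemma measurable_coord_rV (i : 'I_n) :
  measurable_fun [set: 'rV[R]_n] (fun x => x ord0 i : measurableTypeR R).
Proof.
move=> _ Y mY; rewrite setTI; apply: sub_sigma_algebra => /=.
rewrite -bigcup_seq/=; exists i => /=; first by rewrite mem_index_enum.
by exists Y => //; rewrite setTI.
Qed.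

Lemma measurable_fun_rV d (T : measurableType d) (f : T -> 'rV[R]_n) :
  (forall i, measurable_fun [set: T] (fun t => f t ord0 i : measurableTypeR R)) ->
  measurable_fun [set: T] f.
Proof.
move=> mf _ A mA; rewrite setTI.
have /(_ A mA) : (@measurable _ 'rV[R]_n) `<=` [set B | measurable (f @^-1` B)].
  apply: smallest_sub.
    split => [|B /= mB|F /= mF].
    - by rewrite /= preimage_set0.
    - by rewrite setTD -preimage_setC; exact: measurableC.
    - by rewrite /= preimage_bigcup; exact: bigcupT_measurable.
  rewrite -bigcup_seq => B [i _ [C mC <-]] /=.
  have := mf i measurableT C mC.
  by rewrite !setTI.
by [].
Qed.

End measurable_rV.

Section lebesgue_rV.
Variable R : realType.

Definition consrV n (p : measurableTypeR R * 'rV[R]_n) : 'rV[R]_n.+1 :=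
  (row_mx p.1%:M p.2 : 'rV[R]_(1 + n)).

Definition unconsrV n (x : 'rV[R]_n.+1) : measurableTypeR R * 'rV[R]_n :=
  (x ord0 ord0, \row_i x ord0 (lift ord0 i)).

Lemma consrV0 n p : @consrV n p ord0 ord0 = p.1.
Proof.
have e : ord0 = @lshift 1 n ord0 by apply: val_inj.
by rewrite /consrV e (row_mxEl (p.1%:M : 'M[R]_1)) mxE eqxx mulr1n.
Qed.

Lemma consrVS n p i : @consrV n p ord0 (lift ord0 i) = p.2 ord0 i.
Proof.
have e : lift ord0 i = @rshift 1 n i by apply: val_inj.
by rewrite /consrV e (row_mxEr (p.1%:M : 'M[R]_1)).
Qed.

Lemma unconsrVK n : cancel (@unconsrV n) (@consrV n).
Proof.
move=> x; apply/rowP => i.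
by case: (unliftP ord0 i) => [j|] ->; rewrite ?consrV0 ?consrVS//= mxE.
Qed.

Lemma consrVK n : cancel (@consrV n) (@unconsrV n).
Proof.
move=> [a x]; rewrite /unconsrV consrV0; congr (_, _).
by apply/rowP => i; rewrite mxE consrVS.
Qed.

Lemma measurable_consrV n : measurable_fun setT (@consrV n).
Proof.
apply: measurable_fun_rV => i; case: (unliftP ord0 i) => [j|] ->.
  rewrite (_ : (fun _ => _) = (fun x : 'rV[R]_n => x ord0 j : measurableTypeR R) \o snd).
    by apply: measurableT_comp => //; exact: measurable_coord_rV.
  by apply/funext => p /=; rewrite consrVS.
by rewrite (_ : (fun _ => _) = fst)//; apply/funext => p /=; rewrite consrV0.
Qed.

Lemma measurable_unconsrV n : measurable_fun setT (@unconsrV n).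
Proof.
apply/measurable_fun_pairP; split; first exact: measurable_coord_rV.
apply: measurable_fun_rV => i /=.
rewrite (_ : (fun _ => _) = (fun x : 'rV[R]_n.+1 => x ord0 (lift ord0 i))).
  exact: measurable_coord_rV.
by apply/funext => x /=; rewrite mxE.
Qed.

Section step.
Variables (n : nat) (m : {sigma_finite_measure set 'rV[R]_n -> \bar R}).

Definition lebesgue_step : set 'rV[R]_n.+1 -> \bar R :=
  pushforward (lebesgue_measure \x m)%E (@consrV n).

Let leb1 : {sigma_finite_measure set (measurableTypeR R) -> \bar R} :=
  lebesgue_measure.

Let step : {measure set 'rV[R]_n.+1 -> \bar R} :=
  measure_function_pushforward__canonical__measure_function_Measure
    (lebesgue_measure \x m)%E (@measurable_consrV n).

HB.instance Definition _ := isMeasure.Build _ _ _ lebesgue_step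
  (measure0 step) (measure_ge0 step) (@measure_semi_sigma_additive _ _ _ step).

Let lebesgue_step_sigma_finite : sigma_finite setT lebesgue_step.
Proof.
have /sigma_finiteP[F [TF ndF Foo]] := sigma_finiteT leb1.
have /sigma_finiteP[G [TG ndG Goo]] := sigma_finiteT m.
exists (fun k => @unconsrV n @^-1` (F k `*` G k)).
  rewrite -preimage_bigcup; apply/esym; rewrite -subTset => x _ /=.
  have [[i _ Fi] [j _ Gj]] : (\bigcup_k F k) (unconsrV x).1 /\
      (\bigcup_k G k) (unconsrV x).2 by rewrite -TF -TG.
  exists (maxn i j) => //; split.
  - by move: Fi; exact/subsetPset/ndF/leq_maxl.
  - by move: Gj; exact/subsetPset/ndG/leq_maxr.
move=> k; have [mF Fk] := Foo k; have [mG Gk] := Goo k; split.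
  rewrite -[X in measurable X]setTI; apply: measurable_unconsrV => //.
  exact: measurableX.
rewrite /lebesgue_step /pushforward -comp_preimage.
rewrite (_ : @unconsrV n \o _ = idfun) ?preimage_id; last first.
  by apply/funext => p; exact: consrVK.
rewrite (product_measure1E leb1 m)//.
by rewrite lte_mul_pinfty// ge0_fin_numE.
Qed.

HB.instance Definition _ := Measure_isSigmaFinite.Build _ _ _ lebesgue_step
  lebesgue_step_sigma_finite.

End step.

Fixpoint lebesgue_rV (n : nat) : {sigma_finite_measure set 'rV[R]_n -> \bar R} :=
  match n with
  | 0 => (\d_(0 : 'rV[R]_0) : {sigma_finite_measure set 'rV[R]_0 -> \bar R})
  | n'.+1 => (lebesgue_step (lebesgue_rV n') :
      {sigma_finite_measure set 'rV[R]_n'.+1 -> \bar R})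
  end.

End lebesgue_rV.

Section bessel_capacity.
Variables (R : realType) (n : nat).
Local Notation V := 'rV[R]_n.
Local Notation leb := (lebesgue_rV R n).
Implicit Types (alpha s : R) (G f : V -> R) (E : set V).

Definition dotrV (x y : V) : R := \sum_(i < n) x ord0 i * y ord0 i.

(* G is integrable and its Fourier transform
     F G (xi) = \int G(x) exp(- i x.xi) dx
   equals (1 + |xi|^2)^(-alpha/2); the real and imaginary parts of F G (xi) are
   stated separately.  This fixes G up to a Lebesgue-null set. *)
Definition is_bessel_kernel alpha G :=
  leb.-integrable setT (EFin \o G) /\
  forall xi : V,
    \int[leb]_x (G x * cos (dotrV x xi)) = (1 + dotrV xi xi) `^ (- (alpha / 2))
    /\ \int[leb]_x (G x * sin (dotrV x xi)) = 0.

(* Only the almost-everywhere class of the chosen kernel matters below, since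
   it is used only through convolutions. *)
Definition bessel_kernel alpha : V -> R :=
  xget (fun=> 0) [set G | is_bessel_kernel alpha G].

Definition bessel_potential alpha f (x : V) : \bar R :=
  (\int[leb]_y (bessel_kernel alpha (x - y) * f y)%:E)%E.

Definition capacity alpha s E : \bar R :=
  ereal_inf [set (Lnorm leb s%:E (EFin \o f) `^ s)%E | f in
    [set f : V -> R | measurable_fun setT f /\ (forall x, 0 <= f x) /\
       forall x, E x -> (1 <= bessel_potential alpha f x)%E]].

End bessel_capacity.

Section Cc.
Variables (R : realType) (n : nat).
Local Notation V := 'rV[R]_n.

Definition fun_supp (f : V -> R) : set V := closure [set x | f x != 0].

Definition Cc_pred : {pred V -> R^o} :=
  [pred f : V -> R | `[< continuous f /\ compact (fun_supp f) >]].

Lemma CcP (f : V -> R) :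
  reflect (continuous f /\ compact (fun_supp f)) (f \in Cc_pred).
Proof. exact: asboolP. Qed.

Lemma Cc_submod_closed : submod_closed Cc_pred.
Proof.
split.
  apply/CcP; split; first exact: cst_continuous.
  rewrite /fun_supp (_ : [set x | _] = set0) ?closure0; first exact: compact0.
  by rewrite -subset0 => x /=; rewrite eqxx.
move=> a f g /CcP[cf kf] /CcP[cg kg]; apply/CcP; split.
  move=> x; apply: (@cvgD R R^o _ (nbhs x) _ (a \*: f) g) => //; last exact: cg.
  by apply: (@cvgZl_tmp R R^o) => //; exact: cf.
apply: (@subclosed_compact _ _ (fun_supp f `|` fun_supp g)).
- exact: closed_closure.
- exact: compactU.
- rewrite /fun_supp -closureU; apply: closureS => x /= h.
  case: (eqVneq (f x) 0) => [fx0|]; last by left.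
  by right; apply: contra h => /eqP gx0; rewrite !fctE fx0 gx0 scaler0 addr0.
Qed.

HB.instance Definition _ :=
  GRing.isSubmodClosed.Build R (V -> R^o) Cc_pred Cc_submod_closed.

Record Cc := MkCc { Cc_fun :> V -> R^o ; Cc_funP : Cc_fun \in Cc_pred }.

HB.instance Definition _ := [isSub for Cc_fun].
HB.instance Definition _ := [Choice of Cc by <:].
HB.instance Definition _ := [SubChoice_isSubLmodule of Cc by <:].

End Cc.

Section radon_measures.
Variables (R : realType) (n : nat).
Local Notation V := 'rV[R]_n.
Local Notation C0 := (Cc R n).
Implicit Types (mu : C0 -> R) (phi psi : C0) (E G : set V).

(* Neighbourhoods of 0 in the locally convex inductive limit of the Banach
   spaces {phi in C_0 | supp phi `<=` K}, K compact, with the sup norm: those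
   sets that contain an absolutely convex W whose trace on each of these spaces
   is a neighbourhood of 0. *)
Definition indlim_nbhs0 (U : set C0) :=
  exists W : set C0,
    [/\ W `<=` U,
        forall (a b : R) phi psi,
          `|a| + `|b| <= 1 -> W phi -> W psi -> W (a *: phi + b *: psi) &
        forall K : set V, compact K -> exists2 d : R, 0 < d &
          forall phi, fun_supp phi `<=` K -> (forall x, `|phi x| <= d) -> W phi].

Definition is_radon mu :=
  scalar mu /\ forall e : R, 0 < e -> indlim_nbhs0 [set phi | `|mu phi| < e].

(* |mu|(phi) for phi >= 0. *)
Definition total_variation mu phi : \bar R :=
  ereal_sup [set `|mu psi|%:E | psi in
    [set psi : C0 | forall x, `|psi x| <= phi x]].

(* |mu|(h) for h >= 0 lower semicontinuous. *)
Definition tv_lsc mu (h : V -> \bar R) : \bar R :=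
  ereal_sup [set total_variation mu phi | phi in
    [set phi : C0 | forall x, 0 <= phi x /\ ((phi x : R)%:E <= h x)%E]].

(* The upper integral of h >= 0 with respect to |mu|. *)
Definition tv_upper_integral mu (h : V -> \bar R) : \bar R :=
  ereal_inf [set tv_lsc mu k | k in
    [set k : V -> \bar R | lower_semicontinuous k /\ forall x, (h x <= k x)%E]].

Definition tv_open mu G : \bar R := tv_lsc mu (EFin \o \1_G).

(* |mu|^*; it extends the Borel measure |mu|. *)
Definition tv_outer mu E : \bar R :=
  ereal_inf [set tv_open mu G | G in [set G : set V | open G /\ E `<=` G]].

(* f is mu-integrable with \int f dmu = v: the integral is the extension of mu
   from C_0 by continuity for the seminorm \int^* |f| d|mu|. *)
Definition has_integral mu (f : V -> R) (v : R) :=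
  forall e : R, 0 < e -> exists phi : C0,
    (tv_upper_integral mu (fun x => `|f x - phi x|%:E) < e%:E)%E /\
    `|mu phi - v| < e.

End radon_measures.

Section capacitary_spaces.
Variables (R : realType) (n : nat).
Local Notation V := 'rV[R]_n.
(* In the theorem, C is the Bessel capacity. *)
Variable C : set V -> \bar R.

Definition norm_frakM (mu : Cc R n -> R) : \bar R :=
  ereal_sup [set (tv_outer mu K / C K)%E | K in
    [set K : set V | compact K /\ C K <> 0%E]].

Definition frakM (mu : Cc R n -> R) :=
  is_radon mu /\ (norm_frakM mu < +oo)%E.

Definition lorentz_norm (p q : R) (f : V -> R) : \bar R :=
  ((p `^ q^-1)%:E *
   (\int[lebesgue_measure]_(t in `]0%R, +oo[)
      (C [set x | (t < `|f x|)%R] `^ (q / p) * (t `^ q)%:E * (t^-1)%:E))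
     `^ q^-1)%E.

Definition lorentz (p q : R) (f : V -> R) := (lorentz_norm p q f < +oo)%E.

(* Functions are not quotiented by equality outside a set of capacity zero: a
   functional that is continuous for the quasi-norm factors through the
   quotient. *)
Definition lorentz_closure (p q : R) (f : V -> R) :=
  lorentz p q f /\ forall e : R, 0 < e ->
    exists phi : Cc R n, (lorentz_norm p q (fun x => f x - phi x)%R < e%:E)%E.

Definition is_dual (p q : R) (L : (V -> R) -> R) :=
  (forall (a : R) f g, lorentz_closure p q f -> lorentz_closure p q g ->
     L (fun x => a * f x + g x) = a * L f + L g) /\
  (forall f, lorentz_closure p q f -> forall e : R, 0 < e ->
     exists2 d : R, 0 < d & forall g, lorentz_closure p q g ->
       (lorentz_norm p q (fun x => g x - f x)%R < d%:E)%E -> `|L g - L f| < e).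

Definition dual_norm (p q : R) (L : (V -> R) -> R) : \bar R :=
  ereal_sup [set `|L f|%:E | f in
    [set f : V -> R | lorentz_closure p q f /\ (lorentz_norm p q f <= 1)%E]].

Definition represents (p q : R) (mu : Cc R n -> R) (L : (V -> R) -> R) :=
  forall f, lorentz_closure p q f -> has_integral mu f (L f).

Definition dual_is_frakM (p q : R) :=
  [/\ forall L, is_dual p q L ->
        exists! mu : Cc R n -> R, frakM mu /\ represents p q mu L,
      forall mu, frakM mu -> exists L, is_dual p q L /\ represents p q mu L &
      exists2 c : R, 0 < c &
        forall L mu, is_dual p q L -> frakM mu -> represents p q mu L ->
          ((c^-1)%:E * norm_frakM mu <= dual_norm p q L)%E /\
          (dual_norm p q L <= c%:E * norm_frakM mu)%E].

End capacitary_spaces.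

(* Main.v *)
(* The Bessel kernel is almost everywhere a mixture of heat kernels, as both have
   the same Fourier transform.  So it may be taken positive; potentials are then
   lower semicontinuous, which makes the capacity C outer regular, finite on
   compact sets and positive on sets with interior points.

   Let ||mu|| = M.  If phi <= 1_G with G open, then {phi >= eps} is compact and
   the part of phi below eps contributes little to |mu|(phi), so |mu|(G) <= M C(G),
   and outer regularity gives the second assertion.

   For a function h choose open sets G_k, slightly larger than {|h| > e^k} in
   capacity.  Since |h| is at most the sum over k in Z of e^(k+1) 1_(G_k),
     int^* |h| d|mu| <= M sum_k e^(k+1) C(|h| > e^k) <= c M ||h||_(1,q),
   where the last step uses l^q in l^1, i.e. q <= 1.  Hence mu extends from C_0 to
   the closure.  Conversely a continuous functional restricts to a Radon measure
   on C_0, and |psi| <= 1_G implies ||psi||_(1,q) <= q^(-1/q) C(G), which bounds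
   |mu|(G), hence ||mu||. *)

Require Import Defs.
From HB Require Import structures.
From mathcomp Require Import all_boot all_order all_algebra.
From mathcomp Require Import all_classical all_reals all_analysis.
From mathcomp Require Import measurable_realfun ring lra.
Set Implicit Arguments.
Unset Strict Implicit.
Unset Printing Implicit Defensive.

Import Order.TTheory GRing.Theory Num.Theory.
Import numFieldNormedType.Exports.

Local Open Scope classical_set_scope.
Local Open Scope ring_scope.

(** * Lebesgue measure on row vectors *)

(** The kernel is given only as a choice among the solutions of a Fourier identity, with default 0
    if there is none. Nothing can be said about potentials before both existence and L^1 uniqueness
    of a solution are known, and this is what the Fourier analysis is for. The mixture comes from
    writing (1 + |xi|^2)^(-alpha/2) as a normalised Gamma integral of t^(alpha/2 - 1) exp(- t (1 +
    |xi|^2)) and reading exp(- t |xi|^2) as the Fourier transform of a heat kernel. The mixture can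
    be infinite at a point; lower semicontinuity of potentials is therefore obtained before t is
    integrated out, from Fatou's lemma for an integrand that is continuous in the point. On the dual
    side |mu| is only a supremum over C_0. No Borel measure is constructed, so countable
    subadditivity of the upper integral has to come from continuous minorants and compactness. Since
    ||mu|| may be 0, the estimates are proved with an arbitrary positive bound a of ||mu|| in its
    place. *)

Section affine_line.
Context {R : realType}.
Local Notation mu := (@lebesgue_measure R).
Local Notation RR := (measurableTypeR R).

Lemma measurable_affine (a b : R) :
  measurable_fun [set: RR] ((fun x => a + b * x) : RR -> RR).
Proof. by apply: measurable_funD => //; exact: measurable_funM. Qed.

Lemma preimage_affine_itvoc (a b u v : R) : 0 < b ->
  (fun x : R => a + b * x) @^-1` `]u, v] = `](u - a) / b, (v - a) / b]%classic.
Proof.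
move=> b0; apply/seteqP; split => x /=; rewrite !in_itv/= ltr_pdivrMr// ler_pdivlMr//.
  by move=> /andP[? ?]; rewrite ltrBlDl lerBrDl (mulrC x) ; apply/andP.
by rewrite ltrBlDl lerBrDl (mulrC x).
Qed.

(** The image measure under x -> a + b x, multiplied by b, gives half-open intervals their length,
    so it is Lebesgue measure by uniqueness. *)
Lemma lebesgue_measure_affine_gt0 (a b : R) (A : set RR) : 0 < b ->
  measurable A -> mu ((fun x : R => a + b * x) @^-1` A) = ((b^-1)%:E * mu A)%E.
Proof.
move=> b0 mA.
have b0' : 0 <= b by exact: ltW.
pose nu := mscale (NngNum b0') (measure_function_pushforward__canonical__measure_function_Measure
  (lebesgue_measure : {measure set RR -> \bar R}) (@measurable_affine a b)).
have -> : mu A = nu A.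
  apply: lebesgue_measure_unique => // _ [[u v]] _ <-.
  rewrite -[RHS]/(b%:E * mu ((fun x => a + b * x)%R @^-1` `]u, v]%classic))%E.
  rewrite preimage_affine_itvoc//.
  rewrite !lebesgue_measure_itv/= !lte_fin.
  rewrite ltr_pM2r ?invr_gt0// ltrD2r.
  case: ifPn => _; last by rewrite mule0.
  by rewrite -EFinD -EFinM; congr (_%:E); field; rewrite gt_eqF.
rewrite -[nu A]/(b%:E * mu ((fun x => a + b * x)%R @^-1` A))%E muleA -EFinM mulVf ?gt_eqF//.
by rewrite mul1e.
Qed.

Lemma lebesgue_measure_affine (a b : R) (A : set RR) : b != 0 ->
  measurable A -> mu ((fun x : R => a + b * x) @^-1` A) = ((`|b|^-1)%:E * mu A)%E.
Proof.
move=> b0 mA; have [b1|b1|b1] := ltgtP b 0; last by rewrite b1 eqxx in b0.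
- rewrite -(lebesgue_measureN mA) /pushforward.
  rewrite -(@lebesgue_measure_affine_gt0 (- a) `|b|) ?normr_gt0//.
  + congr (mu _); apply/funext => x; rewrite /preimage/= ltr0_norm//.
    by congr (A _); ring.
  + have mN : measurable_fun setT (-%R : RR -> RR) by exact: measurable_funN.
    by rewrite -[X in measurable X]setTI; exact: mN.
- by rewrite lebesgue_measure_affine_gt0// gtr0_norm.
Qed.

Lemma ge0_integral_affine (a b : R) (f : RR -> \bar R) : b != 0 ->
  measurable_fun setT f -> (forall x, 0 <= f x)%E ->
  (\int[mu]_x f (a + b * x)%R = (`|b|^-1)%:E * \int[mu]_x f x)%E.
Proof.
move=> b0 mf f0.
have bi : 0 <= `|b|^-1 by rewrite invr_ge0.
have := @ge0_integral_pushforward _ _ _ _ R _ (@measurable_affine a b) mu setT f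
  measurableT mf (fun x _ => f0 x).
rewrite preimage_setT => <-.
rewrite -[X in (X%:E * _)%E]/((NngNum bi)%:num) -ge0_integral_mscale//.
apply: eq_measure_integral => [|mphi A mA _]; first exact: measurable_affine.
exact: lebesgue_measure_affine.
Qed.

End affine_line.

Section integral_rV.
Context {R : realType}.
Local Notation RR := (measurableTypeR R).
Implicit Types n : nat.

Lemma ge0_integral_rVS n (f : 'rV[R]_n.+1 -> \bar R) :
  measurable_fun setT f -> (forall x, 0 <= f x)%E ->
  (\int[lebesgue_rV R n.+1]_x f x =
   \int[lebesgue_measure]_a \int[lebesgue_rV R n]_y f (consrV (a, y)))%E.
Proof.
move=> mf f0 /=.
rewrite (ge0_integral_pushforward (@measurable_consrV R n) _ measurableT mf (fun x _ => f0 x)).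
rewrite preimage_setT.
rewrite (fubini_tonelli1 (f \o @consrV R n) _ (fun x => f0 _))//.
by apply: measurableT_comp => //; exact: measurable_consrV.
Qed.

Lemma ge0_integral_rV0 (f : 'rV[R]_0 -> \bar R) :
  measurable_fun setT f -> (forall x, 0 <= f x)%E ->
  (\int[lebesgue_rV R 0]_x f x = f 0%R)%E.
Proof. by move=> mf f0 /=; rewrite integral_dirac// diracT mul1e. Qed.

Lemma measurable_affine_rV n (x : 'rV[R]_n) (b : R) :
  measurable_fun setT (fun y : 'rV[R]_n => x + b *: y).
Proof.
apply: measurable_fun_rV => i.
under eq_fun do rewrite !mxE.
apply: measurable_funD => //; apply: measurable_funM => //.
exact: measurable_coord_rV.
Qed.

(** Induction on n: the first coordinate is split off by Tonelli and contributes one factor 1 / |b|.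
    The case b = -1 is invariance under reflections, b = 1 invariance under translations. *)
Lemma ge0_integral_affine_rV n (x : 'rV[R]_n) (b : R) (f : 'rV[R]_n -> \bar R) :
  b != 0 -> measurable_fun setT f -> (forall x, 0 <= f x)%E ->
  (\int[lebesgue_rV R n]_y f (x + b *: y)%R =
   (`|b|^-1 ^+ n)%:E * \int[lebesgue_rV R n]_y f y)%E.
Proof.
move=> b0; elim: n x f => [|n IH] x f mf f0.
  rewrite !ge0_integral_rV0// ?expr0 ?mul1e; last exact: measurableT_comp (measurable_affine_rV _ _).
  by congr f; apply/rowP; case.
have mfc a : measurable_fun setT (fun y : 'rV[R]_n => f (consrV (a, y))).
  apply: measurableT_comp => //; apply: measurableT_comp; first exact: measurable_consrV.
  exact: measurable_pair1.
rewrite ge0_integral_rVS//; last exact: measurableT_comp (measurable_affine_rV _ _).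
rewrite ge0_integral_rVS//.
pose g a := (\int[lebesgue_rV R n]_y f (consrV (a, y)))%E.
have mg : measurable_fun setT g.
  have mfc2 : measurable_fun setT (f \o @consrV R n).
    by apply: measurableT_comp => //; exact: measurable_consrV.
  exact: (measurable_fun_fubini_tonelli_F (f \o @consrV R n) mfc2 (fun x => f0 _)).
transitivity (\int[lebesgue_measure]_a ((`|b|^-1 ^+ n)%:E * g (x ord0 ord0 + b * a)%R))%E.
  apply: eq_integral => a _.
  rewrite /g -(IH (\row_i x ord0 (lift ord0 i)) (fun y => f (consrV (_, y))))//.
  apply: eq_integral => y _; congr f; apply/rowP => i.
  rewrite mxE [X in _ + X]mxE.
  case: (unliftP ord0 i) => [j|] ->; rewrite ?consrV0 ?consrVS//.
  by rewrite !mxE.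
have g0 a : (0 <= g a)%E by apply: integral_ge0.
have mga : measurable_fun setT (fun a : RR => g (x ord0 ord0 + b * a)).
  by apply: (measurableT_comp mg); exact: measurable_affine.
have k0 : (0 <= (`|b|^-1 ^+ n)%:E)%E by rewrite lee_fin exprn_ge0// invr_ge0.
transitivity ((`|b|^-1 ^+ n)%:E *
    \int[lebesgue_measure]_a g (x ord0 ord0 + b * a)%R)%E.
  exact: (ge0_integralZl lebesgue_measure measurableT mga (fun a _ => g0 _) k0).
rewrite (ge0_integral_affine _ b0 mg g0) muleA -EFinM.
by rewrite exprS mulrC.
Qed.

Lemma ge0_integral_subrV n (x : 'rV[R]_n) (f : 'rV[R]_n -> \bar R) :
  measurable_fun setT f -> (forall x, 0 <= f x)%E ->
  (\int[lebesgue_rV R n]_y f (x - y)%R = \int[lebesgue_rV R n]_y f y)%E.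
Proof.
move=> mf f0; transitivity (\int[lebesgue_rV R n]_y f (x + (-1) *: y)%R)%E.
  by apply: eq_integral => y _; rewrite scaleN1r.
by rewrite ge0_integral_affine_rV ?oppr_eq0 ?oner_eq0// normrN1 invr1 expr1n mul1e.
Qed.

End integral_rV.

(** * Fourier transform of Gaussians *)

Section gauss_line.
Context {R : realType}.
Local Notation mu := (@lebesgue_measure R).
Local Notation RR := (measurableTypeR R).

Lemma integral_expR_sqr (c : R) : 0 < c ->
  (\int[mu]_x (expR (- (c * x ^+ 2)))%:E = (Num.sqrt (pi / c))%:E)%E.
Proof.
move=> c0; have s0 : 0 < Num.sqrt c by rewrite sqrtr_gt0.
transitivity (\int[mu]_x (EFin \o gauss_fun) (0 + Num.sqrt c * x)%R)%E.
  apply: eq_integral => x _ /=; rewrite /gauss_fun add0r exprMn sqr_sqrtr//.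
  exact: ltW.
rewrite ge0_integral_affine ?gt_eqF//=.
- rewrite integralT_gauss -EFinM gtr0_norm// -sqrtrV ?ltW// -sqrtrM; last first.
    by rewrite invr_ge0 ltW.
  by rewrite mulrC.
- by apply/measurable_EFinP; exact: measurable_gauss_fun.
- by move=> x; rewrite lee_fin gauss_fun_ge0.
Qed.

Lemma measurable_expR_sqr (c : R) :
  measurable_fun [set: RR] (fun x : RR => expR (- (c * x ^+ 2))).
Proof.
apply: measurableT_comp => //; apply: measurable_funN.
apply: measurable_funM => //; exact: measurable_funX.
Qed.

Lemma integrable_expR_sqr (c : R) : 0 < c ->
  mu.-integrable setT (fun x => (expR (- (c * x ^+ 2)))%:E).
Proof.
move=> c0; apply/integrableP; split.
  by apply/measurable_EFinP; exact: measurable_expR_sqr.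
under eq_integral do rewrite /= ger0_norm ?expR_ge0//.
by rewrite integral_expR_sqr// ltry.
Qed.

(** Half of the exponent absorbs the factor |x|: exp(c x^2 / 2) >= 1 + c x^2 / 2, while |x| <= (1 +
    x^2) / 2. This serves both the integrability of x times a Gaussian and the decay of boundary
    terms. *)
Lemma norm_expR_sqr_le (c x : R) : 0 < c ->
  `|x| * expR (- (c * x ^+ 2)) <= (2^-1 + c^-1) * expR (- (c / 2 * x ^+ 2)).
Proof.
move=> c0.
have -> : - (c * x ^+ 2) = - (c / 2 * x ^+ 2) - (c / 2 * x ^+ 2) by field.
rewrite expRD mulrA ler_wpM2r ?expR_ge0//.
rewrite expRN ler_pdivrMr ?expR_gt0//.
apply: (@le_trans _ _ ((2^-1 + c^-1) * (1 + c / 2 * x ^+ 2))); last first.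
  by rewrite ler_wpM2l ?expR_ge1Dx// addr_ge0 ?invr_ge0 ?ltW.
have -> : (2^-1 + c^-1) * (1 + c / 2 * x ^+ 2) =
   (1 + x ^+ 2) / 2 + c^-1 + c / 4 * x ^+ 2 by field; rewrite gt_eqF.
have h : `|x| <= (1 + x ^+ 2) / 2.
  by rewrite -(real_normK (num_real x)); have := sqr_ge0 (1 - `|x|); nra.
rewrite -addrA; apply: (le_trans h); rewrite lerDl.
by rewrite addr_ge0 ?invr_ge0 ?(ltW c0)// mulr_ge0 ?sqr_ge0// divr_ge0// ltW.
Qed.

(** The fundamental theorem on [-N, N] leaves the boundary term F(N) - F(-N), of size at most 2 K /
    N; dominated convergence lets N tend to infinity. *)
Lemma Rintegral_derive_vanishing (F f : R -> R) (K : R) :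
  (forall x : R^o, is_derive x 1 F (f x)) -> continuous f ->
  mu.-integrable setT (EFin \o f) -> (forall x, `|x| * `|F x| <= K) ->
  \int[mu]_x f x = 0.
Proof.
move=> dF cf intf FK.
pose N n : R := n.+1%:R.
have mfE : measurable_fun [set: RR] (EFin \o f) by exact: measurable_int intf.
pose f_ n := (EFin \o f) \_ `[- N n, N n].
have mI n : measurable (`[- N n, N n]%classic : set RR) by exact: measurable_itv.
have [] := @dominated_convergence _ _ R mu setT measurableT f_ (EFin \o f) (abse \o (EFin \o f)).
- by move=> n; exact: (measurable_restrictT _ (mI n)).1 (measurable_funTS mfE).
- exact: mfE.
- apply/aeW => x _; apply: cvg_near_cst.
  near=> n; rewrite /f_ patchE mem_set//= in_itv/= -ler_norml.
  have : `|x| <= n%:R by near: n; exact: nbhs_infty_ger.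
  by move=> h; apply: (le_trans h); rewrite ler_nat.
- exact: integrable_abse.
- apply/aeW => x n _; rewrite /f_ patchE; case: ifPn => // _.
  rewrite -[point]/(0%E : \bar R) abse0; exact: abse_ge0.
move=> _ _ /= cv.
have ctF : continuous F.
  by move=> x; apply/differentiable_continuous/derivable1_diffP; exact: ex_derive.
have FE n : (\int[mu]_x f_ n x = (F (N n) - F (- N n))%:E)%E.
  rewrite /f_ -integral_mkcond EFinB; apply: continuous_FTC2.
  - by rewrite /N gtrN.
  - exact: continuous_subspaceT.
  - split; first by move=> x _; exact: ex_derive.
    + exact/cvg_at_right_filter/ctF.
    + exact/cvg_at_left_filter/ctF.
  - by move=> x _; rewrite derive1E (@derive_val _ _ _ _ _ _ _ (dF x)).
have FN0 : (F (N n) - F (- N n)) @[n --> \oo] --> (0 : R).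
  apply: norm_cvg0.
  apply: (@squeeze_cvgr _ _ _ _ (cst 0) (fun n => K *+ 2 * harmonic n)).
  - apply/nearW => n; rewrite normr_ge0/= ler_pdivlMr ?ltr0n//.
    have a := FK (N n); have b := FK (- N n).
    rewrite normrN in b; rewrite /N ger0_norm// in a b.
    apply: (le_trans (ler_wpM2r _ (ler_normB _ _))) => //.
    by rewrite mulrDl mulr2n lerD// mulrC.
  - exact: cvg_cst.
  - rewrite -[X in _ --> X](mulr0 (K *+ 2)); apply: cvgMr.
    exact: cvg_harmonic.
rewrite /Rintegral; have -> : (\int[mu]_x (f x)%:E)%E = 0%E; last by [].
apply: (cvg_unique _ cv) => //.
rewrite /= (_ : (fun n => _) = (fun n => (F (N n) - F (- N n))%:E)); last exact/funext.
by apply: cvg_EFin; [exact: nearW|exact: FN0].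
Unshelve. all: end_near.
Qed.

Lemma is_derive_expR_sqr (c x : R) :
  is_derive (x : R^o) 1 (fun x => expR (- (c * x ^+ 2)))
    (- (2 * c * x) * expR (- (c * x ^+ 2))).
Proof.
have h : is_derive (x : R^o) 1 (fun x : R => - (c * x ^+ 2)) (- (2 * c * x)).
  apply: is_derive_eq; rewrite /= !scaler1 /GRing.scale/=; ring.
by have := @is_derive1_comp R expR _ x _ _ (is_derive_expR _) h; rewrite mulrC.
Qed.

Lemma is_derive_cosM (k x : R) :
  is_derive (x : R^o) 1 (fun x => cos (k * x)) (- (k * sin (k * x))).
Proof.
have h : is_derive (x : R^o) 1 (fun x : R => k * x) k.
  by apply: is_derive_eq; rewrite /= scaler1.
by have := is_derive1_comp (is_derive_cos (k * x)) h; rewrite mulNr mulrC.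
Qed.

Lemma is_derive_sinM (k x : R) :
  is_derive (x : R^o) 1 (fun x => sin (k * x)) (k * cos (k * x)).
Proof.
have h : is_derive (x : R^o) 1 (fun x : R => k * x) k.
  by apply: is_derive_eq; rewrite /= scaler1.
by have := is_derive1_comp (is_derive_sin (k * x)) h; rewrite mulrC.
Qed.

Lemma measurable_cosM (k : R) : measurable_fun [set: RR] (fun x : RR => cos (k * x)).
Proof.
apply: measurableT_comp; last exact: measurable_funM.
by apply: continuous_measurable_fun; exact: continuous_cos.
Qed.

Lemma measurable_sinM (k : R) : measurable_fun [set: RR] (fun x : RR => sin (k * x)).
Proof.
apply: measurableT_comp; last exact: measurable_funM.
by apply: continuous_measurable_fun; exact: continuous_sin.
Qed.

Lemma integrable_dominated d (T : measurableType d) (m : {measure set T -> \bar R})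
    (f g : T -> R) : measurable_fun setT f -> (forall x, `|f x| <= g x) ->
  m.-integrable setT (EFin \o g) -> m.-integrable setT (EFin \o f).
Proof.
move=> mf fg; apply: le_integrable => //; first exact/measurable_EFinP.
move=> x _ /=; rewrite lee_fin; apply: (le_trans (fg x)); exact: ler_norm.
Qed.

Section integrable_real.
Context d (T : measurableType d) (m : {measure set T -> \bar R}).
Implicit Types f g : T -> R.

Lemma integrable_mulrl (k : R) f : m.-integrable setT (EFin \o f) ->
  m.-integrable setT (EFin \o (fun x => k * f x)).
Proof.
move=> intf; rewrite (_ : EFin \o _ = (fun x => k%:E * (EFin \o f) x)%E)//.
exact: integrableZl.
Qed.

Lemma integrable_addr f g : m.-integrable setT (EFin \o f) ->
  m.-integrable setT (EFin \o g) -> m.-integrable setT (EFin \o (fun x => f x + g x)).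
Proof.
move=> intf intg.
rewrite (_ : EFin \o _ = (fun x => (EFin \o f) x + (EFin \o g) x)%E)//.
exact: integrableD.
Qed.

Lemma integrable_subr f g : m.-integrable setT (EFin \o f) ->
  m.-integrable setT (EFin \o g) -> m.-integrable setT (EFin \o (fun x => f x - g x)).
Proof.
move=> intf intg.
rewrite (_ : EFin \o _ = (fun x => (EFin \o f) x - (EFin \o g) x)%E)//.
exact: integrableB.
Qed.

End integrable_real.

Lemma integrable_expR_sqrM (c : R) (h : R -> R) : 0 < c ->
  measurable_fun [set: RR] (h : RR -> R) -> (forall x, `|h x| <= 1) ->
  mu.-integrable setT (EFin \o (fun x => expR (- (c * x ^+ 2)) * h x)).
Proof.
move=> c0 mh h1.
apply: (integrable_dominated _ _ (integrable_expR_sqr c0)).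
  by apply: measurable_funM => //; exact: measurable_expR_sqr.
by move=> x; rewrite normrM (ger0_norm (expR_ge0 _)) ler_piMr ?expR_ge0.
Qed.

Lemma integrable_mul_expR_sqr (c : R) (h : R -> R) : 0 < c ->
  measurable_fun [set: RR] (h : RR -> R) -> (forall x, `|h x| <= `|x|) ->
  mu.-integrable setT (EFin \o (fun x => expR (- (c * x ^+ 2)) * h x)).
Proof.
move=> c0 mh h1; have c20 : 0 < c / 2 by rewrite divr_gt0.
apply: (@integrable_dominated _ _ mu _
  (fun x : RR => (2^-1 + c^-1) * expR (- (c / 2 * x ^+ 2)))).
- by apply: measurable_funM => //; exact: measurable_expR_sqr.
- move=> x; rewrite normrM (ger0_norm (expR_ge0 _)) mulrC.
  by apply: le_trans (norm_expR_sqr_le x c0); rewrite ler_wpM2r ?expR_ge0.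
- by apply: integrable_mulrl; exact: integrable_expR_sqr.
Qed.

Lemma norm_cos_le1 (x : R) : `|cos x| <= 1.
Proof. by rewrite ler_norml cos_geN1 cos_le1. Qed.

Lemma norm_sin_le1 (x : R) : `|sin x| <= 1.
Proof. by rewrite ler_norml sin_geN1 sin_le1. Qed.

End gauss_line.

Section gauss_fourier.
Context {R : realType}.
Local Notation mu := (@lebesgue_measure R).
Local Notation RR := (measurableTypeR R).
Variable c : R.
Hypothesis c0 : 0 < c.

Let gcos (k : R) := fun x : R => expR (- (c * x ^+ 2)) * cos (k * x).
Let gsin (k : R) := fun x : R => expR (- (c * x ^+ 2)) * sin (k * x).

Lemma integrable_gcos k : mu.-integrable setT (EFin \o gcos k).
Proof.
apply: integrable_expR_sqrM => //; first exact: measurable_cosM.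
by move=> x; exact: norm_cos_le1.
Qed.

Lemma integrable_gsin k : mu.-integrable setT (EFin \o gsin k).
Proof.
apply: integrable_expR_sqrM => //; first exact: measurable_sinM.
by move=> x; exact: norm_sin_le1.
Qed.

Let xgsin (k : R) := fun x : R => expR (- (c * x ^+ 2)) * (x * sin (k * x)).
Let xgcos (k : R) := fun x : R => expR (- (c * x ^+ 2)) * (x * cos (k * x)).

Let integrable_xgsin k : mu.-integrable setT (EFin \o xgsin k).
Proof.
apply: integrable_mul_expR_sqr => //.
  by apply: measurable_funM => //; exact: measurable_sinM.
by move=> x; rewrite normrM ler_piMr// norm_sin_le1.
Qed.

Let integrable_xgcos k : mu.-integrable setT (EFin \o xgcos k).
Proof.
apply: integrable_mul_expR_sqr => //.
  by apply: measurable_funM => //; exact: measurable_cosM.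
by move=> x; rewrite normrM ler_piMr// norm_cos_le1.
Qed.

Let expR_sqr_vanishing (h : R -> R) : (forall x, `|h x| <= 1) ->
  forall x, `|x| * `|expR (- (c * x ^+ 2)) * h x| <= 2^-1 + c^-1.
Proof.
move=> h1 x; rewrite normrM (ger0_norm (expR_ge0 _)) mulrA.
apply: (@le_trans _ _ (`|x| * expR (- (c * x ^+ 2)))).
  by rewrite ler_piMr// mulr_ge0// expR_ge0.
apply: (le_trans (norm_expR_sqr_le x c0)).
rewrite ler_piMr ?addr_ge0 ?invr_ge0 ?(ltW c0)// -expR0 ler_expR oppr_le0.
by rewrite mulr_ge0 ?sqr_ge0// divr_ge0// ltW.
Qed.

Let continuous_expR_sqr : continuous (fun x : R => expR (- (c * x ^+ 2))).
Proof.
move=> x; apply/differentiable_continuous/derivable1_diffP.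
exact: (@ex_derive _ _ _ _ _ _ _ (is_derive_expR_sqr c x)).
Qed.

Let continuous_cosM k : continuous (fun x : R => cos (k * x)).
Proof.
move=> x; apply/differentiable_continuous/derivable1_diffP.
exact: (@ex_derive _ _ _ _ _ _ _ (is_derive_cosM k x)).
Qed.

Let continuous_sinM k : continuous (fun x : R => sin (k * x)).
Proof.
move=> x; apply/differentiable_continuous/derivable1_diffP.
exact: (@ex_derive _ _ _ _ _ _ _ (is_derive_sinM k x)).
Qed.

(** The derivative of exp(- c x^2) sin(k x) is k [gcos] - 2 c [xgsin], and its integral vanishes. *)
Lemma Rintegral_xgsin k :
  \int[mu]_x xgsin k x = k / (2 * c) * \int[mu]_x gcos k x.
Proof.
pose f x := k * gcos k x - 2 * c * xgsin k x.
have i1 : mu.-integrable setT (EFin \o (fun x => k * gcos k x)).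
  by apply: integrable_mulrl; exact: integrable_gcos.
have i2 : mu.-integrable setT (EFin \o (fun x => 2 * c * xgsin k x)).
  exact: integrable_mulrl.
have intf : mu.-integrable setT (EFin \o f) by exact: integrable_subr.
have : \int[mu]_x f x = 0.
  apply: (@Rintegral_derive_vanishing _ (gsin k) f (2^-1 + c^-1)) => //.
  - move=> x; have := @is_deriveM R _ _ _ x 1 _ _ (is_derive_expR_sqr c x)
      (is_derive_sinM k x).
    move=> /is_derive_eq; apply; rewrite /f /gcos /xgsin /GRing.scale/=; ring.
  - move=> x; apply: cvgB.
      by apply: cvgMr; apply: cvgM; [exact: continuous_expR_sqr|exact: continuous_cosM].
    apply: cvgMr; apply: cvgM; first exact: continuous_expR_sqr.
    by apply: cvgM => //; exact: continuous_sinM.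
  - by apply: expR_sqr_vanishing => x; exact: norm_sin_le1.
rewrite RintegralB// !RintegralZl//; last exact: integrable_gcos.
by move=> /eqP; rewrite subr_eq0 => /eqP h; rewrite mulrAC h; field; rewrite gt_eqF.
Qed.

Lemma Rintegral_xgcos k :
  \int[mu]_x xgcos k x = - (k / (2 * c)) * \int[mu]_x gsin k x.
Proof.
pose f x := - k * gsin k x - 2 * c * xgcos k x.
have i1 : mu.-integrable setT (EFin \o (fun x => - k * gsin k x)).
  by apply: integrable_mulrl; exact: integrable_gsin.
have i2 : mu.-integrable setT (EFin \o (fun x => 2 * c * xgcos k x)).
  exact: integrable_mulrl.
have intf : mu.-integrable setT (EFin \o f) by exact: integrable_subr.
have : \int[mu]_x f x = 0.
  apply: (@Rintegral_derive_vanishing _ (gcos k) f (2^-1 + c^-1)) => //.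
  - move=> x; have := @is_deriveM R _ _ _ x 1 _ _ (is_derive_expR_sqr c x)
      (is_derive_cosM k x).
    move=> /is_derive_eq; apply; rewrite /f /gsin /xgcos /GRing.scale/=; ring.
  - move=> x; apply: cvgB.
      by apply: cvgMr; apply: cvgM; [exact: continuous_expR_sqr|exact: continuous_sinM].
    apply: cvgMr; apply: cvgM; first exact: continuous_expR_sqr.
    by apply: cvgM => //; exact: continuous_cosM.
  - by apply: expR_sqr_vanishing => x; exact: norm_cos_le1.
rewrite RintegralB// !RintegralZl//; last exact: integrable_gsin.
by move=> /eqP; rewrite subr_eq0 => /eqP h; rewrite -mulNr mulrAC h; field; rewrite gt_eqF.
Qed.

Let is_derive_Rintegral (f df : R -> R -> R) (G : R -> R) (k : R) :
  (forall k, mu.-integrable setT (EFin \o f k)) ->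
  (forall k x : R, is_derive (k : R^o) 1 (f ^~ x) (df k x)) ->
  mu.-integrable setT (EFin \o G) -> (forall k x, `|df k x| <= G x) ->
  is_derive (k : R^o) 1 (fun k => \int[mu]_x f k x) (\int[mu]_x df k x).
Proof.
move=> intf dfP intG dfG.
have G0 x : 0 <= G x by apply: le_trans (dfG 0 x).
(* The bound [G] does not depend on the parameter, so the size of this neighbourhood is
   immaterial. *)
have kI : `](k - 1), (k + 1)[%classic k.
  by rewrite /= in_itv/= gtrBl ltrDl ltr01.
have d1 k' x : partial1of2 f k' x = df k' x.
  by rewrite partial1of2E (@derive_val _ _ _ _ _ _ _ (dfP k' x)).
have dd (k' : R) (x : RR) : `](k - 1), (k + 1)[%classic k' -> setT x -> derivable (f ^~ x) k' 1.
  by move=> _ _; exact: ex_derive.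
have db (k' : R) (x : RR) : `](k - 1), (k + 1)[%classic k' -> setT x ->
  `|partial1of2 f k' x| <= G x by move=> _ _; rewrite d1.
have := differentiation_under_integral measurableT kI (fun k' _ => intf k') dd G0 intG db.
have dble := derivable_under_integral measurableT kI (fun k' _ => intf k') dd G0 intG db.
rewrite derive1E => e; apply: DeriveDef => //.
by rewrite e; apply: eq_Rintegral => x _; rewrite d1.
Qed.

Let heat_ode_unique (J : R -> R) :
  (forall k, is_derive (k : R^o) 1 J (- (k / (2 * c)) * J k)) ->
  forall k, J k = J 0 * expR (- (k ^+ 2 / (4 * c))).
Proof.
move=> dJ k.
(* Integrating factor exp(x^2 / (4 c)), written as a Gaussian of negative rate so that
   [is_derive_expR_sqr] applies. *)
pose E x := J x * expR (- (- (4 * c)^-1 * x ^+ 2)).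
have dE (x : R) : is_derive (x : R^o) (1 : R) E 0.
  have := @is_deriveM R _ _ _ x 1 _ _ (dJ x) (is_derive_expR_sqr (- (4 * c)^-1) x).
  by move=> /is_derive_eq; apply; rewrite /GRing.scale/=; field; rewrite gt_eqF.
have := is_derive_0_is_cst k 0 dE.
rewrite /E expr0n/= mulr0 oppr0 expR0 mulr1 => <-.
rewrite -mulrA -expRD (_ : _ + _ = 0) ?expR0 ?mulr1//.
by field; rewrite gt_eqF.
Qed.

(** As a function of k the integral solves J' = - k / (2 c) J: differentiate under the integral
    sign, then integrate by parts. Its value at k = 0 is the Gaussian integral. *)
Lemma Rintegral_gcos k :
  \int[mu]_x gcos k x = Num.sqrt (pi / c) * expR (- (k ^+ 2 / (4 * c))).
Proof.
have dJ j : is_derive (j : R^o) 1 (fun k => \int[mu]_x gcos k x)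
    (- (j / (2 * c)) * \int[mu]_x gcos j x).
  rewrite mulNr -Rintegral_xgsin.
  have -> : - (\int[mu]_x xgsin j x) = \int[mu]_x (- xgsin j x).
    rewrite -[LHS]mulN1r -RintegralZl//; apply: eq_Rintegral => x _.
    by rewrite mulN1r.
  apply: (@is_derive_Rintegral gcos (fun k x => - xgsin k x)
    (fun x => expR (- (c * x ^+ 2)) * `|x|)).
  - exact: integrable_gcos.
  - move=> {}j x; have := is_deriveZ (expR (- (c * x ^+ 2))) (is_derive_cosM x j).
    rewrite (_ : gcos^~ x = expR (- (c * x ^+ 2)) \*: (fun y => cos (x * y))).
      by move=> /is_derive_eq; apply; rewrite /xgsin (mulrC x j) /GRing.scale/= mulrN.
    by apply/funext => y; rewrite /gcos (mulrC y).
  - by apply: integrable_mul_expR_sqr => // x; rewrite normr_id.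
  - move=> {}j x; rewrite normrN /xgsin !normrM (ger0_norm (expR_ge0 _)).
    by rewrite ler_wpM2l ?expR_ge0// ler_piMr// norm_sin_le1.
rewrite (heat_ode_unique dJ).
congr (_ * _); rewrite /Rintegral -[RHS]/(fine (Num.sqrt (pi / c))%:E).
rewrite -integral_expR_sqr//; congr fine; apply: eq_integral => x _.
by rewrite /gcos mul0r cos0 mulr1.
Qed.

(** The same differential equation, now with J(0) = 0. *)
Lemma Rintegral_gsin k : \int[mu]_x gsin k x = 0.
Proof.
have dJ j : is_derive (j : R^o) 1 (fun k => \int[mu]_x gsin k x)
    (- (j / (2 * c)) * \int[mu]_x gsin j x).
  rewrite -Rintegral_xgcos.
  apply: (@is_derive_Rintegral gsin (fun k x => xgcos k x)
    (fun x => expR (- (c * x ^+ 2)) * `|x|)).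
  - exact: integrable_gsin.
  - move=> {}j x; have := is_deriveZ (expR (- (c * x ^+ 2))) (is_derive_sinM x j).
    rewrite (_ : gsin^~ x = expR (- (c * x ^+ 2)) \*: (fun y => sin (x * y))).
      by move=> /is_derive_eq; apply; rewrite /xgcos (mulrC x j).
    by apply/funext => y; rewrite /gsin (mulrC y).
  - by apply: integrable_mul_expR_sqr => // x; rewrite normr_id.
  - move=> {}j x; rewrite /xgcos !normrM (ger0_norm (expR_ge0 _)).
    by rewrite ler_wpM2l ?expR_ge0// ler_piMr// norm_cos_le1.
rewrite (heat_ode_unique dJ).
rewrite [X in X * _](_ : _ = 0) ?mul0r// /Rintegral.
under eq_integral do rewrite /gsin mul0r sin0 mulr0.
by rewrite integral0.
Qed.

End gauss_fourier.

Section integral_rV_signed.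
Context {R : realType}.
Local Notation RR := (measurableTypeR R).

Lemma integral_rVS n (f : 'rV[R]_n.+1 -> \bar R) :
  (lebesgue_rV R n.+1).-integrable setT f ->
  (\int[lebesgue_rV R n.+1]_x f x =
   \int[lebesgue_measure]_a \int[lebesgue_rV R n]_y f (consrV (a, y)))%E.
Proof.
move=> intf; have mf : measurable_fun setT f by exact: measurable_int intf.
have intfc : (lebesgue_measure \x lebesgue_rV R n)%E.-integrable setT (f \o @consrV R n).
  apply/integrableP; split.
    by apply: measurableT_comp => //; exact: measurable_consrV.
  have /integrableP[_] := intf.
  have maf : measurable_fun setT (abse \o f) by exact: measurableT_comp.
  by rewrite /= (ge0_integral_pushforward (@measurable_consrV R n) _ measurableT maf (fun x _ => abse_ge0 _)) preimage_setT.
rewrite /= (integral_pushforward (@measurable_consrV R n) mf) ?preimage_setT//.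
exact: (esym (integral12_prod_meas1 intfc)).
Qed.

Lemma integrable_rV_prod n (g : R -> R) (h : 'rV[R]_n -> R) :
  lebesgue_measure.-integrable [set: RR] (EFin \o g) ->
  (lebesgue_rV R n).-integrable setT (EFin \o h) ->
  (lebesgue_rV R n.+1).-integrable setT
    (EFin \o (fun x : 'rV[R]_n.+1 => g (x ord0 ord0) * h (unconsrV x).2)).
Proof.
move=> ig ih.
have mg : measurable_fun [set: RR] (g : RR -> RR).
  by apply/measurable_EFinP; exact: measurable_int ig.
have mh : measurable_fun setT h.
  by apply/measurable_EFinP; exact: measurable_int ih.
have mgh : measurable_fun setT (fun x : 'rV[R]_n.+1 => g (x ord0 ord0) * h (unconsrV x).2).
  apply: measurable_funM.
    apply: (@measurableT_comp _ _ _ _ _ _ g) => //; exact: measurable_coord_rV.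
  apply: measurableT_comp => //; apply: measurableT_comp => //.
  exact: measurable_unconsrV.
apply/integrableP; split; first exact/measurable_EFinP.
rewrite ge0_integral_rVS//; last by apply: measurableT_comp => //; exact/measurable_EFinP.
have /integrableP[_ iih] := ih; have /integrableP[_ iig] := ig.
have E a : (\int[lebesgue_rV R n]_y `|(EFin \o (fun x : 'rV[R]_n.+1 => g (x ord0 ord0) * h (unconsrV x).2)%R) (consrV (a, y))| =
   (\int[lebesgue_rV R n]_y `|(EFin \o h) y|) * `|(g a)%:E|)%E.
  rewrite muleC -ge0_integralZl//; last by do 2 apply: measurableT_comp => //.
  by apply: eq_integral => y _; rewrite /comp consrVK consrV0 /= normrM EFinM.
under eq_integral do rewrite E.
rewrite ge0_integralZl//; last 2 first.
  by do 2 apply: measurableT_comp => //.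
  by apply: integral_ge0.
by rewrite lte_mul_pinfty ?integral_ge0// ge0_fin_numE ?integral_ge0.
Qed.

Lemma Rintegral_rV_prod n (g : R -> R) (h : 'rV[R]_n -> R) :
  lebesgue_measure.-integrable [set: RR] (EFin \o g) ->
  (lebesgue_rV R n).-integrable setT (EFin \o h) ->
  \int[lebesgue_rV R n.+1]_x (g (x ord0 ord0) * h (unconsrV x).2) =
  (\int[lebesgue_measure]_x g x) * \int[lebesgue_rV R n]_x h x.
Proof.
move=> ig ih; rewrite {1}/Rintegral (integral_rVS (integrable_rV_prod ig ih)).
have E a : (\int[lebesgue_rV R n]_y (EFin \o (fun x : 'rV[R]_n.+1 => g (x ord0 ord0) * h (unconsrV x).2)%R) (consrV (a, y)) =
   (\int[lebesgue_rV R n]_x h x)%:E * (g a)%:E)%E.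
  rewrite muleC [in RHS]/Rintegral fineK ?integrable_fin_num//.
  rewrite -integralZl//; apply: eq_integral => y _.
  by rewrite /comp consrVK consrV0 EFinM.
under eq_integral do rewrite E.
rewrite integralZl// fineM ?integrable_fin_num//.
by rewrite mulrC.
Qed.

End integral_rV_signed.

Section dotrV.
Context {R : realType}.

Lemma dotrV_cons n a (y : 'rV[R]_n) (xi : 'rV[R]_n.+1) :
  dotrV (consrV (a, y)) xi = a * xi ord0 ord0 + dotrV y (unconsrV xi).2.
Proof.
rewrite /dotrV big_ord_recl consrV0; congr (_ + _).
by apply: eq_bigr => i _; rewrite consrVS mxE.
Qed.

Lemma dotrV_consC n (x xi : 'rV[R]_n.+1) :
  dotrV x xi = x ord0 ord0 * xi ord0 ord0 + dotrV (unconsrV x).2 (unconsrV xi).2.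
Proof.
have := dotrV_cons (x ord0 ord0) (unconsrV x).2 xi.
by rewrite -[(x ord0 ord0, _)]/(unconsrV x) unconsrVK.
Qed.

Lemma dotrVC n (x y : 'rV[R]_n) : dotrV x y = dotrV y x.
Proof. by apply: eq_bigr => i _; rewrite mulrC. Qed.

Lemma dotrV_ge0 n (x : 'rV[R]_n) : 0 <= dotrV x x.
Proof. by apply: sumr_ge0 => i _; rewrite -expr2 sqr_ge0. Qed.

Lemma dotrV0l n (x : 'rV[R]_n) : dotrV 0 x = 0.
Proof. by rewrite /dotrV big1// => i _; rewrite mxE mul0r. Qed.

Lemma dotrVDl n (x y z : 'rV[R]_n) : dotrV (x + y) z = dotrV x z + dotrV y z.
Proof. by rewrite /dotrV -big_split/=; apply: eq_bigr => i _; rewrite mxE mulrDl. Qed.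

Lemma dotrVNl n (x y : 'rV[R]_n) : dotrV (- x) y = - dotrV x y.
Proof. by rewrite /dotrV -sumrN; apply: eq_bigr => i _; rewrite mxE mulNr. Qed.

Lemma dotrVBl n (x y z : 'rV[R]_n) : dotrV (x - y) z = dotrV x z - dotrV y z.
Proof. by rewrite dotrVDl dotrVNl. Qed.

Lemma dotrVZl n a (x y : 'rV[R]_n) : dotrV (a *: x) y = a * dotrV x y.
Proof. by rewrite /dotrV big_distrr/=; apply: eq_bigr => i _; rewrite mxE mulrA. Qed.

Lemma measurable_dotrV d (T : measurableType d) n (f g : T -> 'rV[R]_n) :
  measurable_fun setT f -> measurable_fun setT g ->
  measurable_fun setT (fun t => dotrV (f t) (g t)).
Proof.
move=> mf mg; apply: measurable_sum => i; apply: measurable_funM.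
  exact: (measurableT_comp (measurable_coord_rV i) mf).
exact: (measurableT_comp (measurable_coord_rV i) mg).
Qed.

End dotrV.

Section gauss_fourier_rV.
Context {R : realType}.
Variables (c : R).
Hypothesis c0 : 0 < c.
Local Notation leb n := (lebesgue_rV R n).

Let G n (x : 'rV[R]_n) := expR (- (c * dotrV x x)).

Lemma measurable_expR_dotrV n : measurable_fun setT (@G n).
Proof.
apply: measurableT_comp => //; apply: measurable_funN.
by apply: measurable_funM => //; exact: measurable_dotrV.
Qed.

Let GS n (x : 'rV[R]_n.+1) :
  G x = expR (- (c * x ord0 ord0 ^+ 2)) * G (unconsrV x).2.
Proof. by rewrite /G -expRD (dotrV_consC x x) -expr2 mulrDr opprD. Qed.

(** The four assertions go through the induction together: the addition formulas express the cosine
    and the sine of x . xi by products of those of the first coordinate and of the rest, mixing the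
    two. *)
Lemma gauss_fourier_rV n (xi : 'rV[R]_n) :
  [/\ (leb n).-integrable setT (EFin \o (fun x => G x * cos (dotrV x xi))),
      \int[leb n]_x (G x * cos (dotrV x xi)) =
        Num.sqrt (pi / c) ^+ n * expR (- (dotrV xi xi / (4 * c))),
      (leb n).-integrable setT (EFin \o (fun x => G x * sin (dotrV x xi))) &
      \int[leb n]_x (G x * sin (dotrV x xi)) = 0].
Proof.
elim: n xi => [|n IH] xi.
  have z (x y : 'rV[R]_0) : dotrV x y = 0 by rewrite /dotrV big_ord0.
  have i0 (k : R) : (leb 0).-integrable setT (EFin \o (fun x => k)).
    apply/integrableP; split; first exact: measurable_cst.
    by rewrite ge0_integral_rV0//= ltry.
  have r0 (k : R) : \int[leb 0]_x k = k.
    by rewrite /Rintegral/= integral_dirac// diracT mul1e.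
  rewrite (_ : (fun x => G x * cos _) = cst 1); last first.
    by apply/funext => x; rewrite /G !z mulr0 oppr0 expR0 cos0 mulr1.
  rewrite (_ : (fun x => G x * sin _) = cst 0); last first.
    by apply/funext => x; rewrite /G !z sin0 mulr0.
  split; [exact: i0| |exact: i0|].
    by rewrite -[LHS]/(\int[leb 0]_x 1) r0 z mul0r oppr0 expR0 expr0 mulr1.
  by rewrite -[LHS]/(\int[leb 0]_x 0) r0.
have [ic vc is_ vs] := IH (unconsrV xi).2.
set k := xi ord0 ord0.
have gc := integrable_gcos c0 k; have gs := integrable_gsin c0 k.
have pcc := integrable_rV_prod gc ic; have pss := integrable_rV_prod gs is_.
have psc := integrable_rV_prod gs ic; have pcs := integrable_rV_prod gc is_.
have -> : (fun x : 'rV[R]_n.+1 => G x * cos (dotrV x xi)) = (fun x : 'rV[R]_n.+1 =>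
   (expR (- (c * x ord0 ord0 ^+ 2)) * cos (k * x ord0 ord0)) *
     (G (unconsrV x).2 * cos (dotrV (unconsrV x).2 (unconsrV xi).2)) -
   (expR (- (c * x ord0 ord0 ^+ 2)) * sin (k * x ord0 ord0)) *
     (G (unconsrV x).2 * sin (dotrV (unconsrV x).2 (unconsrV xi).2))).
  apply/funext => x; rewrite GS (dotrV_consC x xi) cosD (mulrC _ k); ring.
have -> : (fun x : 'rV[R]_n.+1 => G x * sin (dotrV x xi)) = (fun x : 'rV[R]_n.+1 =>
   (expR (- (c * x ord0 ord0 ^+ 2)) * sin (k * x ord0 ord0)) *
     (G (unconsrV x).2 * cos (dotrV (unconsrV x).2 (unconsrV xi).2)) +
   (expR (- (c * x ord0 ord0 ^+ 2)) * cos (k * x ord0 ord0)) *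
     (G (unconsrV x).2 * sin (dotrV (unconsrV x).2 (unconsrV xi).2))).
  apply/funext => x; rewrite GS (dotrV_consC x xi) sinD (mulrC _ k); ring.
split.
- exact: integrable_subr.
- rewrite RintegralB// (Rintegral_rV_prod gc ic) (Rintegral_rV_prod gs is_) vs mulr0 subr0.
  have -> : dotrV xi xi / (4 * c) = k ^+ 2 / (4 * c) +
      dotrV (unconsrV xi).2 (unconsrV xi).2 / (4 * c).
    by rewrite -mulrDl expr2 -(dotrV_consC xi xi).
  rewrite vc Rintegral_gcos// [_ ^+ n.+1]exprS opprD expRD.
  by ring.
- exact: integrable_addr.
- rewrite RintegralD// (Rintegral_rV_prod gs ic) (Rintegral_rV_prod gc is_) vs mulr0 addr0.
  by rewrite Rintegral_gsin// mul0r.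
Qed.

Lemma integral_expR_dotrV n :
  (\int[leb n]_x (G x)%:E = (Num.sqrt (pi / c) ^+ n)%:E)%E.
Proof.
have [h + _ _] := gauss_fourier_rV (0 : 'rV[R]_n); rewrite dotrV0l mul0r oppr0 expR0 mulr1 => <-.
rewrite /Rintegral fineK; last exact: integrable_fin_num.
by apply: eq_integral => x _; rewrite dotrVC dotrV0l cos0 mulr1.
Qed.

End gauss_fourier_rV.

(** * Gaussian mixtures and the Bessel weight *)

Section gauss_mixture.
Context {R : realType}.
Local Notation RR := (measurableTypeR R).
Local Notation mu := (@lebesgue_measure R).
Variable n : nat.
Local Notation V := 'rV[R]_n.
Local Notation leb := (lebesgue_rV R n).

(** The Gaussian of rate c normalised to mass one, that is, the heat kernel at time 1 / (4 c). *)
Definition heat (c : R) (x : V) : R := Num.sqrt (c / pi) ^+ n * expR (- (c * dotrV x x)).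

Lemma heat_ge0 c x : 0 <= heat c x.
Proof. by rewrite mulr_ge0 ?expR_ge0// exprn_ge0// sqrtr_ge0. Qed.

Let sqrtK (c : R) : 0 < c -> Num.sqrt (c / pi) ^+ n * Num.sqrt (pi / c) ^+ n = 1.
Proof.
move=> c0; rewrite -exprMn -sqrtrM ?divr_ge0 ?pi_ge0 ?ltW//.
by rewrite mulrA mulfVK ?gt_eqF ?pi_gt0// divff ?gt_eqF// sqrtr1 expr1n.
Qed.

Lemma integral_heat (c : R) : 0 < c -> (\int[leb]_x (heat c x)%:E = 1)%E.
Proof.
move=> c0; under eq_integral do rewrite EFinM.
rewrite ge0_integralZl//=.
- by rewrite integral_expR_dotrV// -EFinM sqrtK.
- by apply/measurable_EFinP; exact: measurable_expR_dotrV.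
Qed.

Lemma heat_fourier (c : R) (xi : V) : 0 < c ->
  [/\ leb.-integrable setT (EFin \o (fun x => heat c x * cos (dotrV x xi))),
      \int[leb]_x (heat c x * cos (dotrV x xi)) = expR (- (dotrV xi xi / (4 * c))),
      leb.-integrable setT (EFin \o (fun x => heat c x * sin (dotrV x xi))) &
      \int[leb]_x (heat c x * sin (dotrV x xi)) = 0].
Proof.
move=> c0; have [ic vc is_ vs] := gauss_fourier_rV c0 xi.
rewrite (_ : (fun x => heat c x * cos _) = (fun x => Num.sqrt (c / pi) ^+ n *
  (expR (- (c * dotrV x x)) * cos (dotrV x xi)))); last first.
  by apply/funext => x; rewrite mulrA.
rewrite (_ : (fun x => heat c x * sin _) = (fun x => Num.sqrt (c / pi) ^+ n *
  (expR (- (c * dotrV x x)) * sin (dotrV x xi)))); last first.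
  by apply/funext => x; rewrite mulrA.
split; try exact: integrable_mulrl.
- by rewrite RintegralZl// vc mulrA sqrtK// mul1r.
- by rewrite RintegralZl// vs mulr0.
Qed.

Variables W c : R -> R.
Hypothesis W0 : forall u, 0 <= W u.
Hypothesis mW : measurable_fun [set: RR] (W : RR -> RR).
Hypothesis intW : (\int[mu]_u (W u)%:E = 1)%E.
Hypothesis c0 : forall u, 0 < c u.
Hypothesis mc : measurable_fun [set: RR] (c : RR -> RR).

(** Extended real valued because a mixture can be infinite at a point: with the Bessel weight this
    happens at 0 when alpha <= n. *)
Definition mixture (x : V) : \bar R := (\int[mu]_u (W u * heat (c u) x)%:E)%E.

Lemma measurable_heat_comp d (T : measurableType d) (g : T -> RR) (f : T -> V) :
  measurable_fun setT g -> measurable_fun setT f ->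
  measurable_fun setT (fun t => W (g t) * heat (c (g t)) (f t)).
Proof.
move=> mg mf; have mcg := measurableT_comp mc mg.
apply: measurable_funM; first exact: (measurableT_comp mW mg).
apply: measurable_funM.
  apply: measurable_funX; apply: measurableT_comp.
    by apply: continuous_measurable_fun; exact: sqrt_continuous.
  exact: measurable_funM.
apply: measurableT_comp => //; apply: measurable_funN.
apply: measurable_funM => //; exact: measurable_dotrV.
Qed.

Let mk : measurable_fun setT (fun p : RR * V => (W p.1 * heat (c p.1) p.2)%:E).
Proof. by apply/measurable_EFinP; exact: measurable_heat_comp. Qed.

Let k0 (p : RR * V) : (0 <= (W p.1 * heat (c p.1) p.2)%:E)%E.
Proof. by rewrite lee_fin mulr_ge0// heat_ge0. Qed.

Lemma mixture_ge0 x : (0 <= mixture x)%E.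
Proof. by apply: integral_ge0 => u _; exact: (k0 (u, x)). Qed.

Lemma measurable_mixture : measurable_fun setT mixture.
Proof. exact: (measurable_fun_fubini_tonelli_G _ mk k0). Qed.

Lemma integral_mixture : (\int[leb]_x mixture x = 1)%E.
Proof.
rewrite -(fubini_tonelli (m1 := mu) (m2 := leb) _ mk k0)/= -intW.
apply: eq_integral => u _.
transitivity (\int[leb]_y ((W u)%:E * (heat (c u) y)%:E))%E.
  by apply: eq_integral => y _; rewrite EFinM.
rewrite ge0_integralZl//.
- by rewrite integral_heat// mule1.
- apply/measurable_EFinP; apply: measurable_funM => //.
  exact: measurable_expR_dotrV.
- by move=> x _; rewrite lee_fin heat_ge0.
- by rewrite lee_fin.
Qed.

Lemma integrable_mixture : leb.-integrable setT mixture.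
Proof.
apply/integrableP; split; first exact: measurable_mixture.
under eq_integral do rewrite gee0_abs ?mixture_ge0//.
by rewrite integral_mixture ltry.
Qed.

Lemma ae_mixture : {ae leb, forall x, (fine (mixture x))%:E = mixture x}.
Proof.
have := integrable_ae measurableT integrable_mixture.
by apply: filterS => x /(_ I) h; rewrite fineK.
Qed.

Lemma measurable_fine_mixture : measurable_fun setT (fine \o mixture).
Proof. by apply: measurableT_comp => //; exact: measurable_mixture. Qed.

Lemma integrable_fine_mixture : leb.-integrable setT (EFin \o (fine \o mixture)).
Proof.
apply/integrableP; split; first by apply/measurable_EFinP; exact: measurable_fine_mixture.
rewrite (_ : (\int[leb]_x `|(EFin \o (fine \o mixture)) x|)%E = 1%E) ?ltry//.
rewrite -integral_mixture; apply: ge0_ae_eq_integral => //.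
- by apply: measurableT_comp => //; apply/measurable_EFinP; exact: measurable_fine_mixture.
- exact: measurable_mixture.
- by move=> x _; exact: mixture_ge0.
- by apply: filterS ae_mixture => x h _; rewrite /comp h gee0_abs// mixture_ge0.
Qed.

(** Fubini for an integrand dominated by [W u * heat (c u) x], whose integral over the product space
    is 1. Passing from the mixture to its [fine] part changes it on a null set only. *)
Lemma mixture_integralM (h : V -> R) : measurable_fun setT h ->
  (forall x, `|h x| <= 1) ->
  (\int[leb]_x (fine (mixture x) * h x)%:E =
   \int[mu]_u \int[leb]_x (W u * heat (c u) x * h x)%:E)%E.
Proof.
move=> mh h1.
pose f (p : RR * V) := (W p.1 * heat (c p.1) p.2 * h p.2)%:E.
have mf : measurable_fun setT f.
  apply/measurable_EFinP; apply: measurable_funM; first exact: measurable_heat_comp.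
  exact: measurableT_comp.
have intk : (mu \x leb)%E.-integrable setT (fun p : RR * V => (W p.1 * heat (c p.1) p.2)%:E).
  apply/integrableP; split => //.
  under eq_integral do rewrite gee0_abs ?k0//.
  rewrite (fubini_tonelli2 _ mk k0) -[X in (X < _)%E]/(\int[leb]_x mixture x)%E.
  by rewrite integral_mixture ltry.
have intf : (mu \x leb)%E.-integrable setT f.
  apply: (le_integrable _ mf _ intk) => // p _ /=.
  by rewrite lee_fin normrM ler_piMr.
rewrite (Fubini intf).
apply: ae_eq_integral => //.
- apply/measurable_EFinP; apply: measurable_funM => //.
  exact: measurable_fine_mixture.
- exact: (measurable_fubini_G intf).
- apply: filterS2 ae_mixture (ae_integrable2 intk) => x hx ix _.
  by rewrite EFinM hx /mixture -integralZr.
Qed.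

End gauss_mixture.

(** * The weight that produces the Bessel kernel *)

Section bessel_mixture.
Context {R : realType}.
Local Notation RR := (measurableTypeR R).
Local Notation mu := (@lebesgue_measure R).
Variable a : R.
Hypothesis a0 : 0 < a.

(* The substitution t = u^(1/a) turns the density t^(a-1) exp(-t) dt of the
   subordination formula into exp(-u^(1/a)) du / a, which has no singularity. *)
Definition bessel_time (u : R) : R := expR (ln u / a).
Definition bessel_rate (u : R) : R := (4 * bessel_time u)^-1.

Lemma bessel_time_gt0 u : 0 < bessel_time u. Proof. exact: expR_gt0. Qed.

Lemma bessel_rate_gt0 u : 0 < bessel_rate u.
Proof. by rewrite invr_gt0 mulr_gt0// bessel_time_gt0. Qed.

Lemma measurable_bessel_time : measurable_fun [set: RR] (bessel_time : RR -> RR).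
Proof.
apply: measurableT_comp => //; apply: measurable_funM => //; exact: measurable_ln.
Qed.

Lemma measurable_bessel_rate : measurable_fun [set: RR] (bessel_rate : RR -> RR).
Proof.
rewrite (_ : bessel_rate = fun u => 4^-1 * expR (- (ln u / a))).
  apply: measurable_funM => //; apply: measurableT_comp => //.
  apply: measurable_funN; apply: measurable_funM => //; exact: measurable_ln.
by apply/funext => u; rewrite /bessel_rate invfM expRN.
Qed.

(** The integrand of the transformed Gamma integral. The indicator discards u <= 0, where [ln] has
    only a default value. *)
Let w (lam u : R) : R := \1_(`]0, +oo[%classic : set R) u * expR (- (lam * bessel_time u)).

Let w0 lam u : 0 <= w lam u. Proof. by rewrite mulr_ge0 ?expR_ge0. Qed.

Let mw lam : measurable_fun [set: RR] (w lam : RR -> RR).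
Proof.
apply: measurable_funM; first exact: measurable_indic.
apply: measurableT_comp => //; apply: measurable_funN; apply: measurable_funM => //.
exact: measurable_bessel_time.
Qed.

(** [bessel_time] turns multiplication of u by lam^a into multiplication of the time by lam;
    rescaling the integral gives the factor lam^(-a). *)
Lemma integral_bessel_scale lam : 0 < lam ->
  (\int[mu]_u (w lam u)%:E = (expR (- (a * ln lam)))%:E * \int[mu]_u (w 1 u)%:E)%E.
Proof.
move=> lam0; pose b := expR (a * ln lam).
have b0 : 0 < b by exact: expR_gt0.
transitivity (\int[mu]_u (EFin \o w 1) (0 + b * u)%R)%E.
  apply: eq_integral => u _ /=; rewrite add0r /w !indicE !mem_setE !in_itv/= !andbT.
  have -> : ((0 : R) < b * u) = (0 < u) by exact: pmulr_rgt0.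
  have [u0|u0] := ltP (0 : R) u; last by rewrite !mulr0n !mul0r.
  rewrite !mulr1n !mul1r.
  rewrite /bessel_time lnM ?posrE// expRK mulrDl expRD mulrAC divff ?gt_eqF//.
  by rewrite mul1r lnK.
rewrite ge0_integral_affine ?gt_eqF//=.
- by rewrite gtr0_norm// /b expRN.
- by apply/measurable_EFinP; exact: mw.
- by move=> u; rewrite lee_fin w0.
Qed.

(** From ln r <= r - 1 with r = t / (2 a) and t = [bessel_time u]: since 2 a ln t = 2 ln u, this
    reads exp(- t) <= (2 a)^(2 a) u^(-2). *)
Let w_le (u : R) : 0 < u -> w 1 u <= expR (2 * a * ln (2 * a)) * u ^- 2.
Proof.
move=> u0; rewrite /w indicE mem_set/= ?in_itv/= ?u0// !mul1r.
have a20 : 0 < 2 * a by rewrite mulr_gt0.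
have t0 := bessel_time_gt0 u.
have h : ln (bessel_time u) - ln (2 * a) <= bessel_time u / (2 * a).
  rewrite -ln_div ?posrE//; set r := bessel_time u / (2 * a).
  have r0 : 0 < r by rewrite divr_gt0.
  have r1 : -1 < r - 1 by rewrite ltrBrDr addNr.
  have := le_ln1Dx r1; rewrite addrCA subrr addr0 => /le_trans; apply.
  by rewrite gerBl.
move: h; rewrite ler_pdivlMr// {1}/bessel_time expRK => h.
have -> : u ^- 2 = expR (- (2 * ln u)).
  by rewrite expRN -[2]/(2%:R) expRM_natl lnK ?posrE.
rewrite -expRD ler_expR.
have e : (ln u / a - ln (2 * a)) * (2 * a) = 2 * ln u - 2 * a * ln (2 * a).
  by field; rewrite gt_eqF.
by rewrite e in h; lra.
Qed.

Let w_ge (u : R) : 1 <= u <= 2 -> expR (- bessel_time 2) <= w 1 u.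
Proof.
move=> /andP[u1 u2]; have u0 : 0 < u by rewrite (lt_le_trans _ u1).
rewrite /w indicE mem_set/= ?in_itv/= ?u0// !mul1r ler_expR lerN2 ler_expR.
by rewrite ler_pM2r ?invr_gt0// ler_ln ?posrE.
Qed.

Let continuous_invr2 (C : R) :
  {within `[1, +oo[%classic, continuous (fun u : R => C * u ^- 2)}.
Proof.
apply: continuous_in_subspaceT => x; rewrite inE/= in_itv/= andbT => x1.
have x0 : x != 0 by rewrite gt_eqF// (lt_le_trans _ x1).
apply: cvgMr; apply: cvgV; first by rewrite expf_neq0.
exact: exprn_continuous.
Qed.

Let integral_invr2 (C : R) : 0 <= C ->
  (\int[mu]_(u in `[1%R, +oo[) (C * u ^- 2)%:E < +oo)%E.
Proof.
move=> C0.
have dF1 (x : R) : 1 <= x -> is_derive (x : R^o) 1 (fun u => - C * u^-1) (C * x ^- 2).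
  move=> x1; have x0 : x != 0 by rewrite gt_eqF// (lt_le_trans _ x1).
  have := is_deriveZ (- C) (@is_deriveV R id x 1 1 x0 (is_derive_id _ _)).
  by move=> /is_derive_eq; apply; rewrite /GRing.scale/= mulr1 mulrNN.
have := @ge0_continuous_FTC2y R (fun u => C * u ^- 2) (fun u => - C * u^-1) 1 0.
move=> ->.
- by rewrite -EFinB ltry.
- by move=> x x1; rewrite mulr_ge0// invr_ge0 sqr_ge0.
- exact: continuous_invr2.
- rewrite -(mulr0 (- C)); apply: cvgMr; apply/gtr0_cvgV0; last exact: cvg_id.
  by near=> x; near: x; exact: nbhs_pinfty_gt.
- by move=> x x1; apply: ex_derive; apply: dF1; exact: ltW.
- apply: cvg_at_right_filter; apply: cvgMr; apply: cvgV; first exact: oner_neq0.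
  exact: cvg_id.
- move=> x; rewrite in_itv/= andbT => x1.
  by rewrite derive1E (@derive_val _ _ _ _ _ _ _ (dF1 _ (ltW x1))).
Unshelve. all: end_near.
Qed.

(** [w 1] vanishes for u <= 0, is at most 1 on ]0, 1] and is O(u^(-2)) beyond 1. *)
Lemma integral_bessel_weight_fin : (\int[mu]_u (w 1 u)%:E < +oo)%E.
Proof.
pose C := expR (2 * a * ln (2 * a)).
have mwE (D : set RR) : measurable_fun D (EFin \o w 1).
  by apply/measurable_EFinP; apply: measurable_funTS; exact: mw.
have I1 : (\int[mu]_(u in `]0%R, 1%R]) (w 1 u)%:E < +oo)%E.
  apply: (@le_lt_trans _ _ (\int[mu]_(u in `]0%R, 1%R]) cst 1 u)%E).
    apply: ge0_le_integral => //.
    - by move=> u _; rewrite lee_fin w0.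
    - move=> u _; rewrite lee_fin /w indicE.
      case: (_ \in _); rewrite ?mul0r// !mul1r -expR0 ler_expR oppr_le0.
      by rewrite ltW// bessel_time_gt0.
  rewrite integral_cst// mul1e.
  by rewrite /= lebesgue_measure_itv/= lte01 oppr0 adde0 ltry.
have I2 : (\int[mu]_(u in `[1%R, +oo[) (w 1 u)%:E < +oo)%E.
  apply: le_lt_trans (integral_invr2 (expR_ge0 (2 * a * ln (2 * a)))).
  apply: ge0_le_integral => //.
  - by move=> u _; rewrite lee_fin w0.
  - apply/measurable_EFinP; apply: subspace_continuous_measurable_fun => //.
    exact: continuous_invr2.
  - move=> u /=; rewrite in_itv/= andbT => u1; rewrite lee_fin w_le//.
    by rewrite (lt_le_trans _ u1).
have cover : [set: RR] = `]-oo, 0%R]%classic `|` (`]0%R, 1%R]%classic `|` `]1%R, +oo[%classic).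
  apply/esym; rewrite -subTset => u _ /=; rewrite !in_itv/= andbT.
  by case: (leP u 0) => ?; [left|right; case: (leP u 1) => ?; [left|right]].
rewrite cover ge0_integral_setU//=; last 2 first.
- by move=> u _; rewrite lee_fin.
- apply/disj_setPS => u [/=]; rewrite !in_itv/= andbT => u0 [/andP[u1 _]|u1].
    by have := lt_le_trans u1 u0; rewrite ltxx.
  by have := lt_trans (lt_le_trans u1 u0) ltr01; rewrite ltxx.
rewrite integral0_eq ?add0e; last first.
  move=> u /=; rewrite in_itv/= => u0; rewrite /w indicE memNset ?mul0r//=.
  by rewrite in_itv/= andbT => /lt_le_trans/(_ u0); rewrite ltxx.
rewrite ge0_integral_setU//=; last 2 first.
- by move=> u _; rewrite lee_fin.
- apply/disj_setPS => u [/=]; rewrite !in_itv/= andbT => /andP[u0 u1] u2.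
  by have := lt_le_trans u2 u1; rewrite ltxx.
apply: lte_add_pinfty => //; apply: le_lt_trans I2.
apply: ge0_subset_integral => //; first by move=> u _; rewrite lee_fin.
  by move=> u /=; rewrite !in_itv/= !andbT; exact: ltW.
exact: measurableU.
Qed.

Lemma integral_bessel_weight_gt0 : (0 < \int[mu]_u (w 1 u)%:E)%E.
Proof.
apply: (@lt_le_trans _ _ (\int[mu]_u ((expR (- bessel_time 2))%:E *
   (\1_(`[1, 2]%classic : set R) u)%:E))%E).
  rewrite ge0_integralZl//.
    rewrite integral_indic//= setIT lebesgue_measure_itv/= lte_fin ltr1n -EFinD.
    by rewrite -EFinM lte_fin mulr_gt0 ?expR_gt0// subr_gt0 ltr1n.
  by apply/measurable_EFinP; exact: measurable_indic.
apply: ge0_le_integral => //.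
- apply: measurable_funeM; apply/measurable_EFinP; exact: measurable_indic.
- by apply/measurable_EFinP; exact: mw.
- move=> u _; rewrite -EFinM lee_fin indicE mem_setE in_itv/=.
  have [u12|_] := boolP ((1 : R) <= u <= 2); last by rewrite mulr0n mulr0.
  by rewrite mulr1n mulr1; exact: w_ge.
Qed.

(** This number is a Gamma(a) = Gamma(a + 1). *)
Let Gam := fine (\int[mu]_u (w 1 u)%:E)%E.

Let Gam_gt0 : 0 < Gam.
Proof.
by rewrite fine_gt0// integral_bessel_weight_fin integral_bessel_weight_gt0.
Qed.

Definition bessel_weight (u : R) : R := Gam^-1 * w 1 u.

Lemma bessel_weight_ge0 u : 0 <= bessel_weight u.
Proof. by rewrite mulr_ge0// invr_ge0 ltW. Qed.

Lemma measurable_bessel_weight : measurable_fun [set: RR] (bessel_weight : RR -> RR).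
Proof. by apply: measurable_funM => //; exact: mw. Qed.

(** The factor exp(- lam t) turns [w 1] into [w (1 + lam)], so the scaling law gives (1 + lam)^(-a).
    The Fourier transform of the kernel uses it with lam = |xi|^2. *)
Lemma integral_bessel_laplace lam : 0 <= lam ->
  (\int[mu]_u (bessel_weight u * expR (- (lam * bessel_time u)))%:E =
   (expR (- (a * ln (1 + lam))))%:E)%E.
Proof.
move=> lam0; have lam1 : 0 < 1 + lam by rewrite ltr_pwDl.
transitivity (\int[mu]_u ((Gam^-1)%:E * (w (1 + lam) u)%:E))%E.
  apply: eq_integral => u _; rewrite -EFinM /bessel_weight /w.
  by rewrite mulrDl opprD expRD -!mulrA.
rewrite ge0_integralZl//; last 3 first.
- by apply/measurable_EFinP; exact: mw.
- by move=> u _; rewrite lee_fin.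
- by rewrite lee_fin invr_ge0 ltW.
rewrite integral_bessel_scale// muleCA -[X in (_ * (_ * X))%E]fineK; last first.
  by rewrite ge0_fin_numE ?integral_bessel_weight_fin// integral_ge0// => u _; rewrite lee_fin.
by rewrite -/Gam -(EFinM Gam^-1) mulVf ?gt_eqF// mule1.
Qed.

Lemma integral_bessel_weight : (\int[mu]_u (bessel_weight u)%:E = 1)%E.
Proof.
have := integral_bessel_laplace (lexx 0); rewrite addr0 ln1 mulr0 oppr0 expR0 => <-.
by apply: eq_integral => u _; rewrite mul0r oppr0 expR0 mulr1.
Qed.

Lemma bessel_weight_ge : exists2 k, 0 < k & forall u, 1 <= u <= 2 -> k <= bessel_weight u.
Proof.
exists (Gam^-1 * expR (- bessel_time 2)).
  by rewrite mulr_gt0 ?invr_gt0 ?expR_gt0.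
by move=> u u12; rewrite /bessel_weight ler_pM2l ?invr_gt0//; exact: w_ge.
Qed.

Lemma bessel_rate_bounds u : 1 <= u <= 2 ->
  (4 * bessel_time 2)^-1 <= bessel_rate u <= 4^-1.
Proof.
move=> /andP[u1 u2]; have u0 : 0 < u by rewrite (lt_le_trans _ u1).
have t1 : 1 <= bessel_time u.
  by rewrite -expR0 ler_expR divr_ge0 ?(ltW a0)// ln_ge0.
have t2 : bessel_time u <= bessel_time 2.
  by rewrite ler_expR ler_pM2r ?invr_gt0// ler_ln ?posrE.
have tp := bessel_time_gt0 2; have tu := bessel_time_gt0 u.
rewrite /bessel_rate !lef_pV2 ?posrE ?mulr_gt0//.
by rewrite ler_pM2l// t2 /= ler_peMr.
Qed.

End bessel_mixture.

(** * Uniqueness in L^1 of the Fourier transform *)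

Section integrable_helpers.
Context {R : realType}.

Lemma EFin_Rintegral d (T : measurableType d) (m : {measure set T -> \bar R}) (f : T -> R) :
  m.-integrable setT (EFin \o f) -> ((\int[m]_x f x)%:E = \int[m]_x (f x)%:E)%E.
Proof. by move=> intf; rewrite /Rintegral fineK//; exact: integrable_fin_num. Qed.

Lemma integrable_mul_bounded d (T : measurableType d) (m : {measure set T -> \bar R})
    (f h : T -> R) : m.-integrable setT (EFin \o f) -> measurable_fun setT h ->
  (forall x, `|h x| <= 1) -> m.-integrable setT (EFin \o (fun x => f x * h x)).
Proof.
move=> intf mh h1.
have mf : measurable_fun setT f.
  by apply/measurable_EFinP; exact: measurable_int intf.
apply: (le_integrable _ _ _ intf) => //.
  by apply/measurable_EFinP; exact: measurable_funM.
by move=> x _ /=; rewrite lee_fin normrM ler_piMr.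
Qed.

Lemma integrable_prodM d1 d2 (T1 : measurableType d1) (T2 : measurableType d2)
    (m1 : {sigma_finite_measure set T1 -> \bar R})
    (m2 : {sigma_finite_measure set T2 -> \bar R}) (g : T1 -> R) (h : T2 -> R) :
  m1.-integrable setT (EFin \o g) -> m2.-integrable setT (EFin \o h) ->
  (m1 \x m2)%E.-integrable setT (EFin \o (fun p => g p.1 * h p.2)).
Proof.
move=> ig ih.
have mg : measurable_fun setT g by apply/measurable_EFinP; exact: measurable_int ig.
have mh : measurable_fun setT h by apply/measurable_EFinP; exact: measurable_int ih.
have /integrableP[_ iih] := ih; have /integrableP[_ iig] := ig.
apply/integrable12ltyP.
  by apply/measurable_EFinP; apply: measurable_funM; exact: measurableT_comp.
have E x : (\int[m2]_y `|(EFin \o (fun p => g p.1 * h p.2)%R) (x, y)| =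
   (\int[m2]_y `|(EFin \o h) y|) * `|(EFin \o g) x|)%E.
  rewrite muleC -ge0_integralZl//; last first.
    by apply: measurableT_comp => //; exact/measurable_EFinP.
  by apply: eq_integral => y _; rewrite /= normrM EFinM.
under eq_integral do rewrite E.
rewrite ge0_integralZl//; last 2 first.
  by apply: measurableT_comp => //; exact/measurable_EFinP.
  by apply: integral_ge0.
by rewrite lte_mul_pinfty ?integral_ge0// ge0_fin_numE ?integral_ge0.
Qed.

End integrable_helpers.

Section fourier_unique.
Context {R : realType}.
Variable n : nat.
Local Notation V := 'rV[R]_n.
Local Notation leb := (lebesgue_rV R n).
Variable H : V -> R.
Hypothesis intH : leb.-integrable setT (EFin \o H).
Hypothesis Hcos : forall xi : V, \int[leb]_x (H x * cos (dotrV x xi)) = 0.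
Hypothesis Hsin : forall xi : V, \int[leb]_x (H x * sin (dotrV x xi)) = 0.

Let mH : measurable_fun setT H.
Proof. by apply/measurable_EFinP; exact: measurable_int intH. Qed.

Let mcos_dot d (T : measurableType d) (f g : T -> V) : measurable_fun setT f ->
  measurable_fun setT g -> measurable_fun setT (fun x => cos (dotrV (f x) (g x))).
Proof.
move=> mf mg; apply: measurableT_comp; last exact: measurable_dotrV.
by apply: continuous_measurable_fun; exact: continuous_cos.
Qed.

Let msin_dot d (T : measurableType d) (f g : T -> V) : measurable_fun setT f ->
  measurable_fun setT g -> measurable_fun setT (fun x => sin (dotrV (f x) (g x))).
Proof.
move=> mf mg; apply: measurableT_comp; last exact: measurable_dotrV.
by apply: continuous_measurable_fun; exact: continuous_sin.
Qed.

Let msub d (T : measurableType d) (f g : T -> V) : measurable_fun setT f ->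
  measurable_fun setT g -> measurable_fun setT (fun x => f x - g x).
Proof.
move=> mf mg; apply: measurable_fun_rV => i.
under eq_fun do rewrite !mxE.
apply: measurable_funB; first exact: (measurableT_comp (measurable_coord_rV i) mf).
exact: (measurableT_comp (measurable_coord_rV i) mg).
Qed.

Let intHcos (x xi : V) : leb.-integrable setT
  (EFin \o (fun y => H y * cos (dotrV xi (x - y)))).
Proof.
apply: integrable_mul_bounded => //; first by apply: mcos_dot => //; exact: msub.
by move=> y; exact: norm_cos_le1.
Qed.

Let Hcos_shift (x xi : V) : (\int[leb]_y (H y * cos (dotrV xi (x - y)))%:E = 0)%E.
Proof.
have ic : leb.-integrable setT (EFin \o (fun y => H y * cos (dotrV y xi))).
  by apply: integrable_mul_bounded => //; [exact: mcos_dot|move=> y; exact: norm_cos_le1].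
have is_ : leb.-integrable setT (EFin \o (fun y => H y * sin (dotrV y xi))).
  by apply: integrable_mul_bounded => //; [exact: msin_dot|move=> y; exact: norm_sin_le1].
rewrite -EFin_Rintegral//; congr EFin.
have -> : (fun y : V => H y * cos (dotrV xi (x - y))) = (fun y =>
    cos (dotrV x xi) * (H y * cos (dotrV y xi)) + sin (dotrV x xi) * (H y * sin (dotrV y xi))).
  by apply/funext => y; rewrite dotrVC dotrVBl cosB; ring.
by rewrite RintegralD ?RintegralZl ?Hcos ?Hsin ?mulr0 ?addr0//; exact: integrable_mulrl.
Qed.

(** The Gaussian is itself the Fourier transform of a heat kernel in the variable xi. By Fubini the
    transform falls on [H], where it vanishes at every xi. *)
Lemma gauss_convolution_eq0 (c : R) (x : V) : 0 < c ->
  (\int[leb]_y (H y * expR (- (c * dotrV (x - y) (x - y))))%:E = 0)%E.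
Proof.
(* The heat kernel of rate 1 / (4 c) has Fourier transform exp(- c |.|^2). *)
move=> c0; pose c' := (4 * c)^-1.
have c'0 : 0 < c' by rewrite invr_gt0 mulr_gt0.
pose f (p : V * V) := (H p.1 * heat c' p.2 * cos (dotrV p.2 (x - p.1)))%:E.
have intheat : leb.-integrable setT (EFin \o heat c').
  have [h _ _ _] := heat_fourier (0 : V) c'0; move: h.
  rewrite (_ : (fun x => heat c' x * _) = heat c')//.
  by apply/funext => z; rewrite dotrVC dotrV0l cos0 mulr1.
have intf : (leb \x leb)%E.-integrable setT f.
  apply: (@integrable_mul_bounded _ _ _ _ (fun p : V * V => H p.1 * heat c' p.2)).
  - exact: integrable_prodM.
  - by apply: mcos_dot => //; exact: msub.
  - by move=> p; exact: norm_cos_le1.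
transitivity (\int[leb]_y \int[leb]_xi f (y, xi))%E.
  apply: eq_integral => y _; rewrite /f/=.
  have [ic vc _ _] := heat_fourier (x - y) c'0.
  transitivity ((H y)%:E * \int[leb]_xi (heat c' xi * cos (dotrV xi (x - y)))%:E)%E.
    rewrite -EFin_Rintegral// vc -EFinM; congr (_ * expR (- _))%:E.
    by rewrite /c'; field; rewrite gt_eqF.
  by rewrite -integralZl//; apply: eq_integral => xi _; rewrite -EFinM mulrA.
rewrite (Fubini intf) integral0_eq// => xi _; rewrite /f/=.
transitivity ((heat c' xi)%:E * \int[leb]_y (H y * cos (dotrV xi (x - y)))%:E)%E.
  rewrite -(integralZl measurableT (intHcos x xi)).
  by apply: eq_integral => y _; rewrite -EFinM; congr EFin; ring.
by rewrite Hcos_shift mule0.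
Qed.

Let integral_gauss_shift (c : R) (y : V) : 0 < c ->
  (\int[leb]_x (expR (- (c * dotrV (x - y) (x - y))))%:E = (Num.sqrt (pi / c) ^+ n)%:E)%E.
Proof.
move=> c0; rewrite -integral_expR_dotrV//.
transitivity (\int[leb]_x (expR (- (c * dotrV (- y + 1 *: x) (- y + 1 *: x))))%:E)%E.
  by apply: eq_integral => x _; rewrite scale1r addrC.
rewrite (ge0_integral_affine_rV (- y) (oner_neq0 R)
  (f := fun x => (expR (- (c * dotrV x x)))%:E))//.
- by rewrite normr1 invr1 expr1n mul1e.
- by apply/measurable_EFinP; exact: measurable_expR_dotrV.
Qed.

Let integrable_gauss_kernel (c : R) (phi : V -> R) : 0 < c ->
  measurable_fun setT phi -> (forall x, `|phi x| <= 1) ->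
  (leb \x leb)%E.-integrable setT (EFin \o (fun p : V * V =>
    H p.1 * expR (- (c * dotrV (p.2 - p.1) (p.2 - p.1))) * phi p.2)).
Proof.
move=> c0 mphi phi1; apply: integrable_mul_bounded => //; last exact: measurableT_comp.
have mE : measurable_fun setT (fun p : V * V => expR (- (c * dotrV (p.2 - p.1) (p.2 - p.1)))).
  apply: measurableT_comp => //; apply: measurable_funN; apply: measurable_funM => //.
  by apply: measurable_dotrV; exact: msub.
apply/integrable12ltyP.
  by apply/measurable_EFinP; apply: measurable_funM => //; exact: measurableT_comp.
have E y : (\int[leb]_x `|(EFin \o (fun p : V * V =>
    (H p.1 * expR (- (c * dotrV (p.2 - p.1) (p.2 - p.1))))%R)) (y, x)| =
   (Num.sqrt (pi / c) ^+ n)%:E * `|(EFin \o H) y|)%E.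
  rewrite muleC -(integral_gauss_shift y c0) -ge0_integralZl//.
    by apply: eq_integral => x _; rewrite /= normrM EFinM (ger0_norm (expR_ge0 _)).
  apply/measurable_EFinP; exact: (measurableT_comp mE (measurable_pair1 y)).
under eq_integral do rewrite E.
have /integrableP[_ iH] := intH.
rewrite ge0_integralZl//; last by apply: measurableT_comp => //; exact/measurable_EFinP.
by rewrite lte_mul_pinfty// lee_fin exprn_ge0// sqrtr_ge0.
Qed.

(** Substituting x = y + e z makes the inner integral one against a Gaussian of rate e^(-2) centred
    at y; after Fubini the integral over y is a Gaussian convolution of [H], which is 0 for every
    x. *)
Let gauss_smoothing_eq0 (e : R) (phi : V -> R) : 0 < e ->
  measurable_fun setT phi -> (forall x, 0 <= phi x <= 1) ->
  (\int[leb]_y \int[leb]_z (H y * heat 1 z * phi (y + e *: z))%:E = 0)%E.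
Proof.
move=> e0 mphi phi01; pose c := e ^- 2.
have c0 : 0 < c by rewrite invr_gt0 exprn_gt0.
have phi0 x : 0 <= phi x by case/andP : (phi01 x).
have phi1 x : `|phi x| <= 1 by rewrite ger0_norm//; case/andP : (phi01 x).
(* Jacobian of the substitution times the normalisation of [heat 1]. *)
pose K : R := e^-1 ^+ n * Num.sqrt (1 / pi) ^+ n.
have intf := integrable_gauss_kernel c0 mphi phi1.
set f := (EFin \o _) in intf.
transitivity (\int[leb]_y (K%:E * \int[leb]_x f (y, x)))%E; last first.
  rewrite integralZl//; last exact: (integrable_fubini_F intf).
  rewrite (Fubini intf) integral0_eq ?mule0// => x _; rewrite /f/=.
  transitivity ((phi x)%:E * \int[leb]_y (H y * expR (- (c * dotrV (x - y) (x - y))))%:E)%E.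
    rewrite -integralZl//.
      by apply: eq_integral => y _; rewrite -EFinM mulrC.
    apply: integrable_mul_bounded => //.
      apply: measurableT_comp => //; apply: measurable_funN; apply: measurable_funM => //.
      by apply: measurable_dotrV; exact: msub.
    move=> y; rewrite ger0_norm ?expR_ge0// -expR0 ler_expR oppr_le0.
    by rewrite mulr_ge0 ?dotrV_ge0// ltW.
  by rewrite gauss_convolution_eq0// mule0.
apply: eq_integral => y _.
pose F x := (phi x * expR (- (c * dotrV (x - y) (x - y))))%:E.
have mF : measurable_fun setT F.
  apply/measurable_EFinP; apply: measurable_funM => //.
  apply: measurableT_comp => //; apply: measurable_funN; apply: measurable_funM => //.
  by apply: measurable_dotrV; exact: msub.
have F0 x : (0 <= F x)%E by rewrite lee_fin mulr_ge0 ?expR_ge0.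
have FE z : (H y * heat 1 z * phi (y + e *: z))%:E =
    ((H y * Num.sqrt (1 / pi) ^+ n)%:E * F (y + e *: z)%R)%E.
  rewrite -EFinM; congr EFin; rewrite /heat (addrC y) addrK (mul1r (dotrV z z)).
  rewrite dotrVZl (dotrVC z) dotrVZl /c (_ : e ^- 2 * _ = dotrV z z); first by ring.
  by field; rewrite gt_eqF.
under eq_integral do rewrite FE.
have Ffin : (\int[leb]_x F x < +oo)%E.
  apply: (@le_lt_trans _ _ (\int[leb]_x (expR (- (c * dotrV (x - y) (x - y))))%:E)%E).
    apply: ge0_le_integral => //.
      apply/measurable_EFinP.
      apply: measurableT_comp => //; apply: measurable_funN; apply: measurable_funM => //.
      by apply: measurable_dotrV; exact: msub.
    move=> x _; rewrite lee_fin ler_piMl ?expR_ge0//; by case/andP : (phi01 x).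
  by rewrite integral_gauss_shift// ltry.
have intF : leb.-integrable setT F.
  by apply/integrableP; split => //; under eq_integral do rewrite gee0_abs//.
have intFe : leb.-integrable setT (fun z => F (y + e *: z)).
  apply/integrableP; split.
    by apply: measurableT_comp => //; exact: measurable_affine_rV.
  under eq_integral do rewrite gee0_abs//.
  rewrite ge0_integral_affine_rV ?gt_eqF//.
  by rewrite lte_mul_pinfty// ?lee_fin ?exprn_ge0 ?invr_ge0.
rewrite integralZl// ge0_integral_affine_rV ?gt_eqF//.
transitivity (K%:E * ((H y)%:E * \int[leb]_x F x))%E.
  by rewrite !muleA -!EFinM /K gtr0_norm//; congr (_%:E * _)%E; ring.
congr (_ * _)%E; rewrite -integralZl//; apply: eq_integral => x _.
by rewrite /f/= -EFinM; congr EFin; ring.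
Qed.

(** Smoothing at scale 1 / (k + 1) gives 0 for each k. By dominated convergence the limit is the
    integral of [H] times [phi], because [heat 1] has mass one. Continuity of [phi] is assumed in
    the sequential form in which this limit uses it. *)
Lemma fourier0_integral_test (phi : V -> R) :
  measurable_fun setT phi -> (forall x, 0 <= phi x <= 1) ->
  (forall y z, phi (y + k.+1%:R^-1 *: z) @[k --> \oo] --> phi y) ->
  (\int[leb]_y (H y * phi y)%:E = 0)%E.
Proof.
move=> mphi phi01 cphi.
have phi1 x : `|phi x| <= 1.
  by rewrite ger0_norm; case/andP : (phi01 x).
have intheat : leb.-integrable setT (EFin \o heat 1).
  have [h _ _ _] := heat_fourier (0 : V) (@ltr01 R); move: h.
  rewrite (_ : (fun x => heat 1 x * _) = heat 1)//.
  by apply/funext => z; rewrite dotrVC dotrV0l cos0 mulr1.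
have intHh : (leb \x leb)%E.-integrable setT (EFin \o (fun p : V * V => H p.1 * heat 1 p.2)).
  exact: integrable_prodM.
pose f_ (k : nat) (p : V * V) := (H p.1 * heat 1 p.2 * phi (p.1 + k.+1%:R^-1 *: p.2))%:E.
pose f (p : V * V) := (H p.1 * heat 1 p.2 * phi p.1)%:E.
have mphik k : measurable_fun setT (fun p : V * V => phi (p.1 + k.+1%:R^-1 *: p.2)).
  apply: measurableT_comp => //; apply: measurable_fun_rV => i.
  under eq_fun do rewrite !mxE.
  apply: measurable_funD; first exact: (measurableT_comp (measurable_coord_rV i)).
  apply: measurable_funM => //; exact: (measurableT_comp (measurable_coord_rV i)).
have intf_ k : (leb \x leb)%E.-integrable setT (f_ k).
  exact: (integrable_mul_bounded intHh (mphik k)).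
have intf : (leb \x leb)%E.-integrable setT f.
  by apply: (integrable_mul_bounded intHh) => //; exact: measurableT_comp.
have [] := @dominated_convergence _ _ R (leb \x leb)%E setT measurableT f_ f
  (abse \o (EFin \o (fun p : V * V => H p.1 * heat 1 p.2))).
- by move=> k; exact: measurable_int (intf_ k).
- exact: measurable_int intf.
- apply/aeW => p _; apply: cvg_EFin; first exact: nearW.
  by apply: cvgMr; exact: cphi.
- exact: integrable_abse.
- by apply/aeW => p k _; rewrite /f_/= lee_fin normrM ler_piMr.
move=> _ _ /= cv.
have : (\int[leb \x leb]_p f p = 0)%E.
  apply: (cvg_unique _ cv) => //.
  rewrite /= (_ : (fun k => _) = cst 0%E); first exact: cvg_cst.
  apply/funext => k; rewrite -(integral12_prod_meas1 (intf_ k)).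
  by apply: gauss_smoothing_eq0 => //; rewrite invr_gt0.
rewrite -(integral12_prod_meas1 intf) => <-.
apply: eq_integral => y _; rewrite /fubini_F /f/=.
transitivity ((H y * phi y)%:E * \int[leb]_z (heat 1 z)%:E)%E.
  by rewrite integral_heat// mule1.
rewrite -integralZl//; apply: eq_integral => z _; rewrite -EFinM; congr EFin; ring.
Qed.

End fourier_unique.

(** * Boxes that generate the Borel sets *)

Section lower_box.
Context {R : realType}.
Variable n : nat.
Local Notation V := 'rV[R]_n.

(** These sets are closed under intersection and generate the sigma-algebra, hence suffice for
    testing that all integrals of a function vanish. *)
Definition lower_box (a : V) : set V := [set y | forall i, y ord0 i < a ord0 i].

Lemma lower_boxE a : lower_box a =
  \big[setI/setT]_(i < n) ((fun y : V => y ord0 i) @^-1` `]-oo, a ord0 i[).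
Proof.
apply/seteqP; split => [y ay|y].
  rewrite -bigcap_seq => i _ /=; rewrite in_itv/=; exact: ay.
by rewrite -bigcap_seq => ay i; have /= := ay i (mem_index_enum _); rewrite in_itv.
Qed.

Lemma measurable_lower_box a : measurable (lower_box a).
Proof.
rewrite lower_boxE; apply: bigsetI_measurable => i _.
rewrite -[X in measurable X]setTI; apply: measurable_coord_rV => //.
Qed.

Lemma lower_boxI : setI_closed (range lower_box).
Proof.
move=> _ _ [a _ <-] [b _ <-].
exists (\row_i Num.min (a ord0 i) (b ord0 i)) => //.
apply/seteqP; split => [y ay|y [ya yb] i].
  by split => i; have := ay i; rewrite mxE lt_min => /andP[].
by rewrite mxE lt_min ya yb.
Qed.

Lemma measurable_lower_boxE : @measurable _ V = <<s range lower_box >>.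
Proof.
apply/seteqP; split.
  apply: smallest_sub; first exact: smallest_sigma_algebra.
  rewrite -bigcup_seq => B [i _ [C mC <-]].
  rewrite setTI.
  have sub : @measurable _ (measurableTypeR R) `<=`
     [set C | <<s range lower_box >> ((fun y : V => y ord0 i) @^-1` C)].
    rewrite -[X in X `<=` _]/((@ocitv R).-sigma.-measurable) RGenInftyO.measurableE.
    apply: smallest_sub.
      split => [|D /= mD|F /= mF].
      - by rewrite /= preimage_set0; exact: sigma_algebra0.
      - by rewrite setTD -preimage_setC; exact: sigma_algebraC.
      - by rewrite /= preimage_bigcup; exact: sigma_algebra_bigcup.
    move=> _ [x ->] /=.
    (* The half-space y_i < x is the union of the boxes whose i-th side is x and whose other sides
       are k. *)
    pose b (k : nat) : V := \row_j (if j == i then x else k%:R).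
    rewrite (_ : _ @^-1` _ = \bigcup_k lower_box (b k)).
      by apply: sigma_algebra_bigcup => k; apply: sub_sigma_algebra; exists (b k).
    apply/seteqP; split => [y /=|y [k _ yb] /=]; rewrite in_itv/=.
      (* The sum over all coordinates gives one index that exceeds each of them. *)
      move=> yx; exists (\sum_j (Num.trunc `|y ord0 j|).+1)%N => // j.
      rewrite /b mxE; case: eqP => [->//|_].
      apply: (le_lt_trans (ler_norm _)).
      apply: (lt_le_trans (truncnS_gt _)); rewrite ler_nat (bigD1 j)//= leq_addr//.
    by have := yb i; rewrite /b mxE eqxx.
  exact: sub.
apply: smallest_sub; last by move=> _ [a _ <-]; exact: measurable_lower_box.
split => [|A|F]; [exact: measurable0|by rewrite setTD; exact: measurableC|].
exact: bigcupT_measurable.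
Qed.

End lower_box.

Section fourier_unique.
Context {R : realType}.
Variable n : nat.
Local Notation V := 'rV[R]_n.
Local Notation leb := (lebesgue_rV R n).

Section fourier0.
Variable H : V -> R.
Hypothesis intH : leb.-integrable setT (EFin \o H).
Hypothesis Hcos : forall xi : V, \int[leb]_x (H x * cos (dotrV x xi)) = 0.
Hypothesis Hsin : forall xi : V, \int[leb]_x (H x * sin (dotrV x xi)) = 0.

Let mH : measurable_fun setT H.
Proof. by apply/measurable_EFinP; exact: measurable_int intH. Qed.

Let clamp (t : R) : R := Num.min 1 (Num.max 0 t).

Let clamp01 t : 0 <= clamp t <= 1.
Proof. by rewrite /clamp le_min ler01 le_max lexx/= ge_min lexx. Qed.

Let continuous_clamp : continuous clamp.
Proof.
move=> t; apply: (@continuous_min R); first exact: cvg_cst.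
by apply: (@continuous_max R); [exact: cvg_cst|exact: cvg_id].
Qed.

Let cvg_clamp (u : nat -> R) (l : R) :
  u @ \oo --> l -> (fun k => clamp (u k)) @ \oo --> clamp l.
Proof. by move=> ul; apply: continuous_cvg => //; exact: continuous_clamp. Qed.

(** The indicator of the box is the pointwise limit of the continuous functions [phi k]. At y_i =
    a_i the clamp is 0, in accordance with the strict inequality in [lower_box]. *)
Lemma fourier0_lower_box (a : V) : (\int[leb]_(y in lower_box a) (H y)%:E = 0)%E.
Proof.
pose phi (k : nat) (y : V) := \prod_(i < n) clamp (k%:R * (a ord0 i - y ord0 i)).
have phi01 k y : 0 <= phi k y <= 1.
  apply/andP; split; last by apply: prodr_ile1 => i _; exact: clamp01.
  by apply: prodr_ge0 => i _; case/andP : (clamp01 (k%:R * (a ord0 i - y ord0 i))).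
have mphi k : measurable_fun setT (phi k).
  apply: measurable_prod => i _; apply: measurableT_comp.
    by apply: continuous_measurable_fun; exact: continuous_clamp.
  apply: measurable_funM => //; apply: measurable_funB => //.
  exact: measurable_coord_rV.
have z k : (\int[leb]_y (H y * phi k y)%:E = 0)%E.
  apply: (fourier0_integral_test intH Hcos Hsin) => // y v.
  apply: cvg_big => [|i _]; first exact: mul_continuous.
  have c1 : (k%:R * (a ord0 i - (y + m.+1%:R^-1 *: v) ord0 i)) @[m --> \oo] -->
      (k%:R * (a ord0 i - y ord0 i) : R).
    apply: cvgMr; apply: cvgB; first exact: cvg_cst.
    rewrite (_ : (fun m => _) = (fun m : nat => y ord0 i + harmonic m * v ord0 i)); last first.
      by apply/funext => m; rewrite !mxE.
    rewrite -[X in _ --> X]addr0; apply: cvgD; first exact: cvg_cst.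
    rewrite -[X in _ --> X](mul0r (v ord0 i)); apply: cvgMl; exact: cvg_harmonic.
  exact: cvg_clamp c1.
rewrite integral_mkcond.
have [] := @dominated_convergence _ _ R leb setT measurableT
  (fun k y => (H y * phi k y)%:E) ((EFin \o H) \_ (lower_box a)) (abse \o (EFin \o H)).
- by move=> k; apply/measurable_EFinP; exact: measurable_funM.
- have mHE : measurable_fun setT (EFin \o H) by exact/measurable_EFinP.
  exact: (measurable_restrictT (EFin \o H) (measurable_lower_box a)).1 (measurable_funTS mHE).
- apply/aeW => y _.
  have -> : ((EFin \o H) \_ (lower_box a)) y = (H y * \prod_(i < n) (y ord0 i < a ord0 i)%R%:R)%:E.
    rewrite patchE; case: ifPn => [/set_mem ay|].
      by rewrite big1 ?mulr1// => i _; rewrite ay.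
    rewrite notin_setE => /existsNP[i /negP iy].
    by rewrite (bigD1 i)//= (negbTE iy) mul0r mulr0.
  apply: cvg_EFin; first exact: nearW.
  apply: cvgMr; apply: cvg_big => [|i _]; first exact: mul_continuous.
  apply: cvg_near_cst; have [ya|ay] := ltP (y ord0 i) (a ord0 i); near=> k.
    have d0 : 0 < a ord0 i - y ord0 i by rewrite subr_gt0.
    rewrite /clamp; apply/min_idPl; rewrite le_max -ler_pdivrMr//; apply/orP; right.
    by near: k; exact: nbhs_infty_ger.
  have : k%:R * (a ord0 i - y ord0 i) <= 0 by rewrite mulr_ge0_le0// subr_le0.
  by move=> h; rewrite /clamp (max_idPl h); apply/min_idPr.
- exact: integrable_abse.
- apply/aeW => y k _; rewrite /= lee_fin normrM ler_piMr//.
  by rewrite ger0_norm; case/andP : (phi01 k y).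
move=> _ _ /= cv.
apply: (cvg_unique _ cv) => //; rewrite /=.
rewrite (_ : (fun k => _) = cst 0%E); first exact: cvg_cst.
by apply/funext => k; exact: z.
Unshelve. all: end_near.
Qed.

(** The sets over which [H] integrates to 0 form a Dynkin class; the whole space belongs to it by
    the cosine hypothesis at xi = 0. *)
Lemma fourier0_integral_set (A : set V) : measurable A ->
  (\int[leb]_(y in A) (H y)%:E = 0)%E.
Proof.
have intHA B : measurable B -> leb.-integrable B (EFin \o H).
  by move=> mB; exact: integrableS intH.
have HT : (\int[leb]_y (H y)%:E = 0)%E.
  have := Hcos 0; rewrite /Rintegral.
  have -> : (\int[leb]_x (H x * cos (dotrV x 0))%:E = \int[leb]_x (H x)%:E)%E.
    by apply: eq_integral => y _; rewrite dotrVC dotrV0l cos0 mulr1.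
  move=> h; rewrite -[LHS]fineK ?h//; exact: integrable_fin_num.
rewrite measurable_lower_boxE -(setI_closed_g_dynkin_g_sigma_algebra (@lower_boxI R n)).
pose D := [set B : set V | measurable B /\ (\int[leb]_(y in B) (H y)%:E = 0)%E].
suff : <<d range (@lower_box R n) >> `<=` D by move=> h /h[].
apply: smallest_sub; last first.
  move=> _ [a _ <-]; split; first exact: measurable_lower_box.
  exact: fourier0_lower_box.
split => [|B [mB B0]|F tF mF].
- by split.
- split; first exact: measurableC.
  have := HT; rewrite -(setUv B) integral_setU_EFin//; last 3 first.
  + exact: measurableC.
  + by rewrite setUv.
  + by apply/disj_setPCl.
  by rewrite B0 add0e.
- split; first by apply: bigcupT_measurable => k; have [] := mF k.
  rewrite integral_bigcup//.
  + by rewrite eseries0// => k _ _; have [] := mF k.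
  + by move=> k; have [] := mF k.
  + by apply: intHA; apply: bigcupT_measurable => k; have [] := mF k.
Qed.

End fourier0.

(** The difference of the two functions integrates to 0 over every measurable set. *)
Lemma fourier_unique (G1 G2 : V -> R) :
  leb.-integrable setT (EFin \o G1) -> leb.-integrable setT (EFin \o G2) ->
  (forall xi : V, \int[leb]_x (G1 x * cos (dotrV x xi)) = \int[leb]_x (G2 x * cos (dotrV x xi))) ->
  (forall xi : V, \int[leb]_x (G1 x * sin (dotrV x xi)) = \int[leb]_x (G2 x * sin (dotrV x xi))) ->
  ae_eq leb setT (EFin \o G1) (EFin \o G2).
Proof.
move=> i1 i2 ec es.
have i12 := integrable_subr i1 i2.
have mcos (xi : V) : measurable_fun setT (fun x => cos (dotrV x xi)).
  apply: measurableT_comp; last exact: measurable_dotrV.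
  by apply: continuous_measurable_fun; exact: continuous_cos.
have msin (xi : V) : measurable_fun setT (fun x => sin (dotrV x xi)).
  apply: measurableT_comp; last exact: measurable_dotrV.
  by apply: continuous_measurable_fun; exact: continuous_sin.
have z A : measurable A -> (\int[leb]_(y in A) (G1 y - G2 y)%:E = 0)%E.
  apply: fourier0_integral_set => // xi.
    under eq_Rintegral do rewrite mulrBl.
    rewrite RintegralB ?ec ?subrr//; apply: integrable_mul_bounded => // x;
      exact: norm_cos_le1.
  under eq_Rintegral do rewrite mulrBl.
  rewrite RintegralB ?es ?subrr//; apply: integrable_mul_bounded => // x;
    exact: norm_sin_le1.
apply: integral_ae_eq => //; first exact: measurable_int i2.
move=> A _ mA; have := z A mA.
have iA1 : leb.-integrable A (EFin \o G1) by exact: integrableS i1.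
have iA2 : leb.-integrable A (EFin \o G2) by exact: integrableS i2.
rewrite -[X in X = _ -> _]/(\int[leb]_(y in A) ((EFin \o G1) y - (EFin \o G2) y))%E.
rewrite integralB// => /eqP; rewrite sube_eq ?add0e; [by move/eqP| |].
- exact: integrable_fin_num.
- by apply: fin_num_adde_defl; exact: integrable_fin_num.
Qed.

End fourier_unique.

(** * The Bessel kernel as a Gaussian mixture *)

Section ae_translate.
Context {R : realType}.

Lemma measurable_subrV n (x : 'rV[R]_n) : measurable_fun setT (fun y : 'rV[R]_n => x - y).
Proof.
rewrite (_ : (fun y => _) = (fun y => x + (-1) *: y)).
  exact: measurable_affine_rV.
by apply/funext => y; rewrite scaleN1r.
Qed.

Lemma ae_subrV n (x : 'rV[R]_n) (P : 'rV[R]_n -> Prop) :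
  {ae lebesgue_rV R n, forall z, P z} -> {ae lebesgue_rV R n, forall y, P (x - y)}.
Proof.
move=> [B [mB B0 sub]]; exists ((fun y => x - y) @^-1` B); split.
- by rewrite -[X in measurable X]setTI; exact: measurable_subrV.
- have mi : measurable_fun setT (fun y : 'rV[R]_n => (\1_B y : R)%:E).
    by apply/measurable_EFinP; exact: measurable_indic.
  have i0 (y : 'rV[R]_n) : (0 <= (\1_B y : R)%:E)%E by rewrite lee_fin.
  have e : (\int[lebesgue_rV R n]_y (\1_B y : R)%:E = 0)%E.
    by rewrite integral_indic// setIT.
  have := ge0_integral_subrV x mi i0; rewrite e => <-.
  rewrite -[X in _ = X]/(\int[lebesgue_rV R n]_y (\1_((fun y => x - y)%R @^-1` B) y : R)%:E)%E.
  rewrite integral_indic// ?setIT//.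
  by rewrite -[X in measurable X]setTI; exact: measurable_subrV.
- by move=> y; exact: sub.
Qed.

End ae_translate.

Lemma integral_mulrA (R : realType) d (T : measurableType d) (m : {measure set T -> \bar R})
    (k : R) (f h : T -> R) : m.-integrable setT (EFin \o (fun x => f x * h x)) ->
  (\int[m]_x (k * f x * h x)%:E = k%:E * \int[m]_x (f x * h x)%:E)%E.
Proof.
move=> ifh; rewrite -(integralZl measurableT ifh).
by apply: eq_integral => x _; rewrite -EFinM mulrA.
Qed.

Section bessel_kernel.
Context {R : realType}.
Local Notation RR := (measurableTypeR R).
Local Notation mu := (@lebesgue_measure R).
Variables (n : nat) (alpha : R).
Hypothesis alpha0 : 0 < alpha.
Local Notation V := 'rV[R]_n.
Local Notation leb := (lebesgue_rV R n).

Let a := alpha / 2.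
Let a0 : 0 < a. Proof. by rewrite divr_gt0. Qed.

Let W := bessel_weight a.
Let c := bessel_rate a.

Definition bessel_mixture (x : V) : \bar R := mixture W c x.

Let W0 := bessel_weight_ge0 a0.
Let mW := measurable_bessel_weight a.
Let intW := integral_bessel_weight a0.
Let c0 := bessel_rate_gt0 a.
Let mc := measurable_bessel_rate a.

Lemma bessel_mixture_ge0 x : (0 <= bessel_mixture x)%E.
Proof. exact: mixture_ge0. Qed.

Lemma measurable_bessel_mixture : measurable_fun setT bessel_mixture.
Proof. exact: measurable_mixture. Qed.

Lemma integral_bessel_mixture : (\int[leb]_x bessel_mixture x = 1)%E.
Proof. exact: integral_mixture. Qed.

(** By Fubini the transform is the mixture of the transforms of heat kernels. As 4 c(u) = 1 / t(u),
    these are exp(- t(u) |xi|^2), and the Laplace transform of the weight gives (1 +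
    |xi|^2)^(-alpha/2). *)
Lemma is_bessel_kernel_mixture : is_bessel_kernel alpha (fine \o bessel_mixture).
Proof.
have intm := integrable_fine_mixture n W0 mW intW c0 mc.
split; first exact: intm.
have mcos (xi : V) : measurable_fun setT (fun x => cos (dotrV x xi)).
  apply: measurableT_comp; last exact: measurable_dotrV.
  by apply: continuous_measurable_fun; exact: continuous_cos.
have msin (xi : V) : measurable_fun setT (fun x => sin (dotrV x xi)).
  apply: measurableT_comp; last exact: measurable_dotrV.
  by apply: continuous_measurable_fun; exact: continuous_sin.
move=> xi; split; rewrite /Rintegral/=.
  rewrite (mixture_integralM W0 mW intW c0 mc (mcos xi)); last first.
    by move=> x; exact: norm_cos_le1.
  transitivity (fine (expR (- (a * ln (1 + dotrV xi xi))))%:E); last first.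
    by rewrite /= /powR gt_eqF ?ltr_pwDl ?dotrV_ge0// mulNr.
  congr fine; rewrite -integral_bessel_laplace ?dotrV_ge0//.
  apply: eq_integral => u _.
  have [ic vc _ _] := heat_fourier xi (c0 u).
  transitivity ((W u)%:E * \int[leb]_x (heat (c u) x * cos (dotrV x xi))%:E)%E.
    exact: integral_mulrA.
  rewrite -EFin_Rintegral// vc -EFinM; congr (_ * expR (- _))%:E.
  by rewrite /c /bessel_rate; field; rewrite gt_eqF// bessel_time_gt0.
rewrite (mixture_integralM W0 mW intW c0 mc (msin xi)); last first.
  by move=> x; exact: norm_sin_le1.
rewrite integral0_eq// => u _.
have [_ _ is_ vs] := heat_fourier xi (c0 u).
transitivity ((W u)%:E * \int[leb]_x (heat (c u) x * sin (dotrV x xi))%:E)%E.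
  exact: integral_mulrA.
by rewrite -EFin_Rintegral// vs mule0.
Qed.

(** The mixture inhabits the set from which the kernel is chosen, so the choice does not fall back
    on its default 0. *)
Lemma is_bessel_kernel_bessel_kernel : is_bessel_kernel alpha (@bessel_kernel R n alpha).
Proof.
rewrite /bessel_kernel; apply: (@xgetPex _ _ [set G : V -> R | is_bessel_kernel alpha G]).
by exists (fine \o bessel_mixture); exact: is_bessel_kernel_mixture.
Qed.

Lemma bessel_kernel_ae : {ae leb, forall x, (bessel_kernel alpha x)%:E = bessel_mixture x}.
Proof.
have [i1 f1] := is_bessel_kernel_bessel_kernel.
have [i2 f2] := is_bessel_kernel_mixture.
have h : ae_eq leb setT (EFin \o (@bessel_kernel R n alpha)) (EFin \o (fine \o bessel_mixture)).
  apply: fourier_unique => // xi; have [c1 s1] := f1 xi; have [c2 s2] := f2 xi.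
    by rewrite c1 c2.
  by rewrite s1 s2.
apply: filterS2 h (ae_mixture n W0 mW intW c0 mc) => x /(_ I) /= -> ->.
by [].
Qed.

Lemma measurable_bessel_integrand (f : V -> R) (x : V) : measurable_fun setT f ->
  measurable_fun setT (fun y : V => bessel_mixture (x - y)%R * (f y)%:E)%E.
Proof.
move=> mf; apply: emeasurable_funM; last exact/measurable_EFinP.
by apply: (measurableT_comp measurable_bessel_mixture); exact: measurable_subrV.
Qed.

Lemma bessel_potentialE (f : V -> R) (x : V) : measurable_fun setT f -> (forall y, 0 <= f y) ->
  bessel_potential alpha f x = (\int[leb]_y (bessel_mixture (x - y)%R * (f y)%:E))%E.
Proof.
move=> mf f0; apply: ae_eq_integral => //.
- apply/measurable_EFinP; apply: measurable_funM => //.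
  have [i1 _] := is_bessel_kernel_bessel_kernel.
  apply: (@measurableT_comp _ _ _ _ _ _ (@bessel_kernel R n alpha)).
    by apply/measurable_EFinP; exact: measurable_int i1.
  exact: measurable_subrV.
- exact: measurable_bessel_integrand.
- by apply: filterS (ae_subrV x bessel_kernel_ae) => y h _; rewrite EFinM h.
Qed.

(** In this form the integrand is finite and continuous in [x], as the application of Fatou's lemma
    to potentials requires. *)
Lemma bessel_potential_prod (f : V -> R) (x : V) : measurable_fun setT f -> (forall y, 0 <= f y) ->
  bessel_potential alpha f x =
  (\int[leb \x mu]_p (W p.2 * heat (c p.2) (x - p.1) * f p.1)%:E)%E.
Proof.
move=> mf f0; rewrite bessel_potentialE//.
have mp : measurable_fun setT (fun p : V * RR => (W p.2 * heat (c p.2) (x - p.1) * f p.1)%:E).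
  apply/measurable_EFinP; apply: measurable_funM; last exact: measurableT_comp.
  apply: (measurable_heat_comp mW mc) => //.
  exact: (measurableT_comp (measurable_subrV _) measurable_fst).
have p0 (p : V * RR) : (0 <= (W p.2 * heat (c p.2) (x - p.1) * f p.1)%:E)%E.
  by rewrite lee_fin; apply: mulr_ge0 => //; apply: mulr_ge0; [exact: W0|exact: heat_ge0].
rewrite (fubini_tonelli1 _ mp p0); apply: eq_integral => y _.
rewrite /fubini_F/= /bessel_mixture /mixture.
rewrite muleC -ge0_integralZl//.
- by apply: eq_integral => u _; rewrite -EFinM mulrC.
- apply/measurable_EFinP; apply: (measurable_heat_comp mW mc) => //.
- by move=> u _; rewrite lee_fin mulr_ge0 ?W0 ?heat_ge0.
- by rewrite lee_fin.
Qed.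

(** If it failed at x, there would be points z_k -> x with potential at most b, while the potential
    at x exceeds b. The integrands converge pointwise, so Fatou's lemma bounds the potential at x by
    b. *)
Lemma lower_semicontinuous_bessel_potential (f : V -> R) :
  measurable_fun setT f -> (forall y, 0 <= f y) ->
  lower_semicontinuous (bessel_potential alpha f).
Proof.
move=> mf f0 x b bx; apply: contrapT => h.
have {h}h (k : nat) : exists z : V, (forall i, `|x ord0 i - z ord0 i| < k.+1%:R^-1) /\
    (bessel_potential alpha f z <= b%:E)%E.
  apply: contrapT => hk; apply: h; exists (ball x k.+1%:R^-1).
    by apply: nbhsx_ballx; rewrite invr_gt0.
  move=> z bz; rewrite ltNge; apply/negP => zb; apply: hk; exists z; split => //.
  by move=> i; case: bz => _ /(_ ord0 i).
have [z hz] := choice h.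
have cz i : z k ord0 i @[k --> \oo] --> x ord0 i.
  apply/cvgrPdist_lt => e e0; near=> k.
  have [+ _] := hz k => /(_ i) /lt_trans; apply.
  by near: k; exact: near_infty_natSinv_lt (PosNum e0).
pose F z (p : V * RR) := (W p.2 * heat (c p.2) (z - p.1) * f p.1)%:E.
have mF z' : measurable_fun setT (F z').
  apply/measurable_EFinP; apply: measurable_funM; last exact: measurableT_comp.
  apply: (measurable_heat_comp mW mc) => //.
  exact: (measurableT_comp (measurable_subrV _) measurable_fst).
have F0 z' p : (0 <= F z' p)%E by rewrite lee_fin; apply: mulr_ge0 => //; apply: mulr_ge0; [exact: W0|exact: heat_ge0].
have cF p : F (z k) p @[k --> \oo] --> F x p.
  apply: cvg_EFin; first exact: nearW.
  have cd i : ((z k - p.1) ord0 i) @[k --> \oo] --> ((x - p.1) ord0 i : R).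
    rewrite mxE (_ : (fun k => _) = (fun k => z k ord0 i + (- p.1) ord0 i)); last first.
      by apply/funext => k; rewrite mxE.
    by apply: cvgD; [exact: cz|exact: cvg_cst].
  have cdot : dotrV (z k - p.1) (z k - p.1) @[k --> \oo] --> (dotrV (x - p.1) (x - p.1) : R).
    by apply: cvg_big => [|i _]; [exact: add_continuous|apply: cvgM; exact: cd].
  have ce : expR (- (c p.2 * dotrV (z k - p.1) (z k - p.1))) @[k --> \oo] -->
      (expR (- (c p.2 * dotrV (x - p.1) (x - p.1))) : R).
    apply: continuous_cvg; first exact: continuous_expR.
    by apply: cvgN; apply: cvgMr.
  by apply: cvgMl; apply: cvgMr; apply: cvgMr.
have := fatou (leb \x mu)%E measurableT (fun k => mF (z k)) (fun k p _ => F0 (z k) p).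
rewrite (_ : (\int[_]_(_ in _) limn_einf _ = bessel_potential alpha f x)%E); last first.
  rewrite bessel_potential_prod//; apply: eq_integral => p _.
  by have [-> _] := cvg_limn_einf_sup (cF p).
apply/negP; rewrite -ltNge; apply: le_lt_trans bx.
rewrite limn_einf_lim; apply: lime_le; first exact: is_cvg_einfs.
apply: nearW => k; apply: (@le_trans _ _ (bessel_potential alpha f (z k))).
  apply: ereal_inf_lbound; exists k => //=.
  by rewrite bessel_potential_prod.
by have [_] := hz k.
Unshelve. all: end_near.
Qed.

End bessel_kernel.

(** * Bessel capacity *)

Section boxes.
Context {R : realType}.
Local Notation RR := (measurableTypeR R).

(** For e > 0 this is the sup-norm ball, spelled out by coordinates so that its volume can be
    computed by induction on n. *)
Definition open_box n (x : 'rV[R]_n) (e : R) : set 'rV[R]_n :=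
  [set y | forall i, `|x ord0 i - y ord0 i| < e].

Lemma measurable_open_box n (x : 'rV[R]_n) e : measurable (open_box x e).
Proof.
rewrite (_ : open_box x e = \big[setI/setT]_(i < n)
   ((fun y : 'rV[R]_n => y ord0 i) @^-1` [set t | `|x ord0 i - t| < e])).
  apply: bigsetI_measurable => i _.
  rewrite -[X in measurable X]setTI; apply: measurable_coord_rV => //.
  rewrite (_ : [set t | _] = `](x ord0 i - e), (x ord0 i + e)[%classic).
    exact: measurable_itv.
  by apply/seteqP; split => t /=; rewrite in_itv/= distrC ltr_distl.
apply/seteqP; split => [y xy|y].
  by rewrite -bigcap_seq => i _ /=; exact: xy.
by rewrite -bigcap_seq => xy i; exact: xy i (mem_index_enum _).
Qed.

Lemma lebesgue_open_box n (x : 'rV[R]_n) e : 0 < e ->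
  lebesgue_rV R n (open_box x e) = ((2 * e) ^+ n)%:E.
Proof.
move=> e0; elim: n x => [|n IH] x.
  by rewrite expr0/= diracE mem_set// => -[].
have mi : measurable_fun setT (fun y : 'rV[R]_n.+1 => (\1_(open_box x e) y : R)%:E).
  by apply/measurable_EFinP; apply: measurable_indic; exact: measurable_open_box.
transitivity (\int[lebesgue_rV R n.+1]_y (\1_(open_box x e) y : R)%:E)%E.
  by rewrite integral_indic ?setIT//; exact: measurable_open_box.
rewrite ge0_integral_rVS//.
pose x' := (unconsrV x).2.
have E (a : R) (y : 'rV[R]_n) : \1_(open_box x e) (consrV (a, y)) =
   \1_(`](x ord0 ord0 - e), (x ord0 ord0 + e)[%classic : set R) a * \1_(open_box x' e) y :> R.
  rewrite !indicE -natrM mulnb; congr (nat_of_bool _)%:R; apply/idP/andP => [/set_mem h|].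
    split; apply/mem_set.
      by have := h ord0; rewrite consrV0/= in_itv/= distrC ltr_distl.
    by move=> i; have := h (lift ord0 i); rewrite consrVS mxE.
  move=> [/set_mem/= ha /set_mem hy]; apply/mem_set => i.
  case: (unliftP ord0 i) => [j|] ->; rewrite ?consrV0 ?consrVS.
    by have := hy j; rewrite mxE.
  by move: ha; rewrite in_itv/= distrC ltr_distl.
transitivity (\int[lebesgue_measure]_a (((2 * e) ^+ n)%:E *
    (\1_(`](x ord0 ord0 - e), (x ord0 ord0 + e)[%classic : set R) a : R)%:E))%E.
  apply: eq_integral => a _; rewrite -(IH x') muleC.
  transitivity (\int[lebesgue_rV R n]_y
     ((\1_(`](x ord0 ord0 - e), (x ord0 ord0 + e)[%classic : set R) a : R)%:E *
      (\1_(open_box x' e) y : R)%:E))%E.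
    by apply: eq_integral => y _; rewrite -EFinM E.
  rewrite ge0_integralZl//.
  - by rewrite integral_indic ?setIT//; exact: measurable_open_box.
  - by apply/measurable_EFinP; apply: measurable_indic; exact: measurable_open_box.
have e2 : 0 <= (2 * e) ^+ n by rewrite exprn_ge0// mulr_ge0// ltW.
rewrite ge0_integralZl//; last by apply/measurable_EFinP; exact: measurable_indic.
rewrite integral_indic//= setIT lebesgue_measure_itv/= lte_fin.
rewrite ltrD2l gtrN// -EFinB -EFinM exprSr; congr (_ * _)%:E; ring.
Qed.

Lemma open_box_nbhs n (x : 'rV[R]_n) (U : set 'rV[R]_n) : nbhs x U ->
  exists2 e : R, 0 < e & open_box x e `<=` U.
Proof.
move=> /nbhs_ballP[e /= e0 xeU]; exists e => // y xy; apply: xeU.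
by split => // i j; rewrite (ord1 i); exact: xy.
Qed.

End boxes.

Section capacity.
Context {R : realType}.
Local Notation RR := (measurableTypeR R).
Variables (n : nat) (alpha s : R).
Hypotheses (alpha0 : 0 < alpha) (s1 : 1 < s).
Local Notation V := 'rV[R]_n.
Local Notation leb := (lebesgue_rV R n).
Local Notation C := (@capacity R n alpha s).
Local Notation G := (@bessel_mixture R n alpha).

Let s0 : 0 < s. Proof. exact: lt_trans s1. Qed.
Let sn0 : s != 0. Proof. by rewrite gt_eqF. Qed.

Let energy (f : V -> R) : \bar R := (Lnorm leb s%:E (EFin \o f) `^ s)%E.

Let energyE (f : V -> R) : (forall x, 0 <= f x) ->
  energy f = (\int[leb]_x (f x `^ s)%:E)%E.
Proof.
move=> f0; rewrite /energy powR_Lnorm//; apply: eq_integral => x _ /=.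
by rewrite ger0_norm.
Qed.

Let energy_ge0 (f : V -> R) : (0 <= energy f)%E. Proof. exact: poweR_ge0. Qed.

Lemma capacity_ge0 E : (0 <= C E)%E.
Proof. by apply: le_ereal_inf_tmp => _ [f _ <-]; exact: poweR_ge0. Qed.

Lemma capacity_mono E F : E `<=` F -> (C E <= C F)%E.
Proof.
move=> EF; apply: le_ereal_inf => _ [f [mf [f0 fF]] <-]; exists f => //.
by split => //; split => // x /EF; exact: fF.
Qed.

Lemma capacity0 : C set0 = 0%E.
Proof.
apply/eqP; rewrite eq_le capacity_ge0 andbT; apply: ereal_inf_lbound.
exists (cst 0) => //=.
rewrite -[LHS]/(energy (cst 0)) energyE//.
by rewrite integral0_eq// => x _; rewrite powR0.
Qed.

Let energyZ (k : R) (f : V -> R) : 0 <= k -> measurable_fun setT f -> (forall x, 0 <= f x) ->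
  energy (fun x => k * f x) = ((k `^ s)%:E * energy f)%E.
Proof.
move=> k0 mf f0; rewrite !energyE//; last by move=> x; rewrite mulr_ge0.
rewrite -ge0_integralZl//.
- by apply: eq_integral => x _; rewrite powRM.
- apply/measurable_EFinP; apply: (@measurableT_comp _ _ _ _ _ _ (fun t : R => t `^ s)) => //.
- by move=> x _; rewrite lee_fin powR_ge0.
- by rewrite lee_fin powR_ge0.
Qed.

Let potentialZ (k : R) (f : V -> R) x : 0 <= k -> measurable_fun setT f -> (forall x, 0 <= f x) ->
  bessel_potential alpha (fun x => k * f x) x = (k%:E * bessel_potential alpha f x)%E.
Proof.
move=> k0 mf f0; rewrite !bessel_potentialE//; last 2 first.
- exact: measurable_funM.
- by move=> y; rewrite mulr_ge0.
rewrite -ge0_integralZl//.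
- by apply: eq_integral => y _; rewrite EFinM muleCA.
- exact: measurable_bessel_integrand.
- by move=> y _; rewrite mule_ge0// ?lee_fin// bessel_mixture_ge0.
Qed.

(** Take [f] almost optimal for E and enlarge it by a factor k > 1. The set where the potential of k
    f exceeds 1 contains E, is open by lower semicontinuity, and has capacity at most k^s times the
    energy of [f]. *)
Lemma capacity_outer_regular E (b : \bar R) : (C E < b)%E ->
  exists U : set V, [/\ open U, E `<=` U & (C U < b)%E].
Proof.
move=> /ereal_inf_lt[_ [f [mf [f0 fE]] <-]]; rewrite -/(energy f) => fb.
have [k k1 kb] : exists2 k : R, 1 < k & ((k `^ s)%:E * energy f < b)%E.
  have e0 := energy_ge0 f; have efin : energy f \is a fin_num.
    by rewrite ge0_fin_numE// (lt_le_trans fb)// leey.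
  rewrite -(fineK efin) in fb e0 *; move: fb e0; move: (fine (energy f)) => r rb.
  rewrite lee_fin le_eqVlt => /orP[/eqP r0|r0].
    (* Zero energy stays zero under any factor. *)
    by exists 2; rewrite ?ltr1n// -r0 mule0; rewrite -r0 in rb.
  have [m rm mb] : exists2 m, r < m & (m%:E < b)%E.
    case: b rb => [b| |]//; rewrite ?lte_fin => rb.
      by exists ((r + b) / 2); rewrite ?lte_fin ?midf_lt.
    by exists (r + 1); rewrite ?ltry// ltrDl.
  have mr : 1 < m / r by rewrite ltr_pdivlMr// mul1r.
  (* With m strictly between the energy r and b, this k satisfies k^s r = m. *)
  exists ((m / r) `^ s^-1).
    have e1 : (1 : R) `^ s^-1 = 1 by rewrite powR1.
    by rewrite -[X in X < _]e1 gt0_ltr_powR ?invr_gt0 ?nnegrE// ltW// (lt_trans _ mr).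
  rewrite -powRrM mulVf// powRr1; last by rewrite ltW// (lt_trans _ mr).
  by rewrite -EFinM divfK// gt_eqF.
have k0 : 0 < k by exact: lt_trans k1.
exists [set x | (1%:E < bessel_potential alpha (fun x => k * f x)%R x)%E]; split.
- apply: (lower_semicontinuousP _).1; apply: lower_semicontinuous_bessel_potential => //.
    exact: measurable_funM.
  by move=> y; rewrite mulr_ge0// ltW.
- move=> x /fE h /=; rewrite potentialZ ?ltW//.
  apply: (@lt_le_trans _ _ k%:E); first by rewrite lte_fin.
  by rewrite -[leLHS]mule1 lee_wpmul2l// lee_fin ltW.
- apply: le_lt_trans kb; rewrite -(energyZ (ltW k0) mf f0).
  rewrite /capacity; apply: ereal_inf_lbound.
  exists (fun x => k * f x) => //; split; first exact: measurable_funM.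
  split; first by move=> x; rewrite mulr_ge0// ltW.
  by move=> x /= /ltW.
Qed.

(** Only u in [1, 2] is kept. There the weight is bounded below and the rate lies between [c2] and
    1/4; [c2] controls the normalising factor and 1/4 the exponent. *)
Lemma bessel_mixture_ge : exists2 k : R, 0 < k &
  forall z : V, ((k * expR (- (4^-1 * dotrV z z)))%:E <= G z)%E.
Proof.
have a0 : 0 < alpha / 2 by rewrite divr_gt0.
have [k k0 kW] := bessel_weight_ge a0.
pose c2 := (4 * bessel_time (alpha / 2) 2)^-1.
have c20 : 0 < c2 by rewrite invr_gt0 mulr_gt0// bessel_time_gt0.
pose K := k * Num.sqrt (c2 / pi) ^+ n.
have K0 : 0 < K by rewrite mulr_gt0// exprn_gt0// sqrtr_gt0 divr_gt0// pi_gt0.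
exists K => // z; set w := K * _.
have w0 : 0 <= w by rewrite mulr_ge0 ?expR_ge0// ltW.
have mi : measurable_fun [set: RR] (fun u : RR => (\1_(`[1, 2]%classic : set R) u : R)%:E).
  by apply/measurable_EFinP; exact: measurable_indic.
apply: (@le_trans _ _ (\int[lebesgue_measure]_(u in [set: RR]) (w%:E * (\1_(`[1, 2]%classic : set R) u)%:E))%E).
  rewrite ge0_integralZl// integral_indic//= setIT lebesgue_measure_itv/= lte_fin ltr1n.
  by rewrite -EFinB -EFinM lee_fin (_ : 2 - 1 = 1) ?mulr1//; ring.
apply: ge0_le_integral => //.
- by move=> u _; rewrite mule_ge0 ?lee_fin.
- exact: measurable_funeM.
- apply/measurable_EFinP.
  apply: (@measurable_heat_comp R n _ _ (measurable_bessel_weight _) (measurable_bessel_rate _)) => //.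
- move=> u _; rewrite -EFinM lee_fin indicE mem_setE in_itv/=.
  have [u12|_] := boolP ((1 : R) <= u <= 2); last first.
    by rewrite mulr0n mulr0 mulr_ge0 ?heat_ge0// bessel_weight_ge0.
  have /andP[cl cu] := bessel_rate_bounds a0 u12.
  have kw := kW _ u12.
  have e0 := expR_ge0 (- (4^-1 * dotrV z z)).
  have q0 : 0 <= Num.sqrt (c2 / pi) ^+ n by rewrite exprn_ge0// sqrtr_ge0.
  rewrite mulr1n mulr1 /w /K /heat -mulrA.
  apply: (ler_pM (ltW k0) (mulr_ge0 q0 e0) kw); apply: (ler_pM q0 e0).
    apply: lerXn2r; rewrite ?nnegrE ?sqrtr_ge0// ler_wsqrtr// ler_pM2r//.
    by rewrite invr_gt0 pi_gt0.
  by rewrite ler_expR lerN2 ler_wpM2r// dotrV_ge0.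
Qed.

Let dotrV_sub_le (x y : V) : dotrV (x - y) (x - y) <= 2 * dotrV x x + 2 * dotrV y y.
Proof.
rewrite /dotrV !mulr_sumr -big_split/=; apply: ler_sum => i _.
rewrite !mxE; set u := x _ _; set v := y _ _.
by have := sqr_ge0 (u + v); rewrite expr2; lra.
Qed.

Lemma compact_dotrV_bounded (K : set V) : compact K ->
  exists B : R, forall x, K x -> dotrV x x <= B.
Proof.
move=> /compact_bounded[M [Mreal HM]].
have MM : M < M + 1 by rewrite ltrDl.
exists (\sum_(i < n) (M + 1) ^+ 2) => x Kx; apply: ler_sum => i _.
have xi : `|x ord0 i| <= M + 1.
  apply: le_trans (HM _ MM x Kx).
  rewrite [X in _ <= X]/Num.Def.normr /= mx_normrE; apply/bigmax_geP; right.
  by exists (ord0, i).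
rewrite -expr2 -(real_normK (num_real (x ord0 i))).
by rewrite lerXn2r ?nnegrE// (le_trans _ xi).
Qed.

(** A multiple of the Gaussian [g] is admissible: its potential is bounded below on K, thanks to the
    Gaussian lower bound of the kernel. *)
Lemma capacity_compact_fin (K : set V) : compact K -> (C K < +oo)%E.
Proof.
move=> /compact_dotrV_bounded[B KB]; have [k k0 kG] := bessel_mixture_ge.
pose g (y : V) := expR (- (1 * dotrV y y)).
have mg : measurable_fun setT g by exact: measurable_expR_dotrV.
(* By |x - y|^2 <= 2 |x|^2 + 2 |y|^2, the kernel bound times [g y] is at least k exp(- |x|^2 / 2)
   exp(- 3/2 |y|^2). [I] is the integral of the last factor, and [m] bounds the result from below
   when |x|^2 <= B. *)
pose I : R := Num.sqrt (pi / (3 / 2)) ^+ n.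
have I0 : 0 < I by rewrite exprn_gt0// sqrtr_gt0 !divr_gt0// pi_gt0.
pose m := k * expR (- (B / 2)) * I.
have m0 : 0 < m by rewrite !mulr_gt0// expR_gt0.
have m1 : 0 <= m^-1 by rewrite invr_ge0 ltW.
have mmg : measurable_fun setT (fun y => m^-1 * g y) by exact: measurable_funM.
have pot x : K x -> (1%:E <= bessel_potential alpha (fun y => m^-1 * g y)%R x)%E.
  move=> Kx; rewrite potentialZ//; last by move=> y; exact: expR_ge0.
  rewrite lee_pdivlMl// mule1.
  rewrite bessel_potentialE//; last by move=> y; exact: expR_ge0.
  rewrite /m EFinM /I -integral_expR_dotrV; last by rewrite divr_gt0.
  have me : measurable_fun setT (fun y : V => (expR (- (3 / 2 * dotrV y y)))%:E).
    by apply/measurable_EFinP; exact: measurable_expR_dotrV.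
  have kB0 : (0 <= (k * expR (- (B / 2)))%:E :> \bar R)%E by rewrite lee_fin mulr_ge0 ?expR_ge0// ltW.
  have e0 (y : V) : (0 <= (expR (- (3 / 2 * dotrV y y)))%:E :> \bar R)%E by rewrite lee_fin expR_ge0.
  rewrite -ge0_integralZl//.
  apply: ge0_le_integral.
  - exact: measurableT.
  - by move=> y _; rewrite mule_ge0.
  - exact: measurable_funeM.
  - exact: measurable_bessel_integrand.
  move=> y _.
  apply: (@le_trans _ _ ((k * expR (- (4^-1 * dotrV (x - y) (x - y))))%:E * (g y)%:E)%E); last first.
    by rewrite lee_wpmul2r// lee_fin expR_ge0.
  rewrite -!EFinM lee_fin -!mulrA ler_pM2l// -!expRD ler_expR.
  have := dotrV_sub_le x y; have := KB x Kx; lra.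
apply: (@le_lt_trans _ _ (energy (fun y => m^-1 * g y)%R)).
  apply: ereal_inf_lbound; exists (fun y => m^-1 * g y) => //; split => //.
  split; first by move=> y; rewrite mulr_ge0// expR_ge0.
  exact: pot.
rewrite energyZ//; last by move=> y; exact: expR_ge0.
rewrite energyE; last by move=> y; exact: expR_ge0.
rewrite (_ : (\int[leb]_x (g x `^ s)%:E = \int[leb]_x (expR (- (s * dotrV x x)))%:E)%E); last first.
  apply: eq_integral => y _; rewrite /g mul1r /powR gt_eqF ?expR_gt0// expRK.
  by rewrite mulrN.
by rewrite integral_expR_dotrV// -EFinM ltry.
Qed.

(* With h = G * 1_A <= 1 one has f h <= h / 2 + 2^(s-1) f^s pointwise; integrate. *)
Lemma capacity_ge_measure : exists2 k : R, 0 < k &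
  forall A : set V, measurable A -> (leb A < +oo)%E -> (k%:E * leb A <= C A)%E.
Proof.
pose k : R := 2 `^ (s - 1).
have k0 : 0 < k by rewrite powR_gt0.
exists (2 * k)^-1; first by rewrite invr_gt0 mulr_gt0.
move=> A mA Afin; apply: le_ereal_inf_tmp => _ [f [mf [f0 fA]] <-].
rewrite -/(energy f) energyE//.
have mG := @measurable_bessel_mixture R n alpha alpha0.
pose F (p : V * V) : \bar R := ((\1_A p.1 : R)%:E * (G (p.1 - p.2) * (f p.2)%:E))%E.
pose H (p : V * V) : \bar R := ((\1_A p.1 : R)%:E * G (p.1 - p.2))%E.
have m1A : measurable_fun setT (\1_A : V -> R) by exact: measurable_indic.
have msub : measurable_fun setT (fun p : V * V => p.1 - p.2).
  apply: measurable_fun_rV => i.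
  under eq_fun do rewrite !mxE.
  apply: measurable_funB; first exact: (measurableT_comp (measurable_coord_rV i)).
  exact: (measurableT_comp (measurable_coord_rV i)).
have mGs : measurable_fun setT (fun p : V * V => G (p.1 - p.2)).
  exact: measurableT_comp.
have mH : measurable_fun setT H.
  apply: emeasurable_funM => //; apply/measurable_EFinP; exact: measurableT_comp.
have mF : measurable_fun setT F.
  apply: emeasurable_funM; first by apply/measurable_EFinP; exact: measurableT_comp.
  by apply: emeasurable_funM => //; apply/measurable_EFinP; exact: measurableT_comp.
have G0 z : (0 <= G z)%E by exact: bessel_mixture_ge0.
have mHy y : measurable_fun setT (fun x => H (x, y)).
  by apply: (measurableT_comp mH); exact: measurable_pair2.
have mGy (y : V) : measurable_fun setT (fun x : V => G (x - y)).
  have mxy : measurable_fun setT (fun x : V => x - y).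
    under eq_fun do rewrite addrC -[X in _ + X]scale1r.
    exact: measurable_affine_rV.
  exact: measurableT_comp mG mxy.
have H0 p : (0 <= H p)%E by rewrite mule_ge0.
have F0 p : (0 <= F p)%E by rewrite !mule_ge0 ?lee_fin.
pose h y := (\int[leb]_x H (x, y))%E.
have mh : measurable_fun setT h by exact: (measurable_fun_fubini_tonelli_G _ mH H0).
have h0 y : (0 <= h y)%E by exact: integral_ge0.
have h1 y : (h y <= 1)%E.
  have <- : (\int[leb]_x G (x - y)%R = 1)%E.
    rewrite -(integral_bessel_mixture n alpha0).
    transitivity (\int[leb]_x G (- y + 1 *: x)%R)%E.
      by apply: eq_integral => x _; rewrite scale1r addrC.
    by rewrite ge0_integral_affine_rV ?oner_neq0// normr1 invr1 expr1n mul1e.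
  apply: ge0_le_integral.
  - exact: measurableT.
  - by move=> x _; exact: H0.
  - exact: mHy.
  - exact: mGy.
  - move=> x _; rewrite /H/= -[leRHS]mul1e lee_wpmul2r// lee_fin indicE.
    by case: (_ \in _).
have hA : (\int[leb]_y h y = leb A)%E.
  rewrite -(fubini_tonelli (m1 := leb) (m2 := leb) _ mH H0).
  transitivity (\int[leb]_x (\1_A x : R)%:E)%E; last by rewrite integral_indic// setIT.
  apply: eq_integral => x _.
  rewrite -[RHS]mule1 -(integral_bessel_mixture n alpha0) -(ge0_integral_subrV x)//.
  have mGx : measurable_fun setT (fun y : V => G (x - y)).
    exact: measurableT_comp mG (measurable_subrV x).
  have A0 : (0 <= (\1_A x : R)%:E)%E by rewrite lee_fin.
  exact: (ge0_integralZl leb measurableT mGx (fun y _ => G0 _) A0).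
have key : (leb A <= \int[leb]_y ((2^-1)%:E * h y + k%:E * (f y `^ s)%:E))%E.
  apply: (@le_trans _ _ (\int[leb]_x (\int[leb]_y F (x, y)))%E).
    rewrite -[leLHS]mule1 -[X in (X <= _)%E](_ : (\int[leb]_x (\1_A x : R)%:E = _)%E); last first.
      by rewrite mule1 integral_indic// setIT.
    apply: ge0_le_integral => //.
    - exact/measurable_EFinP.
    - exact: (measurable_fun_fubini_tonelli_F _ mF F0).
    - move=> x _; rewrite /F/= ge0_integralZl//; last 2 first.
      + exact: measurable_bessel_integrand.
      + by move=> y _; rewrite mule_ge0 ?lee_fin.
      rewrite -bessel_potentialE//; rewrite indicE; case: (boolP (x \in A)) => [/set_mem Ax|_].
        by rewrite mul1e; exact: fA.
      by rewrite mul0e.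
  rewrite (fubini_tonelli (m1 := leb) (m2 := leb) _ mF F0).
  apply: ge0_le_integral => //.
  - by move=> y _; exact: integral_ge0.
  - exact: (measurable_fun_fubini_tonelli_G _ mF F0).
  - apply: emeasurable_funD; apply: measurable_funeM => //.
    by apply/measurable_EFinP; apply: (@measurableT_comp _ _ _ _ _ _ (fun t : R => t `^ s)).
  move=> y _.
  have -> : (\int[leb]_x F (x, y) = (f y)%:E * h y)%E.
    transitivity (\int[leb]_x ((f y)%:E * H (x, y)))%E.
      by apply: eq_integral => x _; rewrite /F /H/= muleA muleC.
    apply: (ge0_integralZl _ measurableT (mHy y)) => //.
    by rewrite lee_fin.
  have hfin : h y \is a fin_num by rewrite ge0_fin_numE// (le_lt_trans (h1 y))// ltry.
  move: (h0 y) (h1 y); rewrite -(fineK hfin) !lee_fin => hy0 hy1.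
  set t := fine (h y) in hy0 hy1 *; set r := f y.
  have r0 : 0 <= r by exact: f0.
  have rs0 : 0 <= k * r `^ s by rewrite mulr_ge0 ?powR_ge0// ltW.
  (* For r > 1/2 one has (2 r)^(s - 1) >= 1, hence r <= 2^(s - 1) r^s. *)
  have [r2|r2] := leP r 2^-1.
    apply: (@le_trans _ _ (2^-1 * t)); first by rewrite ler_wpM2r.
    by rewrite lerDl.
  apply: (@le_trans _ _ (k * r `^ s)); last by rewrite lerDr mulr_ge0.
  apply: (@le_trans _ _ r); first by rewrite ler_piMr.
  have rp : 0 < r by rewrite (lt_trans _ r2).
  have -> : r `^ s = r * r `^ (s - 1) by rewrite -[X in X * _]powRr1// -powRD ?subrKC// gt_eqF// implybT.
  rewrite mulrCA ler_peMr// /k -powRM//.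
  have r21 : 1 <= 2 * r by move: r2; lra.
  by rewrite -[X in X <= _](powRr0 (2 * r)) ler_powR// subr_ge0 ltW.
move: key; rewrite ge0_integralD//; last 4 first.
- by move=> y _; rewrite mule_ge0 ?lee_fin.
- exact: measurable_funeM.
- by move=> y _; rewrite -EFinM lee_fin mulr_ge0 ?powR_ge0// ltW.
- apply: measurable_funeM.
  by apply/measurable_EFinP; apply: (@measurableT_comp _ _ _ _ _ _ (fun t : R => t `^ s)).
have mfs : measurable_fun setT (fun y : V => (f y `^ s)%:E).
  by apply/measurable_EFinP; apply: (@measurableT_comp _ _ _ _ _ _ (fun t : R => t `^ s)).
have fs0 (y : V) : (0 <= (f y `^ s)%:E)%E by rewrite lee_fin powR_ge0.
have e1 := ge0_integralZl leb measurableT mh (fun y _ => h0 y) (ltac:(by rewrite lee_fin) : (0 <= (2^-1 : R)%:E)%E).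
have e2 := ge0_integralZl leb measurableT mfs (fun y _ => fs0 y) (ltac:(by rewrite lee_fin ltW) : (0 <= k%:E)%E).
rewrite e1 e2 hA.
have : (0 <= \int[leb]_y (f y `^ s)%:E)%E.
  by apply: integral_ge0 => y _; rewrite lee_fin powR_ge0.
have : leb A \is a fin_num by rewrite ge0_fin_numE.
move: (leb A) => [a| |]// _; move: (\int[leb]_y _)%E => [X| |]// _; last by rewrite leey.
rewrite -!EFinM -EFinD !lee_fin => aX.
rewrite invfM -mulrA mulrCA ler_pdivrMl//; lra.
Qed.

(** A small box in U has positive and finite volume, which bounds its capacity from below. *)
Lemma capacity_gt0 (A U : set V) : open U -> U !=set0 -> U `<=` A -> (0 < C A)%E.
Proof.
move=> oU [x Ux] UA.
have [e e0 exU] := open_box_nbhs (open_nbhs_nbhs (conj oU Ux)).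
apply: (@lt_le_trans _ _ (C (open_box x e))); last first.
  by apply: capacity_mono; exact: subset_trans exU UA.
rewrite lt0e capacity_ge0 andbT; apply/eqP => c0.
have [k k0 kC] := capacity_ge_measure.
have := kC _ (measurable_open_box x e).
rewrite lebesgue_open_box// c0 ltry => /(_ isT); rewrite -EFinM lee_fin leNgt.
by rewrite mulr_gt0// exprn_gt0// mulr_gt0.
Qed.

End capacity.

(** * Radon measures and their upper integrals *)

Section Cc_lattice.
Context {R : realType} {n : nat}.
Local Notation V := 'rV[R]_n.
Local Notation C0 := (Cc R n).
Implicit Types phi psi : C0.

Lemma Cc_continuous phi : continuous (phi : V -> R^o).
Proof. by have /CcP[] := Cc_funP phi. Qed.

Lemma Cc_supp_compact phi : compact (fun_supp phi).
Proof. by have /CcP[] := Cc_funP phi. Qed.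

Lemma Cc_ext phi psi : (forall x, phi x = psi x) -> phi = psi.
Proof. by move=> h; apply: val_inj; apply/funext. Qed.

Lemma Cc_pred_dominated phi psi (f : V -> R^o) : continuous f ->
  (forall x, phi x = 0 -> psi x = 0 -> f x = 0) -> f \in @Cc_pred R n.
Proof.
move=> cf h; apply/CcP; split => //.
apply: (@subclosed_compact _ _ (fun_supp phi `|` fun_supp psi)).
- exact: closed_closure.
- by apply: compactU; exact: Cc_supp_compact.
- rewrite /fun_supp -closureU; apply: closureS => x /= fx.
  have [p0|] := eqVneq (phi x) 0; last by left.
  have [q0|] := eqVneq (psi x) 0; last by right.
  by rewrite h ?eqxx in fx.
Qed.

Lemma Cc_min_subproof phi psi :
  (fun x => Num.min (phi x : R) (psi x) : R^o) \in @Cc_pred R n.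
Proof.
apply: (Cc_pred_dominated (phi := phi) (psi := psi)) => [x|x -> ->]; last by rewrite minxx.
by apply: (@continuous_min R V (phi : V -> R) (psi : V -> R) x); exact: Cc_continuous.
Qed.
Definition Cc_min phi psi : C0 := MkCc (Cc_min_subproof phi psi).

Lemma Cc_max_subproof phi psi :
  (fun x => Num.max (phi x : R) (psi x) : R^o) \in @Cc_pred R n.
Proof.
apply: (Cc_pred_dominated (phi := phi) (psi := psi)) => [x|x -> ->]; last by rewrite maxxx.
by apply: (@continuous_max R V (phi : V -> R) (psi : V -> R) x); exact: Cc_continuous.
Qed.
Definition Cc_max phi psi : C0 := MkCc (Cc_max_subproof phi psi).

Lemma Cc_abs_subproof phi : (fun x => `|phi x : R| : R^o) \in @Cc_pred R n.
Proof.
apply: (Cc_pred_dominated (phi := phi) (psi := phi)) => [x|x -> _]; last by rewrite normr0.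
by apply: (continuous_comp (g := fun y : R^o => `|y| : R^o)); [exact: Cc_continuous|exact: norm_continuous].
Qed.
Definition Cc_abs phi : C0 := MkCc (Cc_abs_subproof phi).

Lemma Cc_cut_subproof phi (e : R) : 0 <= e ->
  (fun x => Num.min (phi x : R) e : R^o) \in @Cc_pred R n.
Proof.
move=> e0; apply: (Cc_pred_dominated (phi := phi) (psi := phi)) => [x|x -> _]; last exact/min_idPl.
apply: (@continuous_min R V (phi : V -> R) (cst e) x); first exact: Cc_continuous.
exact: cst_continuous.
Qed.
Definition Cc_cut phi (e : R) (e0 : 0 <= e) : C0 := MkCc (Cc_cut_subproof phi e0).

Lemma Cc_min_continuous_subproof phi (g : V -> R) : continuous g -> (forall x, 0 <= phi x) ->
  (forall x, 0 <= g x) -> (fun x => Num.min (phi x : R) (g x) : R^o) \in @Cc_pred R n.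
Proof.
move=> cg phi0 g0; apply: (Cc_pred_dominated (phi := phi) (psi := phi)) => [x|x -> _]; last exact/min_idPl.
by apply: (@continuous_min R V (phi : V -> R) g x); [exact: Cc_continuous|exact: cg].
Qed.

Lemma Cc_bounded phi : exists2 M : R, 0 < M & forall x, `|phi x| <= M.
Proof.
have cK : compact (fun_supp phi) by exact: Cc_supp_compact.
have : compact ((phi : V -> R^o) @` fun_supp phi).
  by apply: continuous_compact => //; apply: continuous_subspaceT; exact: Cc_continuous.
move=> /compact_bounded[M [Mr HM]].
exists (`|M| + 1); first by rewrite ltr_wpDl.
move=> x; have [->|p0] := eqVneq (phi x) 0; first by rewrite normr0 addr_ge0.
apply: (HM (`|M| + 1)); first by rewrite (le_lt_trans (ler_norm _))// ltrDl.
by exists x => //; exact: subset_closure.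
Qed.

Lemma Cc_supp_dominated phi psi : (forall x, phi x = 0 -> psi x = 0) ->
  fun_supp psi `<=` fun_supp phi.
Proof.
by move=> h; apply: closureS => x /=; apply: contra => /eqP /h ->.
Qed.

End Cc_lattice.

Section total_variation.
Context {R : realType} {n : nat}.
Local Notation V := 'rV[R]_n.
Local Notation C0 := (Cc R n).
Variable mu : C0 -> R.
Hypothesis mu_radon : is_radon mu.
Implicit Types phi psi : C0.
Local Notation tv := (@Defs.total_variation R n mu).

Lemma radonP a phi psi : mu (a *: phi + psi) = a * mu phi + mu psi.
Proof. exact: mu_radon.1. Qed.

Lemma radonD phi psi : mu (phi + psi) = mu phi + mu psi.
Proof. by rewrite -[phi in LHS]scale1r radonP mul1r. Qed.

Lemma radon0 : mu 0 = 0.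
Proof. by have := radonD 0 0; rewrite addr0 => h; lra. Qed.

Lemma radonZ a phi : mu (a *: phi) = a * mu phi.
Proof. by rewrite -[a *: phi]addr0 radonP radon0 addr0. Qed.

Lemma radonB phi psi : mu (phi - psi) = mu phi - mu psi.
Proof. by rewrite radonD -scaleN1r radonZ mulN1r. Qed.

(** Among the functions supported in K, the neighbourhood where |mu| < 1 contains a sup-norm ball of
    some radius d; rescale psi into it. The constant is 1 / d. *)
Lemma radon_bounded (K : set V) : compact K -> exists2 c : R, 0 < c &
  forall psi e, 0 < e -> fun_supp psi `<=` K -> (forall x, `|psi x| <= e) ->
    `|mu psi| <= c * e.
Proof.
move=> cK; have [W [W1 _ /(_ _ cK)[d d0 Wd]]] := mu_radon.2 _ (@ltr01 R).
exists d^-1; first by rewrite invr_gt0.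
move=> psi e e0 sK pe.
have /W1 /= : W ((d / e) *: psi).
  apply: Wd.
    apply: subset_trans sK; apply: Cc_supp_dominated => x p0.
    by rewrite -[LHS]/(d / e * psi x) p0 mulr0.
  move=> x; rewrite -[X in `|X|]/(d / e * psi x) normrM gtr0_norm ?divr_gt0//.
  by rewrite mulrAC ler_pdivrMr// ler_pM2l.
rewrite radonZ normrM gtr0_norm ?divr_gt0// mulrAC ltr_pdivrMr// mul1r => h.
by rewrite mulrC ler_pdivlMr// mulrC ltW.
Qed.

Lemma tv_ge phi psi : (forall x, `|psi x| <= phi x) -> (`|mu psi|%:E <= tv phi)%E.
Proof. by move=> h; apply: ereal_sup_ubound; exists psi. Qed.

Lemma tv_ge0 phi : (forall x, 0 <= phi x) -> (0 <= tv phi)%E.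
Proof.
move=> p0; have : (`|mu 0|%:E <= tv phi)%E.
  by apply: tv_ge => x; rewrite [X in `|X|](_ : _ = 0)// normr0.
by rewrite radon0 normr0.
Qed.

(** Riesz decomposition: clipping t to the range from - phi1 to phi1 leaves a remainder bounded by
    phi2. *)
Lemma tvD phi phi1 phi2 : (forall x, 0 <= phi1 x) -> (forall x, 0 <= phi2 x) ->
  (forall x, phi x <= phi1 x + phi2 x) -> (tv phi <= tv phi1 + tv phi2)%E.
Proof.
move=> p1 p2 p12; apply: ge_ereal_sup => _ [t /= tp <-].
pose t1 := Cc_max (- phi1) (Cc_min t phi1).
have -> : mu t = mu t1 + mu (t - t1) by rewrite radonB addrC subrK.
apply: (@le_trans _ _ (`|mu t1|%:E + `|mu (t - t1)|%:E)%E).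
  by rewrite -EFinD lee_fin ler_normD.
have key x : `|t1 x| <= phi1 x /\ `|(t - t1) x| <= phi2 x.
  have := tp x; have := p1 x; have := p2 x; have := p12 x.
  have -> : (t - t1) x = t x - t1 x by [].
  have -> : t1 x = Num.max (- (phi1 x : R)) (Num.min (t x : R) (phi1 x)) by [].
  move: (t x : R) (phi1 x : R) (phi2 x : R) (phi x : R) => a b c d.
  rewrite !ler_norml => h1 h2 h3 /andP[h4 h5].
  rewrite minElt maxElt; do 2 case: ifPn; rewrite -?leNgt => ? ?; split; lra.
by apply: leeD; apply: tv_ge => x; have [] := key x.
Qed.

Lemma tv_bounded (K : set V) : compact K -> exists2 c : R, 0 < c &
  forall phi e, 0 < e -> fun_supp phi `<=` K -> (forall x, phi x <= e) ->
    (tv phi <= (c * e)%:E)%E.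
Proof.
move=> /radon_bounded[c c0 H]; exists c => // phi e e0 sK pe.
apply: ge_ereal_sup => _ [t /= tp <-]; rewrite lee_fin; apply: H => //.
  apply: subset_trans sK; apply: Cc_supp_dominated => x p0.
  by have := tp x; rewrite p0 normr_le0 => /eqP.
by move=> x; apply: le_trans (tp x) (pe x).
Qed.

Lemma tvZ (a : R) phi : 0 < a -> (tv (a *: phi) <= a%:E * tv phi)%E.
Proof.
move=> a0; apply: ge_ereal_sup => _ [t /= tp <-].
have -> : mu t = a * mu (a^-1 *: t) by rewrite radonZ mulVKf// gt_eqF.
rewrite normrM gtr0_norm// EFinM; apply: lee_wpmul2l; first by rewrite lee_fin ltW.
apply: tv_ge => x.
rewrite -[X in `|X|]/(a^-1 * t x) normrM gtr0_norm ?invr_gt0//.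
by rewrite ler_pdivrMl//; exact: tp.
Qed.

(* The minimum of [phi] and a small constant is supported in that of [phi]; it
   has small variation by continuity of [mu]. *)
Lemma tv_cut phi : (forall x, 0 <= phi x) -> forall e : R, 0 < e ->
  exists d : R, exists d0 : 0 <= d, 0 < d /\
    (tv phi <= tv (phi - Cc_cut phi d0)%R + e%:E)%E.
Proof.
move=> p0 e e0; have [c c0 H] := tv_bounded (Cc_supp_compact (phi := phi)).
have d0 : 0 < e / c by rewrite divr_gt0.
exists (e / c), (ltW d0); split => //.
have cE x : Cc_cut phi (ltW d0) x = Num.min (phi x : R) (e / c) by [].
apply: (@le_trans _ _ (tv (phi - Cc_cut phi (ltW d0))%R + tv (Cc_cut phi (ltW d0)))%E).
  apply: tvD => x.
  - by rewrite -[leRHS]/(phi x - Cc_cut phi (ltW d0) x) subr_ge0 cE ge_min lexx.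
  - by rewrite cE le_min p0 ltW.
  - by rewrite -[leRHS]/(phi x - Cc_cut phi (ltW d0) x + Cc_cut phi (ltW d0) x) subrK.
rewrite leeD2l//; apply: le_trans (H _ _ d0 _ _) _.
- by apply: Cc_supp_dominated => x; rewrite cE => ->; exact/min_idPl/ltW.
- by move=> x; rewrite cE ge_min lexx orbT.
- by rewrite mulrCA divff ?gt_eqF// mulr1.
Qed.

End total_variation.

(** * Continuous minorants of lower semicontinuous functions *)

Section lipschitz_minorants.
Context {R : realType} {n : nat}.
Local Notation V := 'rV[R]_n.
Implicit Types (h : V -> \bar R) (x y z : V).

Lemma lipschitz_continuous (f : V -> R) (k : R) : 0 <= k ->
  (forall x z, f x <= f z + k * `|x - z|) -> continuous f.
Proof.
move=> k0 fk x; apply/(@cvgrPdist_le _ R^o V (nbhs x) _) => e e0.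
apply/nbhs_ballP; exists (e / (k + 1)); first by rewrite /= divr_gt0// ltr_wpDl.
move=> z; rewrite -ball_normE/= => xz.
have kxz : k * `|x - z| <= e.
  apply: (@le_trans _ _ ((k + 1) * `|x - z|)); first by rewrite ler_wpM2r// lerDl.
  by rewrite mulrC -ler_pdivlMr ?ltr_wpDl// ltW.
have := fk x z; have := fk z x; rewrite (distrC z) ler_norml.
by move: kxz; set u := k * _ => ? ? ?; apply/andP; split; lra.
Qed.

Lemma ereal_between (a : R) (s : \bar R) : (a%:E < s)%E ->
  exists2 c : R, a < c & (c%:E < s)%E.
Proof.
case: s => [s| |]//; last by exists (a + 1); rewrite ?ltry// ltrDl.
by rewrite lte_fin => ?; exists ((a + s) / 2); rewrite ?lte_fin ?midf_lt.
Qed.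

Definition trunc h (m : nat) y : R := fine (mine (h y) m%:R%:E).

(** For h >= 0 this is the largest m-Lipschitz minorant of min(h, m). The truncation keeps the
    infimum real where h is infinite; letting height and slope grow together makes the sequence
    increasing. *)
Definition lip_approx h (m : nat) x : R :=
  inf [set trunc h m y + m%:R * `|x - y| | y in [set: V]].

Section approx.
Variable h : V -> \bar R.
Hypothesis h0 : forall x, (0 <= h x)%E.

Let truncE m y : (trunc h m y)%:E = mine (h y) m%:R%:E.
Proof.
rewrite fineK// ge0_fin_numE; first by rewrite gt_min ltry orbT.
by rewrite le_min h0 lee_fin ler0n.
Qed.

Let trunc_ge0 m y : 0 <= trunc h m y.
Proof. by rewrite -lee_fin truncE le_min h0 lee_fin ler0n. Qed.

Let trunc_le m y : ((trunc h m y)%:E <= h y)%E.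
Proof. by rewrite truncE ge_min lexx. Qed.

Let lb0 m x : lbound [set trunc h m y + m%:R * `|x - y| | y in [set: V]] 0.
Proof. by move=> _ [y _ <-]; rewrite addr_ge0// mulr_ge0. Qed.

Lemma lip_approx_le m x y : lip_approx h m x <= trunc h m y + m%:R * `|x - y|.
Proof. by apply: ge_inf; [exists 0; exact: lb0|exists y]. Qed.

Lemma lip_approx_ge m x (b : R) : (forall y, b <= trunc h m y + m%:R * `|x - y|) ->
  b <= lip_approx h m x.
Proof.
move=> H; apply: lb_le_inf; first by exists (trunc h m x + m%:R * `|x - x|), x.
by move=> _ [y _ <-].
Qed.

Lemma lip_approx_ge0 m x : 0 <= lip_approx h m x.
Proof. by apply: lip_approx_ge => y; rewrite addr_ge0// mulr_ge0. Qed.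

Lemma lip_approx_minorant m x : ((lip_approx h m x)%:E <= h x)%E.
Proof.
apply: le_trans (trunc_le m x); rewrite lee_fin.
by apply: le_trans (lip_approx_le m x x) _; rewrite subrr normr0 mulr0 addr0.
Qed.

Lemma lip_approx_continuous m : continuous (lip_approx h m).
Proof.
apply: (@lipschitz_continuous _ m%:R) => // x z.
rewrite -lerBlDr; apply: lip_approx_ge => y; rewrite lerBlDr.
apply: le_trans (lip_approx_le m x y) _.
rewrite -addrA lerD2l -mulrDr ler_wpM2l//.
by rewrite (_ : x - y = (z - y) + (x - z)) ?ler_normD// [RHS]addrC subrKA.
Qed.

Lemma lip_approx_mono m p x : (m <= p)%N -> lip_approx h m x <= lip_approx h p x.
Proof.
move=> mp; apply: lip_approx_ge => y; apply: le_trans (lip_approx_le m x y) _.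
rewrite lerD// ?ler_wpM2r ?ler_nat//.
rewrite -lee_fin !truncE le_min ge_min lexx/= ge_min lee_fin ler_nat mp orbT//.
Qed.

(** Points y near x have h(y) > b by semicontinuity, and points at distance at least r are penalised
    by m r. *)
Lemma lip_approx_sup x (b : R) : lower_semicontinuous h -> (b%:E < h x)%E ->
  exists m, b <= lip_approx h m x.
Proof.
move=> lh /lh[U /nbhs_ballP[r /= r0 rU] Ub].
(* Chosen so that both m > |b| and m r > |b|. *)
exists (Num.trunc (`|b| + `|b| / r)).+1.
have := truncnS_gt (`|b| + `|b| / r); set m := (Num.trunc _).+1 => bm.
have b0 : 0 <= `|b| / r by rewrite divr_ge0// ltW.
have bb := ler_norm b; have bb0 := normr_ge0 b.
apply: lip_approx_ge => y; have [xy|xy] := ltP `|x - y| r.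
  rewrite (@le_trans _ _ (trunc h m y))// ?lerDl ?mulr_ge0//.
  rewrite -lee_fin truncE le_min ltW ?Ub ?lee_fin//=; last by apply: rU; rewrite -ball_normE.
  move: bm bb b0; set u := _ / r; lra.
rewrite (@le_trans _ _ (m%:R * r)) ?ler_wpDl ?ler_wpM2l//.
rewrite -ler_pdivrMr// (le_trans (ler_wpM2r _ bb)) ?invr_ge0 ?ltW//.
by apply: le_lt_trans bm; rewrite lerDr.
Qed.

End approx.

Lemma lip_approx_sum_sup (h : nat -> V -> \bar R) x N (b : R) :
  (forall k x, (0 <= h k x)%E) -> (forall k, lower_semicontinuous (h k)) ->
  (b%:E < \sum_(k < N) h k x)%E -> exists m, b < \sum_(k < N) lip_approx (h k) m x.
Proof.
move=> h0 lh; elim: N b => [|N IH] b.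
  by rewrite !big_ord0 lte_fin => b0; exists 0%N; rewrite big_ord0.
rewrite big_ord_recr/=.
have S0 m : 0 <= \sum_(k < N) lip_approx (h k) m x.
  by apply: sumr_ge0 => k _; exact: lip_approx_ge0.
case E : (h N x) => [r| |] bS.
- move: bS; rewrite -lteBlDr// -EFinB => /ereal_between[b' bb' /IH[m1 mb]].
  (* The first N terms together exceed b' > b - r, so the last term may fall short of r by b' - (b -
     r). *)
  have [|m2 mr] := @lip_approx_sup _ (h0 N) x (r - (b' - (b - r))) (lh N).
    by rewrite E lte_fin ltrBlDr ltrDl subr_gt0.
  exists (maxn m1 m2); rewrite big_ord_recr/=.
  have l1 : \sum_(k < N) lip_approx (h k) m1 x <= \sum_(k < N) lip_approx (h k) (maxn m1 m2) x.
    by apply: ler_sum => k _; apply: lip_approx_mono => //; exact: leq_maxl.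
  have l2 : lip_approx (h N) m2 x <= lip_approx (h N) (maxn m1 m2) x.
    by apply: lip_approx_mono => //; exact: leq_maxr.
  move: l1 l2 mr mb; set u := lip_approx _ _ _; set v := \sum_(_ < _) _; set w := lip_approx _ _ _.
  set t := \sum_(_ < _) _; lra.
- have [|m mr] := @lip_approx_sup _ (h0 N) x (b + 1) (lh N); first by rewrite E ltry.
  exists m; rewrite big_ord_recr/=; have := S0 m; set u := \sum_(_ < _) _; lra.
- by have := h0 N x; rewrite E.
Qed.

End lipschitz_minorants.

(** * Countable subadditivity on lower semicontinuous functions *)

Section tv_lsc.
Context {R : realType} {n : nat}.
Local Notation V := 'rV[R]_n.
Local Notation C0 := (Cc R n).
Variable mu : C0 -> R.
Hypothesis mu_radon : is_radon mu.
Implicit Types phi psi : C0.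
Local Notation tv := (@Defs.total_variation R n mu).

Lemma tv_lsc_ge phi (h : V -> \bar R) : (forall x, 0 <= phi x) ->
  (forall x, ((phi x : R)%:E <= h x)%E) -> (tv phi <= tv_lsc mu h)%E.
Proof. by move=> p0 ph; apply: ereal_sup_ubound; exists phi. Qed.

Lemma tv_lsc_ge0 (h : V -> \bar R) : (forall x, (0 <= h x)%E) -> (0 <= tv_lsc mu h)%E.
Proof. by move=> h0; apply: le_trans (tv_ge0 mu_radon _) (@tv_lsc_ge 0 _ _ _). Qed.

Lemma tv_le0 phi : (forall x, phi x <= 0) -> (tv phi <= 0)%E.
Proof.
move=> p0; apply: ge_ereal_sup => _ [t /= tp <-].
have -> : t = 0.
  by apply: Cc_ext => x; apply/eqP; rewrite -normr_le0 (le_trans (tp x)).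
by rewrite radon0// normr0.
Qed.

(** Peel off min(phi, g N), which lies in C_0 because g N is continuous; what remains is bounded by
    the shorter sum. *)
Lemma tv_le_sum N (h : nat -> V -> \bar R) (g : nat -> V -> R) phi :
  (forall k, continuous (g k)) -> (forall k x, 0 <= g k x) ->
  (forall k x, ((g k x)%:E <= h k x)%E) -> (forall x, 0 <= phi x) ->
  (forall x, (phi x : R) <= \sum_(k < N) g k x) ->
  (tv phi <= \sum_(k < N) tv_lsc mu (h k))%E.
Proof.
move=> cg g0 gh; elim: N phi => [|N IH] phi p0 pg.
  by rewrite big_ord0; apply: tv_le0 => x; have := pg x; rewrite big_ord0.
pose p2 : C0 := MkCc (Cc_min_continuous_subproof (cg N) p0 (g0 N)).
have p2E x : p2 x = Num.min (phi x : R) (g N x) by [].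
have p1E x : (phi - p2) x = phi x - p2 x :> R by [].
have p20 x : 0 <= p2 x by rewrite p2E le_min p0 g0.
have p10 x : 0 <= (phi - p2) x by rewrite p1E subr_ge0 p2E ge_min lexx.
apply: (@le_trans _ _ (tv (phi - p2)%R + tv p2)%E).
  by apply: tvD => // x; rewrite p1E subrK.
rewrite big_ord_recr/= leeD//.
- apply: IH => // x; rewrite p1E p2E; have := pg x; rewrite big_ord_recr/=.
  have : 0 <= \sum_(k < N) g k x by apply: sumr_ge0 => k _.
  set s := \sum_(_ < _) _; set u := g N x; set v : R := phi x.
  by rewrite minElt; case: ifPn; rewrite -?leNgt => *; lra.
- apply: tv_lsc_ge => // x; apply: le_trans (gh N x).
  by rewrite lee_fin p2E ge_min lexx orbT.
Qed.

(* Dini: the Lipschitz minorants of the partial sums exhaust [phi] up to [d],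
   uniformly on its compact support. *)
Lemma tv_lsc_nneseries (h : nat -> V -> \bar R) phi :
  (forall k, lower_semicontinuous (h k)) -> (forall k x, (0 <= h k x)%E) ->
  (forall x, 0 <= phi x) -> (forall x, ((phi x : R)%:E <= \sum_(0 <= k <oo) h k x)%E) ->
  (tv phi <= \sum_(0 <= k <oo) tv_lsc mu (h k))%E.
Proof.
move=> lh h0 p0 ph; apply/lee_addgt0Pr => e e0.
have [d [d0 [dp tvd]]] := tv_cut mu_radon p0 e0; apply: le_trans tvd _.
rewrite leeD2r//; set p1 := phi - _.
have p1E x : p1 x = phi x - Num.min (phi x : R) d by [].
have p10 x : 0 <= p1 x by rewrite p1E subr_ge0 ge_min lexx.
(* One index for both the number of terms and the Lipschitz constant makes [F] increasing in m. *)
pose F m x := \sum_(k < m) lip_approx (h k) m x.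
have Fmono m p x : (m <= p)%N -> F m x <= F p x.
  move=> mp; rewrite /F (big_ord_widen _ (fun k => lip_approx (h k) m x) mp).
  rewrite [leRHS](bigID (fun k : 'I_p => (k < m)%N))/= ler_wpDr//.
    by apply: sumr_ge0 => k _; exact: lip_approx_ge0.
  by apply: ler_sum => k _; exact: lip_approx_mono.
have cF m : continuous (F m).
  have : forall N, continuous (fun x => \sum_(k < N) lip_approx (h k) m x : R^o).
    elim=> [|N IH] x.
      under eq_fun do rewrite big_ord0; exact: cst_continuous.
    under eq_fun do rewrite big_ord_recr/=.
    by apply: (@cvgD R R^o _ (nbhs x) _ (fun x => \sum_(k < N) lip_approx (h k) m x)
      (lip_approx (h N) m)); [exact: IH|exact: lip_approx_continuous].
  exact.
have Fsup x : exists m, phi x - d < F m x.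
  have : ((phi x - d)%:E < \sum_(0 <= k <oo) h k x)%E.
    by apply: lt_le_trans (ph x); rewrite lte_fin ltrBlDr ltrDl.
  rewrite ltNge => /negP H.
  have [N HN] : exists N, ((phi x - d)%:E < \sum_(k < N) h k x)%E.
    apply: contrapT => /forallNP H2; apply: H.
    apply: lime_le; first by apply: is_cvg_nneseries => k _ _; exact: h0.
    by apply: nearW => N; rewrite big_mkord leNgt; apply/negP; exact: H2.
  have [m mh] := lip_approx_sum_sup h0 lh HN.
  exists (maxn N m); apply: lt_le_trans mh _.
  apply: (@le_trans _ _ (\sum_(k < N) lip_approx (h k) (maxn N m) x)).
    by apply: ler_sum => k _; apply: lip_approx_mono => //; exact: leq_maxr.
  have NM := leq_maxl N m.
  rewrite /F (big_ord_widen _ (fun k => lip_approx (h k) (maxn N m) x) NM).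
  rewrite [leRHS](bigID (fun k : 'I_(maxn N m) => (k < N)%N))/= lerDl.
  by apply: sumr_ge0 => k _; exact: lip_approx_ge0.
have [m Hm] : exists m, forall x, fun_supp phi x -> phi x - d < F m x.
  have /compact_near_coveringP/(_ nat \oo (fun m x => phi x - d < F m x)) := Cc_supp_compact (phi := phi).
  case=> [x _|m _ Hm].
    have [m mx] := Fsup x.
    have cG : continuous (fun y => F m y - (phi y - d)).
      move=> y; apply: (@cvgB R R^o _ (nbhs y) _ (F m) (fun y => phi y - d)); first exact: cF.
      apply: (@cvgB R R^o _ (nbhs y) _ phi (cst d)); first exact: Cc_continuous.
      exact: cst_continuous.
    have : \forall y \near x, 0 < F m y - (phi y - d).
      by apply: (cvgr_gt _ (cG x)); rewrite subr_gt0.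
    move=> nx; exists ([set y | 0 < F m y - (phi y - d)], [set p | (m <= p)%N]).
      by split => //=; exists m.
    move=> [y p] [/= yx mp]; apply: lt_le_trans (Fmono _ _ y mp).
    by rewrite -subr_gt0.
  by exists m => x sx; apply: (Hm m (leqnn _)).
apply: (@le_trans _ _ (\sum_(k < m) tv_lsc mu (h k))%E); last first.
  rewrite -(big_mkord xpredT (fun k => tv_lsc mu (h k))).
  have H k : (0 <= tv_lsc mu (h k))%E by apply: tv_lsc_ge0.
  by apply: nneseries_lim_ge => *; exact: H.
apply: (@tv_le_sum m h (fun k => lip_approx (h k) m)) => //.
- by move=> k; exact: lip_approx_continuous.
- by move=> k x; exact: lip_approx_ge0.
- by move=> k x; exact: lip_approx_minorant.
move=> x; have Fm0 : 0 <= F m x by apply: sumr_ge0 => k _; exact: lip_approx_ge0.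
rewrite p1E; have [sx|nsx] := pselect (fun_supp phi x).
  by have := Hm x sx; rewrite /F; move: Fm0; rewrite /F minElt; case: ifPn => _; set u := \sum_(_ < _) _ => *; lra.
have -> : phi x = 0 by apply: contrapT => /eqP px; apply: nsx; exact: subset_closure.
by rewrite (min_idPl _)// subrr.
Qed.

End tv_lsc.

(** * Upper integral and integrable functions *)

Section upper_integral.
Context {R : realType} {n : nat}.
Local Notation V := 'rV[R]_n.
Local Notation C0 := (Cc R n).
Variable mu : C0 -> R.
Hypothesis mu_radon : is_radon mu.
Implicit Types (phi psi : C0) (h k : V -> \bar R) (f g : V -> R).
Local Notation tv := (@Defs.total_variation R n mu).
Local Notation U := (tv_upper_integral mu).

Lemma tv_lsc_le_nneseries k (h : nat -> V -> \bar R) :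
  (forall i, lower_semicontinuous (h i)) -> (forall i x, (0 <= h i x)%E) ->
  (forall x, (k x <= \sum_(0 <= i <oo) h i x)%E) ->
  (tv_lsc mu k <= \sum_(0 <= i <oo) tv_lsc mu (h i))%E.
Proof.
move=> lh h0 kh; apply: ge_ereal_sup => _ [phi /= pk <-].
apply: tv_lsc_nneseries => // x; first by have [] := pk x.
by apply: le_trans (kh x); have [] := pk x.
Qed.

Let nneseries2 (u : nat -> \bar R) : (forall i, (0 <= u i)%E) ->
  (forall i, u i.+2 = 0%E) -> (\sum_(0 <= i <oo) u i = u 0%N + u 1%N)%E.
Proof.
move=> u0 u2; rewrite (nneseries_split _ 2)//= big_mkord !big_ord_recl big_ord0/= adde0.
rewrite [X in (_ + X)%E](_ : _ = 0%E) ?adde0//.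
by apply: eseries0 => -[|[|i]]// _ _; exact: u2.
Qed.

(** Two functions padded with zeros form a series, to which the countable case applies. *)
Lemma tv_lscD h1 h2 : lower_semicontinuous h1 -> lower_semicontinuous h2 ->
  (forall x, (0 <= h1 x)%E) -> (forall x, (0 <= h2 x)%E) ->
  (tv_lsc mu (fun x => h1 x + h2 x) <= tv_lsc mu h1 + tv_lsc mu h2)%E.
Proof.
move=> l1 l2 p1 p2.
pose h (i : nat) : V -> \bar R :=
  if i is 0%N then h1 else if i is 1%N then h2 else cst 0%E.
have h0 i x : (0 <= h i x)%E by case: i => [|[|i]] /=.
have lh i : lower_semicontinuous (h i).
  case: i => [|[|i]] //= x a a0; exists setT => //; exact: filterT.
have t0 i : tv_lsc mu (h i.+2) = 0%E.
  apply/eqP; rewrite eq_le tv_lsc_ge0// andbT; apply: ge_ereal_sup => _ [phi /= pk <-].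
  by apply: tv_le0 => // x; have [_] := pk x; rewrite lee_fin.
have -> : (tv_lsc mu h1 + tv_lsc mu h2 = \sum_(0 <= i <oo) tv_lsc mu (h i))%E.
  by rewrite nneseries2// => i; exact: tv_lsc_ge0.
by apply: tv_lsc_le_nneseries => // x; rewrite nneseries2.
Qed.

Lemma lower_semicontinuousD h1 h2 : lower_semicontinuous h1 -> lower_semicontinuous h2 ->
  (forall x, (0 <= h1 x)%E) -> (forall x, (0 <= h2 x)%E) ->
  lower_semicontinuous (fun x => h1 x + h2 x)%E.
Proof.
move=> l1 l2 p1 p2 x a; case E : (h1 x) => [r| |] ax.
- move: ax; rewrite addeC -lteBlDr// -EFinB => /ereal_between[c ac /l2[A2 nA2 HA2]].
  have [A1 nA1 HA1] : exists2 A, nbhs x A & forall y, A y -> ((a - c)%:E < h1 y)%E.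
    by apply: l1; rewrite E lte_fin ltrBlDr -ltrBlDl.
  exists (A1 `&` A2); first exact: filterI.
  move=> y [/HA1 y1 /HA2 y2].
  have -> : a%:E = ((a - c)%:E + c%:E)%E by rewrite -EFinD subrK.
  exact: lteD.
- have [A nA HA] := l1 x a (ltac:(by rewrite E ltry)); exists A => // y /HA ya.
  by rewrite -[a%:E]adde0 lte_leD// fin_num_abs.
- by have := p1 x; rewrite E.
Qed.

Lemma uint_ge0 h : (forall x, (0 <= h x)%E) -> (0 <= U h)%E.
Proof.
move=> h0; apply: le_ereal_inf_tmp => _ [k [_ hk] <-]; apply: tv_lsc_ge0 => // x.
exact: le_trans (hk x).
Qed.

Lemma uint_mono h k : (forall x, (h x <= k x)%E) -> (U h <= U k)%E.
Proof.
move=> hk; apply: le_ereal_inf => _ [l [ll kl] <-]; exists l => //; split => // x.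
exact: le_trans (kl x).
Qed.

Lemma uint_le h k : lower_semicontinuous k -> (forall x, (h x <= k x)%E) -> (U h <= tv_lsc mu k)%E.
Proof. by move=> lk hk; apply: ereal_inf_lbound; exists k. Qed.

Lemma uintD h1 h2 : (forall x, (0 <= h1 x)%E) -> (forall x, (0 <= h2 x)%E) ->
  (U (fun x => h1 x + h2 x) <= U h1 + U h2)%E.
Proof.
move=> p1 p2; have u1 := uint_ge0 p1; have u2 := uint_ge0 p2.
have [f1|] := boolP (U h1 \is a fin_num); last first.
  by rewrite ge0_fin_numE// -leNgt leye_eq => /eqP ->; rewrite addye ?leey// gt_eqF// (lt_le_trans _ u2).
have [f2|] := boolP (U h2 \is a fin_num); last first.
  by rewrite ge0_fin_numE// -leNgt leye_eq => /eqP ->; rewrite addey ?leey// gt_eqF// (lt_le_trans _ u1).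
apply/lee_addgt0Pr => e e0; have e2 : 0 < e / 2 by rewrite divr_gt0.
have [_ [k1 [l1 hk1] <-] t1] := lb_ereal_inf_adherent e2 f1.
have [_ [k2 [l2 hk2] <-] t2] := lb_ereal_inf_adherent e2 f2.
have q1 x : (0 <= k1 x)%E by exact: le_trans (hk1 x).
have q2 x : (0 <= k2 x)%E by exact: le_trans (hk2 x).
apply: (@le_trans _ _ (tv_lsc mu (fun x => k1 x + k2 x))%E).
  by apply: uint_le; [exact: lower_semicontinuousD|move=> x; exact: leeD].
apply: (le_trans (tv_lscD l1 l2 q1 q2)).
rewrite [e]splitr EFinD addeACA; exact: leeD (ltW t1) (ltW t2).
Qed.

Lemma tv_lscZ (a : R) k : 0 < a -> (tv_lsc mu (fun x => a%:E * k x) <= a%:E * tv_lsc mu k)%E.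
Proof.
move=> a0; apply: ge_ereal_sup => _ [phi /= pk <-].
have -> : phi = a *: (a^-1 *: phi) by rewrite scalerA mulfV ?scale1r// gt_eqF.
apply: le_trans (tvZ mu_radon _ a0) _; apply: lee_wpmul2l; first by rewrite lee_fin ltW.
apply: tv_lsc_ge => x; have [px pkx] := pk x; have -> : (a^-1 *: phi) x = a^-1 * phi x by [].
- by rewrite mulr_ge0// invr_ge0 ltW.
- by rewrite EFinM lee_pdivrMl.
Qed.

Lemma lower_semicontinuousZ (a : R) k : 0 < a -> lower_semicontinuous k ->
  lower_semicontinuous (fun x => a%:E * k x)%E.
Proof.
move=> a0 lk x b; rewrite -lte_pdivrMl// -EFinM => /lk[A nA HA]; exists A => // y /HA.
by rewrite EFinM lte_pdivrMl.
Qed.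

Lemma uintZ (a : R) h : 0 < a -> (U (fun x => a%:E * h x) <= a%:E * U h)%E.
Proof.
move=> a0; rewrite -lee_pdivrMl//; apply: le_ereal_inf_tmp => _ [k [lk hk] <-].
rewrite lee_pdivrMl//; apply: le_trans (tv_lscZ _ a0).
apply: uint_le; first exact: lower_semicontinuousZ.
by move=> x; apply: lee_wpmul2l => //; rewrite lee_fin ltW.
Qed.

Lemma uint0 : (U (fun=> 0) <= 0)%E.
Proof.
apply: (@le_trans _ _ (tv_lsc mu (fun=> 0%E))).
  by apply: uint_le => // x a a0; exists setT => //; exact: filterT.
apply: ge_ereal_sup => _ [phi /= pk <-].
by apply: tv_le0 => // x; have [_] := pk x; rewrite lee_fin.
Qed.

(** Every lower semicontinuous majorant of |phi| admits |phi| itself as a test function. *)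
Lemma radon_le_uint phi : (`|mu phi|%:E <= U (fun x => `|phi x|%:E))%E.
Proof.
apply: le_ereal_inf_tmp => _ [k [_ hk] <-].
apply: (@le_trans _ _ (tv (Cc_abs phi))); first exact: tv_ge.
by apply: tv_lsc_ge => x //=; exact: hk.
Qed.

Let absB f g x : (0 <= `|f x - g x|%:E)%E. Proof. by rewrite lee_fin. Qed.

Lemma uint_triangle f g t : (U (fun x => `|f x - g x|%:E) <=
  U (fun x => `|f x - t x|%:E) + U (fun x => `|t x - g x|%:E))%E.
Proof.
apply: le_trans (uintD _ _); try exact: absB.
apply: uint_mono => x; rewrite -EFinD lee_fin.
by rewrite (_ : f x - g x = (f x - t x) + (t x - g x)) ?ler_normD// subrKA.
Qed.

Lemma uint_distC f g : U (fun x => `|f x - g x|%:E) = U (fun x => `|g x - f x|%:E).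
Proof. by congr U; apply/funext => x; rewrite distrC. Qed.

Lemma radon_dist_le phi psi f : (`|mu phi - mu psi|%:E <=
  U (fun x => `|f x - phi x|%:E) + U (fun x => `|f x - psi x|%:E))%E.
Proof.
rewrite -(radonB mu_radon); apply: le_trans (radon_le_uint _) _.
rewrite [X in (X + _)%E]uint_distC; exact: uint_triangle.
Qed.

Lemma has_integral_unique f v w : has_integral mu f v -> has_integral mu f w -> v = w.
Proof.
move=> fv fw; apply/eqP; rewrite -subr_eq0 -normr_le0; apply/ler_addgt0Pr => e e0.
rewrite add0r; have e4 : 0 < e / 4 by rewrite divr_gt0.
have [p [up pv]] := fv _ e4; have [q [uq qw]] := fw _ e4.
have := le_lt_trans (radon_dist_le p q f) (lteD up uq).
rewrite -EFinD lte_fin; move: pv qw; rewrite !ltr_norml ler_norml => /andP[? ?] /andP[? ?] /andP[? ?].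
by apply/andP; split; lra.
Qed.

Lemma has_integral_le f v : has_integral mu f v -> (`|v|%:E <= U (fun x => `|f x|%:E))%E.
Proof.
move=> fv; apply/lee_addgt0Pr => e e0; have e2 : 0 < e / 2 by rewrite divr_gt0.
have [p [up pv]] := fv _ e2.
apply: (@le_trans _ _ (`|mu p|%:E + (e / 2)%:E)%E).
  rewrite -EFinD lee_fin; have := ler_normB (mu p) (mu p - v).
  by rewrite subKr; move: pv; lra.
rewrite [X in (_ <= _ + X%:E)%E]splitr EFinD addeA leeD2r//.
apply: (le_trans (radon_le_uint p)).
apply: (@le_trans _ _ (U (fun x => `|f x|%:E) + U (fun x => `|f x - p x|%:E))%E); last first.
  by rewrite leeD2l// ltW.
apply: le_trans (uintD _ _) => //; apply: uint_mono => x; rewrite -EFinD lee_fin.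
have := ler_normB (f x) (f x - p x); by rewrite subKr.
Qed.

Lemma has_integral_Cc phi : has_integral mu phi (mu phi).
Proof.
move=> e e0; exists phi; rewrite subrr normr0; split => //.
rewrite (_ : (fun x => _) = (fun=> 0%E)); first by rewrite (le_lt_trans uint0)// lte_fin.
by apply/funext => x; rewrite subrr normr0.
Qed.

Lemma has_integral_lin (a : R) f g v w : has_integral mu f v -> has_integral mu g w ->
  has_integral mu (fun x => a * f x + g x) (a * v + w).
Proof.
(* The factor |a| + 1 is positive also for a = 0, as the division below and [uintZ] require. *)
move=> fv gw e e0; have a1 : 0 < `|a| + 1 by rewrite ltr_wpDl.
pose d := e / (2 * (`|a| + 1)).
have d0 : 0 < d by rewrite divr_gt0// mulr_gt0.
have e2 : 0 < e / 2 by rewrite divr_gt0.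
have dE : (`|a| + 1) * d = e / 2 by rewrite /d; field; rewrite gt_eqF.
have [p [up pv]] := fv _ d0; have [q [uq qw]] := gw _ e2.
exists (a *: p + q); split.
- apply: (@le_lt_trans _ _ (U (fun x => (`|a| + 1)%:E * `|f x - p x|%:E) + U (fun x => `|g x - q x|%:E))%E).
    apply: le_trans (uintD _ _).
    + apply: uint_mono => x; rewrite -EFinM -EFinD lee_fin.
      have -> : (a *: p + q) x = a * p x + q x by [].
      have -> : a * f x + g x - (a * p x + q x) = a * (f x - p x) + (g x - q x) by ring.
      rewrite (le_trans (ler_normD _ _))// lerD2r normrM ler_wpM2r// lerDl//.
    + by move=> x; rewrite -EFinM lee_fin mulr_ge0// ltW.
    + by move=> x; rewrite lee_fin.
  apply: (@lt_le_trans _ _ ((`|a| + 1)%:E * d%:E + (e / 2)%:E)%E); last first.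
    by rewrite -EFinM dE -EFinD -splitr.
  apply: lteD => //; apply: le_lt_trans (uintZ _ a1) _.
  by rewrite lte_pmul2l.
- rewrite (radonP mu_radon).
  have -> : a * mu p + mu q - (a * v + w) = a * (mu p - v) + (mu q - w) by ring.
  apply: (le_lt_trans (ler_normD _ _)); rewrite [e]splitr; apply: ler_ltD => //.
  by rewrite normrM -dE; apply: ler_pM => //; [rewrite lerDl|exact: ltW].
Qed.

(* The value is caught between the numbers [mu phi - U |f - phi|] and
   [mu psi + U |f - psi|]. *)
Lemma has_integral_ex f : (forall e : R, 0 < e -> exists phi,
  (U (fun x => `|f x - phi x|%:E) < e%:E)%E) -> exists v, has_integral mu f v.
Proof.
move=> Hf; pose u phi := U (fun x => `|f x - phi x|%:E).
have u0 phi : (0 <= u phi)%E by apply: uint_ge0; exact: absB.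
pose S := [set mu phi - fine (u phi) | phi in [set phi | (u phi < +oo)%E]].
have fu phi : (u phi < +oo)%E -> (fine (u phi))%:E = u phi.
  by move=> h; rewrite fineK// ge0_fin_numE.
have S1 psi : (u psi < +oo)%E -> ubound S (mu psi + fine (u psi)).
  move=> upsi _ [phi /= uphi <-].
  have := radon_dist_le phi psi f; rewrite -/(u phi) -/(u psi) -(fu _ upsi) -(fu _ uphi).
  by rewrite -EFinD lee_fin ler_norml => /andP[? ?]; lra.
have [p0 p0u] := Hf _ (@ltr01 R); have p0f : (u p0 < +oo)%E by rewrite (lt_trans p0u)// ltry.
have S0 : has_sup S.
  by split; [exists (mu p0 - fine (u p0)), p0|exists (mu p0 + fine (u p0)); exact: S1].
exists (sup S) => e e0; have [p pu] := Hf _ e0; exists p; split => //.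
have pf : (u p < +oo)%E by rewrite (lt_trans pu)// ltry.
have l1 : mu p - fine (u p) <= sup S by apply: ub_le_sup; [exact: S0.2|exists p].
have l2 : sup S <= mu p + fine (u p) by apply: ge_sup; [exact: S0.1|exact: S1].
have l3 : fine (u p) < e by rewrite -lte_fin fu.
by rewrite ltr_norml; apply/andP; split; lra.
Qed.

End upper_integral.

(** * Measures controlled by a capacity *)

Section regular_capacity.
Context {R : realType} {n : nat}.
Local Notation V := 'rV[R]_n.
Local Notation C0 := (Cc R n).
Implicit Types (mu : C0 -> R) (C : set V -> \bar R).

(* All that the duality uses of the Bessel capacity. *)
Record regular_capacity C : Prop := RegularCapacity {
  rcap_ge0 : forall E, (0 <= C E)%E ;
  rcap_mono : forall E F, E `<=` F -> (C E <= C F)%E ;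
  rcap0 : C set0 = 0%E ;
  rcap_outer : forall E b, (C E < b)%E ->
    exists U, [/\ open U, E `<=` U & (C U < b)%E] ;
  rcap_compact : forall K, compact K -> (C K < +oo)%E ;
  rcap_gt0 : forall A U, open U -> U !=set0 -> U `<=` A -> (0 < C A)%E }.

Variables (C : set V -> \bar R) (mu : C0 -> R).
Hypotheses (rC : regular_capacity C) (mu_radon : is_radon mu).
Local Notation tv := (@Defs.total_variation R n mu).

Let compactE (K : set V) : compact K -> C K <> 0%E ->
  exists2 r : R, 0 < r & C K = r%:E.
Proof.
move=> cK /eqP CK; have := rcap_compact rC cK; have := rcap_ge0 rC K.
by case: (C K) CK => [r| |]// r0 rp _; exists r => //; rewrite lt_neqAle eq_sym -lee_fin rp andbT.
Qed.

Lemma tv_open_ge0 (G : set V) : (0 <= tv_open mu G)%E.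
Proof. by apply: tv_lsc_ge0 => // x; rewrite lee_fin. Qed.

Lemma tv_outer_ge0 (E : set V) : (0 <= tv_outer mu E)%E.
Proof. by apply: le_ereal_inf_tmp => _ [G _ <-]; exact: tv_open_ge0. Qed.

Lemma tv_outer_le_open (E G : set V) : open G -> E `<=` G ->
  (tv_outer mu E <= tv_open mu G)%E.
Proof. by move=> oG EG; apply: ereal_inf_lbound; exists G. Qed.

Lemma norm_frakM_le (a : R) : (forall E : set V, (tv_outer mu E <= a%:E * C E)%E) ->
  (norm_frakM C mu <= a%:E)%E.
Proof.
move=> H; apply: ge_ereal_sup => _ [K [/compactE cK /cK[r r0 Kr]] <-].
by rewrite Kr inver gt_eqF// lee_pdivrMr// -Kr.
Qed.

(** The supremum over an empty family would be -oo; the closed unit ball supplies a compact set of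
    positive capacity. *)
Lemma norm_frakM_ge0 : (0 <= norm_frakM C mu)%E.
Proof.
pose K := [set x : V | `|x| <= 1].
have cK : compact K.
  apply: bounded_closed_compact.
    exists 1; split => // M M1 x /= x1; exact: le_trans (ltW M1).
  apply: (@closed_comp _ _ (fun x : V => `|x|) [set y : R | y <= 1]).
    by move=> x _; exact: norm_continuous.
  exact: closed_le.
have K0 : C K <> 0%E.
  apply/eqP; rewrite gt_eqF//; apply: (rcap_gt0 rC (U := ball (0 : V) 1)).
  - exact: ball_open.
  - by exists 0; exact: ballxx.
  - by move=> x; rewrite -ball_normE/= sub0r normrN => /ltW.
apply: le_trans (ereal_sup_ubound _); last by exists K.
have [r r0 ->] := compactE cK K0.
by rewrite inver gt_eqF// mule_ge0 ?tv_outer_ge0// lee_fin invr_ge0 ltW.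
Qed.

(* [K] is a compact superlevel set of [phi], on which [|mu|] is controlled. *)
Lemma tv_open_le (a : R) (G : set V) : (norm_frakM C mu <= a%:E)%E -> open G ->
  (tv_open mu G <= a%:E * C G)%E.
Proof.
move=> na oG; have a0 : 0 <= a by rewrite -lee_fin (le_trans norm_frakM_ge0).
have CG0 := rcap_ge0 rC G.
have aCG0 : (0 <= a%:E * C G)%E by rewrite mule_ge0.
apply: ge_ereal_sup => _ [phi /= pG <-].
have p0 x : 0 <= phi x by have [] := pG x.
have p1 x : phi x <= (\1_G x : R) by have [_] := pG x; rewrite lee_fin.
apply/lee_addgt0Pr => e e0; have [d [d0 [dp tvd]]] := tv_cut mu_radon p0 e0.
apply: le_trans tvd _; rewrite leeD2r//; set p := phi - _.
have pE x : p x = phi x - Num.min (phi x : R) d by [].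
have pp0 x : 0 <= p x by rewrite pE subr_ge0 ge_min lexx.
(* Without such a point phi is at most d everywhere and [p] vanishes. *)
have [[x dx]|H] := pselect (exists x, d < phi x); last first.
  apply: le_trans aCG0; apply: tv_le0 => // x; rewrite pE (min_idPl _) ?subrr// leNgt.
  by apply/negP => dx; apply: H; exists x.
pose K := [set x : V | d <= phi x].
have cK : compact K.
  apply: (@subclosed_compact _ _ (fun_supp phi)).
  - apply: (@closed_comp _ _ (phi : V -> R) [set y : R | d <= y]); last exact: closed_ge.
    by move=> y _; exact: Cc_continuous.
  - exact: Cc_supp_compact.
  - by move=> y /= dy; apply: subset_closure; rewrite /= gt_eqF// (lt_le_trans dp).
have KG : K `<=` G.
  move=> y /= dy; apply: contrapT => Gy; have := le_trans dy (p1 y).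
  by rewrite indicE memNset// leNgt dp.
(* [K] contains the nonempty open set where phi > d, so its capacity is positive and its quotient
   occurs in the norm. *)
have [r r0 Kr] : exists2 r : R, 0 < r & C K = r%:E.
  apply: compactE => //; apply/eqP; rewrite gt_eqF//.
  apply: (rcap_gt0 rC (U := [set y : V | d < phi y])).
  - apply: (@open_comp _ _ (phi : V -> R) [set y : R | d < y]); last exact: open_gt.
    by move=> y _; exact: Cc_continuous.
  - by exists x.
  - by move=> y /= /ltW.
apply: (@le_trans _ _ (tv_outer mu K)).
  (* [p] vanishes off [K] and is at most 1, hence lies below the indicator of any open set
     containing [K]. *)
  apply: le_ereal_inf_tmp => _ [U [oU KU] <-]; apply: tv_lsc_ge => // y.
  rewrite lee_fin indicE; have [yU|yU] := boolP (y \in U).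
    have := p1 y; rewrite pE indicE; have := p0 y.
    have : ((y \in G)%:R : R) <= 1 by rewrite lern1 leq_b1.
    by rewrite minElt mulr1n; set u := (y \in G)%:R; case: ifPn => *; lra.
  rewrite pE (min_idPl _) ?subrr// leNgt; apply/negP => /ltW dy.
  by move/negP: yU; apply; apply/mem_set/KU.
apply: (@le_trans _ _ (a%:E * C K)%E); last first.
  by apply: lee_wpmul2l; rewrite ?lee_fin//; exact: rcap_mono.
have : (tv_outer mu K / C K <= a%:E)%E.
  apply: le_trans na; apply: ereal_sup_ubound; exists K => //; split => //.
  by rewrite Kr => -[] /eqP; rewrite gt_eqF.
by rewrite Kr inver gt_eqF// lee_pdivrMr.
Qed.

(** Outer regularity of C carries the bound from open sets to E, with a loss of a (e / a) = e. Where
    C(E) is infinite, a > 0 makes the bound trivial. *)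
Lemma tv_outer_le_of_open (a : R) (E : set V) : 0 < a ->
  (forall G, open G -> (tv_open mu G <= a%:E * C G)%E) ->
  (tv_outer mu E <= a%:E * C E)%E.
Proof.
move=> a0 mu_le; have [CE|] := ltP (C E) +oo%E; last first.
  by rewrite leye_eq => /eqP ->; rewrite gt0_muley ?leey// lte_fin.
have CE0 := rcap_ge0 rC E.
have fE : C E \is a fin_num by rewrite ge0_fin_numE.
apply/lee_addgt0Pr => e e0.
have [|U [oU EU CU]] := rcap_outer rC (E := E) (b := (C E + (e / a)%:E)%E).
  by rewrite lteDl// lte_fin divr_gt0.
apply: (le_trans (tv_outer_le_open oU EU)); apply: (le_trans (mu_le _ oU)).
apply: (@le_trans _ _ (a%:E * (C E + (e / a)%:E))%E).
  by apply: lee_wpmul2l; [rewrite lee_fin ltW|exact: ltW].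
by rewrite -(fineK fE) -EFinD -!EFinM -EFinD lee_fin mulrDr mulrCA divff ?mulr1// gt_eqF.
Qed.

Lemma norm_frakM_inf : norm_frakM C mu =
  ereal_inf [set a%:E | a in [set a : R | 0 < a /\
    forall E : set V, (tv_outer mu E <= a%:E * C E)%E]].
Proof.
apply/eqP; rewrite eq_le; apply/andP; split.
  by apply: le_ereal_inf_tmp => _ [a [_ H] <-]; exact: norm_frakM_le.
have N0 := norm_frakM_ge0; case E : (norm_frakM C mu) N0 => [r| |]//; last by move=> _; rewrite leey.
rewrite lee_fin => r0; apply/lee_addgt0Pr => e e0; apply: ereal_inf_lbound.
(* The slack e makes the candidate positive even when the norm is 0. *)
exists (r + e) => //; have re : 0 < r + e by rewrite ltr_wpDl.
split => // F; apply: tv_outer_le_of_open => // G oG; apply: tv_open_le => //.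
by rewrite E lee_fin lerDl ltW.
Qed.

End regular_capacity.

(** * Lorentz quasi-norms *)

Section scales.
Context {R : realType}.

(** Enumerates the integers as 0, -1, 1, -2, 2, ..., so that sums over all levels become series over
    [nat]. *)
Definition scale_index (k : nat) : int := if odd k then Negz k./2 else Posz k./2.

Lemma scale_index_inj : injective scale_index.
Proof.
move=> i j; rewrite /scale_index => ij.
rewrite -(odd_double_half i) -(odd_double_half j).
by move: ij; case: (odd i); case: (odd j) => // -[->].
Qed.

Lemma scale_index_surj (z : int) : exists k, scale_index k = z.
Proof.
case: z => m.
  by exists m.*2; rewrite /scale_index odd_double doubleK.
by exists m.*2.+1; rewrite /scale_index oddS odd_double/= uphalf_double.
Qed.

Definition scale k : R := expR (scale_index k)%:~R.

Lemma scale_gt0 k : 0 < scale k. Proof. exact: expR_gt0. Qed.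

(** Half-open, so that the shells tile ]0, +oo[: the shell containing t is the one whose index is
    the ceiling of ln t. *)
Definition shell k : set R := `]expR ((scale_index k)%:~R - 1), scale k].

Lemma trivIset_shell (D : set nat) : trivIset D shell.
Proof.
move=> i j _ _ [t []]; rewrite /shell/= !in_itv/= => /andP[i1 i2] /andP[j1 j2].
have t0 : 0 < t by apply: lt_trans i1; exact: expR_gt0.
apply: scale_index_inj; move: i1 i2 j1 j2.
rewrite /scale -{1 2 3 4}(lnK t0) !ltr_expR !ler_expR => i1 i2 j1 j2.
have E k : (scale_index k)%:~R - 1 < ln t -> ln t <= (scale_index k)%:~R ->
    Num.ceil (ln t) = scale_index k.
  by move=> k1 k2; apply: ceil_def; rewrite intrB k1 k2.
by rewrite -(E i)// -(E j).
Qed.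

Lemma scale_covers (t : R) : 0 < t -> exists k, scale k < t <= expR 1 * scale k.
Proof.
move=> t0; have [k kE] := scale_index_surj (Num.ceil (ln t) - 1).
have /andP[h1 h2] := ceil_itv (ln t); rewrite -ltr_expR lnK ?posrE// in h1.
rewrite -ler_expR lnK ?posrE// in h2.
by exists k; rewrite /scale -expRD kE h1/= intrB addrC subrK.
Qed.

End scales.

Section powR_sums.
Context {R : realType}.
Implicit Types q x y : R.

(** With u = x / (x + y) in [0, 1] one has u <= u^q; the same holds for y. Add the two inequalities
    and multiply by (x + y)^q. *)
Lemma powR_addr_le q x y : 0 < q -> q <= 1 -> 0 <= x -> 0 <= y ->
  (x + y) `^ q <= x `^ q + y `^ q.
Proof.
move=> q0 q1 x0 y0; have [s0|s0] := leP (x + y) 0.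
  have -> : x = 0 by lra.
  have -> : y = 0 by lra.
  by rewrite addr0 lerDl powR_ge0.
have sn0 : x + y != 0 by rewrite gt_eqF.
have H z : 0 <= z -> z <= x + y -> (x + y) `^ q * (z / (x + y)) <= z `^ q.
  move=> z0 zs; rewrite -[X in _ <= X `^ _](divfK sn0).
  have u0 : 0 <= z / (x + y) by rewrite divr_ge0// ltW.
  have u1 : z / (x + y) <= 1 by rewrite ler_pdivrMr// mul1r.
  rewrite powRM// ?(ltW s0)// mulrC ler_wpM2r ?powR_ge0//.
  move: (z / _) u0 u1 => u; rewrite le_eqVlt => /orP[/eqP <-|u0] u1; first exact: powR_ge0.
  by rewrite -[X in X <= _](powRr1 (ltW u0)) ger_powR// u0.
have := H x x0 (ltac:(by rewrite lerDl)); have := H y y0 (ltac:(by rewrite lerDr)).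
rewrite -[X in _ -> _ -> X <= _]mulr1 -[X in _ -> _ -> _ * X <= _](divff sn0).
rewrite [X in _ -> _ -> _ * X <= _]mulrDl mulrDr => ? ?; exact: lerD.
Qed.

Lemma powR_sumr_le q (a : nat -> R) m : 0 < q -> q <= 1 -> (forall k, 0 <= a k) ->
  (\sum_(k < m) a k) `^ q <= \sum_(k < m) (a k `^ q).
Proof.
move=> q0 q1 a0; elim: m => [|m IH]; first by rewrite !big_ord0 powR0// gt_eqF.
rewrite !big_ord_recr/=; apply: le_trans (powR_addr_le q0 q1 _ _) _ => //.
  by apply: sumr_ge0.
by rewrite lerD2r.
Qed.

(** Preimages of upper half-lines are intervals. It is meant for capacities of superlevel sets as
    functions of the level, whose measurability comes from monotonicity. *)
Lemma nonincreasing_emeasurable (g : R -> \bar R) :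
  (forall s t, s <= t -> (g t <= g s)%E) ->
  measurable_fun [set: measurableTypeR R] (g : measurableTypeR R -> \bar R).
Proof.
move=> gm; apply: (measurability _ (ErealGenOInfty.measurableE R)) => _ [_ [a ->] <-].
rewrite setTI; apply: is_interval_measurable => s t /= gs gt u /andP[su ut].
move: gs gt; rewrite !in_itv/= !andbT => gs gt.
exact: lt_le_trans gt (gm _ _ ut).
Qed.

Lemma sum_geometric2_le1 m : \sum_(k < m) (2^-1 : R) ^+ k.+1 <= 1.
Proof.
suff -> : \sum_(k < m) (2^-1 : R) ^+ k.+1 = 1 - 2^-1 ^+ m by rewrite lerBlDr lerDl exprn_ge0.
elim: m => [|m IH]; first by rewrite big_ord0 expr0 subrr.
by rewrite big_ord_recr/= IH exprS; set u := _ ^+ m; lra.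
Qed.

End powR_sums.

Section lorentz.
Context {R : realType} {n : nat}.
Local Notation V := 'rV[R]_n.
Local Notation RR := (measurableTypeR R).
Implicit Types f h : V -> R.
Variables (C : set V -> \bar R) (q : R).
Hypotheses (rC : regular_capacity C) (q0 : 0 < q) (q1 : q <= 1).

Definition cap_tail f (t : R) : \bar R := C [set x | t < `|f x|].

Definition lorentz_integrand f (t : RR) : \bar R :=
  (cap_tail f t `^ q * (t `^ (q - 1))%:E)%E.

Definition lorentz_integral f : \bar R :=
  (\int[lebesgue_measure]_(t in `]0%R, +oo[) lorentz_integrand f t)%E.

Lemma cap_tail_ge0 f t : (0 <= cap_tail f t)%E. Proof. exact: rcap_ge0. Qed.

Lemma cap_tail_nonincreasing f s t : s <= t -> (cap_tail f t <= cap_tail f s)%E.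
Proof. by move=> st; apply: rcap_mono => // x /=; exact: le_lt_trans. Qed.

Lemma lorentz_integrand_ge0 f t : (0 <= lorentz_integrand f t)%E.
Proof. by rewrite mule_ge0 ?poweR_ge0// lee_fin powR_ge0. Qed.

Lemma measurable_lorentz_integrand f : measurable_fun [set: RR] (lorentz_integrand f).
Proof.
apply: emeasurable_funM.
  apply: (measurableT_comp (measurable_poweR q)).
  by apply: nonincreasing_emeasurable; exact: cap_tail_nonincreasing.
by apply/measurable_EFinP; exact: measurable_powR.
Qed.

Lemma lorentz_integral_ge0 f : (0 <= lorentz_integral f)%E.
Proof. by apply: integral_ge0 => t _; exact: lorentz_integrand_ge0. Qed.

Lemma lorentz_normE f : lorentz_norm C 1 q f = (lorentz_integral f `^ q^-1)%E.
Proof.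
rewrite /lorentz_norm powR1 mul1e; congr (_ `^ _)%E; apply: eq_integral => t.
rewrite inE/= in_itv/= andbT => t0.
rewrite /lorentz_integrand divr1 -muleA; congr (_ * _)%E.
by rewrite -EFinM -(powR_inv1 (ltW t0)) -powRD// (gt_eqF t0) implybT.
Qed.

(** On the shell both factors of the integrand are smallest at the right end, the power because q <=
    1, and the length (1 - 1/e) [scale k] is at least half of [scale k]. *)
Let shell_le f k : ((2^-1 * scale k `^ q)%:E * cap_tail f (scale k) `^ q <=
  \int[lebesgue_measure]_(t in shell k) lorentz_integrand f t)%E.
Proof.
set z : R := (scale_index k)%:~R.
have c0 : (0 <= cap_tail f (scale k) `^ q * (scale k `^ (q - 1))%:E)%E.
  by rewrite mule_ge0 ?poweR_ge0// lee_fin powR_ge0.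
have mJ : measurable (shell k : set RR) by exact: measurable_itv.
apply: (@le_trans _ _ (\int[lebesgue_measure]_(t in shell k)
   (cst (cap_tail f (scale k) `^ q * (scale k `^ (q - 1))%:E) t))%E).
  rewrite integral_cst//= lebesgue_measure_itv/= lte_fin.
  rewrite /scale ltr_expR ltrBlDr ltrDl ltr01 -EFinB -muleA muleC.
  rewrite -/(scale k) lee_wpmul2l ?poweR_ge0// -EFinM lee_fin.
  have e2 : 2 <= expR (1 : R) by have := expR_ge1Dx (1 : R); lra.
  have -> : scale k `^ q = scale k `^ (q - 1) * expR z.
    rewrite -[X in _ * X]/(scale k) -[X in _ * X]powRr1 ?ltW ?scale_gt0//.
    by rewrite -powRD ?subrK// gt_eqF ?scale_gt0// implybT.
  rewrite mulrCA; apply: ler_wpM2l; first exact: powR_ge0.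
  rewrite -/z expRD expRN; have := expR_gt0 z; set u := expR z => u0.
  have : (expR (1 : R))^-1 <= 2^-1 by rewrite lef_pV2 ?posrE// expR_gt0.
  have -> : scale k = u by [].
  move: (_^-1) => v v2; have : u * v <= u * 2^-1 by rewrite ler_pM2l.
  lra.
apply: ge0_le_integral => //.
- by apply/measurable_funTS; exact: measurable_lorentz_integrand.
- move=> t; rewrite /shell/= in_itv/= => /andP[t1 t2].
  have t0 : 0 < t by apply: lt_trans t1; exact: expR_gt0.
  apply: lee_pmul; rewrite ?poweR_ge0 ?lee_fin ?powR_ge0//.
    apply: (gt0_ler_poweR (ltW q0)); rewrite ?in_itv/= ?cap_tail_ge0 ?leey//.
    exact: cap_tail_nonincreasing.
  rewrite /powR !gt_eqF// ?scale_gt0// ler_expR ler_wnM2l ?subr_le0//.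
  by rewrite ler_ln ?posrE// scale_gt0.
Qed.

Lemma lorentz_integral_ge f m :
  (\sum_(k < m) (2^-1 * scale k `^ q)%:E * cap_tail f (scale k) `^ q <=
   lorentz_integral f)%E.
Proof.
have mf := @measurable_lorentz_integrand f.
have mJ k : measurable (shell k : set RR) by exact: measurable_itv.
pose D := \big[setU/set0]_(k <- iota 0 m) (shell k : set RR).
have mD : measurable D by exact: bigsetU_measurable.
apply: (@le_trans _ _ (\int[lebesgue_measure]_(t in D) lorentz_integrand f t)%E).
  rewrite ge0_integral_bigsetU//.
  - rewrite -(big_mkord xpredT (fun k => ((2^-1 * scale k `^ q)%:E * cap_tail f (scale k) `^ q)%E)).
    rewrite /index_iota subn0; apply: lee_sum => k _; exact: shell_le.
  - exact: iota_uniq.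
  - exact: trivIset_shell.
  - exact: measurable_funTS.
  - by move=> t _; exact: lorentz_integrand_ge0.
apply: ge0_subset_integral => //.
- exact: measurable_funTS.
- by move=> t _; exact: lorentz_integrand_ge0.
rewrite /D => t; rewrite -bigcup_seq => -[k _] /=; rewrite !in_itv/= andbT => /andP[h _].
by apply: lt_trans h; exact: expR_gt0.
Qed.

End lorentz.

(** * Upper integrals bounded by the Lorentz quasi-norm *)

Section upper_integral_lorentz.
Context {R : realType} {n : nat}.
Local Notation V := 'rV[R]_n.
Local Notation C0 := (Cc R n).
Variables (C : set V -> \bar R) (q : R) (mu : C0 -> R) (a : R).
Hypotheses (rC : regular_capacity C) (q0 : 0 < q) (q1 : q <= 1).
Hypotheses (mu_radon : is_radon mu) (a0 : 0 < a).
Hypothesis mu_le : forall G : set V, open G -> (tv_open mu G <= a%:E * C G)%E.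
Local Notation U := (tv_upper_integral mu).
Local Notation e := (expR (1 : R)).

Lemma lower_semicontinuous_indic (G : set V) : open G ->
  lower_semicontinuous (EFin \o (\1_G : V -> R)).
Proof.
move=> oG x b /=; have [Gx|nGx] := pselect (G x) => bx.
  exists G; first exact: open_nbhs_nbhs.
  by move=> y Gy; move: bx; rewrite !indicE !mem_set.
exists setT; first exact: filterT.
move=> y _; apply: lt_le_trans (_ : (0 <= _)%E); last by rewrite lee_fin.
by move: bx; rewrite indicE memNset.
Qed.

Lemma tv_upper_integral_le_scales (h : V -> R) (G : nat -> set V) : (forall k, open (G k)) ->
  (forall k, [set x | scale k < `|h x|] `<=` G k) ->
  (U (fun x => `|h x|%:E) <= \sum_(0 <= k <oo) (e * scale k)%:E * tv_open mu (G k))%E.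
Proof.
move=> oG hG; have e0 k : 0 < e * scale k by rewrite mulr_gt0 ?expR_gt0// scale_gt0.
pose u k (x : V) := ((e * scale k)%:E * (EFin \o (\1_(G k) : V -> R)) x)%E.
have u0 k x : (0 <= u k x)%E by rewrite mule_ge0 ?lee_fin// ltW.
have lu k : lower_semicontinuous (u k).
  by apply: lower_semicontinuousZ => //; exact: lower_semicontinuous_indic.
(* The majorant is the supremum of the [u k] rather than their sum: it is lower semicontinuous at
   once and still lies below the series. *)
pose s x := ereal_sup (range (fun k => u k x)).
apply: (@le_trans _ _ (tv_lsc mu s)).
  apply: uint_le => [x b /ereal_sup_gt[_ [k _ <-] /lu[A nA HA]]|x].
    by exists A => // y /HA; move/lt_le_trans; apply; apply: ereal_sup_ubound; exists k.
  have [x0|] := ltP 0 `|h x|; last first.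
    move=> h0; apply: (@le_trans _ _ 0%E); first by rewrite lee_fin.
    by apply: (le_trans (u0 0%N x)); apply: ereal_sup_ubound; exists 0%N.
  have [k /andP[k1 k2]] := scale_covers x0.
  apply: (@le_trans _ _ (u k x)); last by apply: ereal_sup_ubound; exists k.
  by rewrite /u/= indicE mem_set; [rewrite mule1 lee_fin|exact: hG].
apply: (@le_trans _ _ (\sum_(0 <= k <oo) tv_lsc mu (u k))%E).
  apply: tv_lsc_le_nneseries => // x; apply: ge_ereal_sup => _ [k _ <-].
  apply: le_trans (nneseries_lim_ge k.+1 _) => //.
  by rewrite big_nat_recr//= leeDr// sume_ge0.
have su0 k : (0 <= tv_lsc mu (u k))%E by apply: tv_lsc_ge0.
have suZ k : (tv_lsc mu (u k) <= (e * scale k)%:E * tv_open mu (G k))%E by exact: tv_lscZ.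
by apply: lee_nneseries => *; [exact: su0|exact: suZ].
Qed.

(** In the constant, e is the ratio of consecutive levels, 2 comes from the lengths of the shells,
    and the exponent 1/q from comparing l^1 with l^q. *)
Lemma uint_le_lorentz (h : V -> R) : (U (fun x => `|h x|%:E) <=
  (a * (e * 2 `^ q^-1))%:E * lorentz_norm C 1 q h)%E.
Proof.
have e0 : 0 < e by exact: expR_gt0.
have qn0 : q != 0 by rewrite gt_eqF.
have p0 : 0 < (2 : R) `^ q^-1 by rewrite powR_gt0.
rewrite lorentz_normE//; have := lorentz_integral_ge0 C q h.
have Ige := lorentz_integral_ge rC q0 q1 h.
case : (lorentz_integral C q h) Ige => [I| |]// Ige; last first.
  by rewrite poweRyr ?invr_eq0 ?gt_eqF// gt0_muley ?leey// lte_fin !mulr_gt0.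
rewrite lee_fin => I0.
have term0 k : (0 <= (2^-1 * scale k `^ q)%:E * cap_tail C h (scale k) `^ q)%E.
  by rewrite mule_ge0 ?poweR_ge0// lee_fin mulr_ge0 ?powR_ge0.
(* An infinite tail at one level would already make the integral infinite. *)
have Cfin k : cap_tail C h (scale k) \is a fin_num.
  rewrite ge0_fin_numE ?cap_tail_ge0// ltNge leye_eq; apply/negP => /eqP Cy.
  have s0 : (0 < (2^-1 * scale k `^ q)%:E)%E by rewrite lte_fin mulr_gt0// powR_gt0// scale_gt0.
  have tI : ((2^-1 * scale k `^ q)%:E * cap_tail C h (scale k) `^ q <= I%:E)%E.
    by apply: le_trans (Ige k.+1); rewrite big_ord_recr leeDr// sume_ge0.
  by move: tI; rewrite Cy (poweRyr qn0) (gt0_muley s0).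
pose c k := fine (cap_tail C h (scale k)).
have cE k : cap_tail C h (scale k) = (c k)%:E by rewrite fineK.
have c0 k : 0 <= c k by rewrite -lee_fin -cE cap_tail_ge0.
(* This is the inclusion of l^q in l^1: the q-th power of the sum is at most the sum of the q-th
   powers, which is at most 2 I. *)
have sum_le m : \sum_(k < m) scale k * c k <= (2 * I) `^ q^-1.
  set S := \sum_(_ < _) _.
  have S0 : 0 <= S by apply: sumr_ge0 => k _; rewrite mulr_ge0// ltW// scale_gt0.
  have -> : S = (S `^ q) `^ q^-1 by rewrite -powRrM mulfV// powRr1.
  have q0' := ltW q0.
  apply: ge0_ler_powR; rewrite ?nnegrE ?invr_ge0 ?powR_ge0 ?mulr_ge0//.
  apply: (@le_trans _ _ (\sum_(k < m) (scale k * c k) `^ q)).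
    by apply: (powR_sumr_le (a := fun k => scale k * c k)) => // k; rewrite mulr_ge0// ltW// scale_gt0.
  have := Ige m; under eq_bigr do rewrite cE poweR_EFin -EFinM.
  rewrite sumEFin lee_fin; under eq_bigr do rewrite -mulrA -powRM ?c0 ?ltW ?scale_gt0//.
  by rewrite -mulr_sumr ler_pdivrMl.
apply/lee_addgt0Pr => d d0; rewrite poweR_EFin -EFinM -EFinD.
(* Slack with a e [scale k] [dl k] = d 2^(-k-1), so that all losses add up to at most d. *)
pose dl k := d / (a * e) * 2^-1 ^+ k.+1 / scale k.
have dl0 k : 0 < dl k.
  have sk0 := scale_gt0 (R := R) k.
  by rewrite /dl divr_gt0// mulr_gt0// ?exprn_gt0// divr_gt0// mulr_gt0.
have /choice[G HG] : forall k, exists W : set V,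
    [/\ open W, [set x | scale k < `|h x|] `<=` W & (C W < (c k + dl k)%:E)%E].
  by move=> k; apply: (rcap_outer rC); rewrite -/(cap_tail C h (scale k)) cE lte_fin ltrDl.
have oG k : open (G k) by have [] := HG k.
apply: (@le_trans _ _ (\sum_(0 <= k <oo) (e * scale k)%:E * tv_open mu (G k))%E).
  by apply: tv_upper_integral_le_scales => // k; have [] := HG k.
have es0 k : 0 <= e * scale k by rewrite mulr_ge0 ?ltW// scale_gt0.
apply: lime_le.
  apply: is_cvg_nneseries => k _ _; apply: mule_ge0; rewrite ?lee_fin//.
  exact: tv_open_ge0.
apply: nearW => m; rewrite big_mkord.
apply: (@le_trans _ _ (\sum_(k < m) ((a * e) * (scale k * c k) + d * 2^-1 ^+ k.+1)%:E)%E).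
  apply: lee_sum => k _.
  apply: (@le_trans _ _ ((e * scale k)%:E * (a%:E * (c k + dl k)%:E))%E).
    apply: lee_wpmul2l; first by rewrite lee_fin.
    apply: (le_trans (mu_le (oG k))); apply: lee_wpmul2l; first by rewrite lee_fin ltW.
    by have [_ _ /ltW] := HG k.
  rewrite -!EFinM lee_fin le_eqVlt; apply/orP; left; apply/eqP; rewrite /dl.
  have := scale_gt0 (R := R) k; set x := scale k => x0.
  by move: (2^-1 ^+ _) => y; field; rewrite !gt_eqF.
rewrite sumEFin lee_fin big_split/= -!mulr_sumr.
have dr := ler_wpM2l (ltW d0) (sum_geometric2_le1 m); rewrite mulr1 in dr.
apply: lerD; last exact: dr.
rewrite -!mulrA; apply: (ler_wpM2l (ltW a0)); apply: (ler_wpM2l (ltW e0)).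
by rewrite -powRM//; exact: sum_le.
Qed.

End upper_integral_lorentz.

Section lorentz_estimates.
Context {R : realType} {n : nat}.
Local Notation V := 'rV[R]_n.
Local Notation RR := (measurableTypeR R).
Implicit Types f g h : V -> R.
Variables (C : set V -> \bar R) (q : R).
Hypotheses (rC : regular_capacity C) (q0 : 0 < q) (q1 : q <= 1).
Local Notation N := (lorentz_norm C 1 q).
Local Notation leb1 := (@lebesgue_measure R).

Let qn0 : q != 0. Proof. by rewrite gt_eqF. Qed.

Lemma lorentz_norm_ge0 f : (0 <= N f)%E.
Proof. by rewrite lorentz_normE// poweR_ge0. Qed.

Lemma lorentz_norm_abs f g : (forall x, `|f x| = `|g x|) -> N f = N g.
Proof.
move=> fg; rewrite /lorentz_norm; congr (_ * _ `^ _)%E; apply: eq_integral => t _.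
by rewrite (_ : [set x | t < `|f x|] = [set x | t < `|g x|])//; apply/seteqP; split => x /=; rewrite fg.
Qed.

(** The integrand may be singular at 0, so the fundamental theorem is applied on [d / (k + 2), d]
    and monotone convergence lets k tend to infinity. The shift by 2 keeps the left end strictly
    below d already for k = 0. *)
Lemma integral_powR_le (d : R) : 0 < d ->
  (\int[leb1]_(t in `]0%R, d]) (t `^ (q - 1))%:E <= (d `^ q / q)%:E)%E.
Proof.
move=> d0; pose F (t : R) := q^-1 * t `^ q.
have dF (t : R) : 0 < t -> is_derive t 1 F (t `^ (q - 1)).
  move=> t0; have h := is_derive1_powR q t0.
  have : is_derive t (1 : R) F (q^-1 *: (q * t `^ (q - 1) : R^o)) by exact: is_deriveZ.
  by have -> : q^-1 *: (q * t `^ (q - 1) : R^o) = t `^ (q - 1) by exact: mulKf.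
have cF (t : R) : 0 < t -> {for t, continuous F}.
  by move=> /dF[df _]; apply/differentiable_continuous/derivable1_diffP.
pose J (k : nat) : set RR := `[d / k.+2%:R, d]%classic.
have mJ k : measurable (J k) by exact: measurable_itv.
have a0 k : 0 < d / k.+2%:R by rewrite divr_gt0.
have ad k : d / k.+2%:R < d by rewrite ltr_pdivrMr// ltr_pMr// ltr1n.
have mf : measurable_fun [set: RR] (fun t : RR => (t `^ (q - 1))%:E).
  by apply/measurable_EFinP; exact: measurable_powR.
have f0 (t : RR) : (0 <= (t `^ (q - 1))%:E)%E by rewrite lee_fin powR_ge0.
have JE k : (\int[leb1]_(t in J k) (t `^ (q - 1))%:E <= (d `^ q / q)%:E)%E.
  rewrite /J (@continuous_FTC2 _ _ F)//.
  - rewrite -EFinB lee_fin /F mulrC lerBlDr lerDl mulr_ge0 ?powR_ge0// invr_ge0 ltW//.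
  - apply: derivable_within_continuous => t; rewrite in_itv/= => /andP[t1 _].
    by apply: derivable_powR; rewrite in_itv/= andbT (lt_le_trans (a0 k)).
  - split.
    + by move=> t; rewrite in_itv/= => /andP[t1 _]; have [] := dF t (lt_trans (a0 k) t1).
    + by apply: cvg_at_right_filter; exact: cF.
    + by apply: cvg_at_left_filter; exact: cF.
  - move=> t; rewrite in_itv/= => /andP[t1 _].
    by rewrite derive1E; have [_ ->] := dF t (lt_trans (a0 k) t1).
have UJ : `]0, d]%classic = \bigcup_k J k.
  apply/seteqP; split => t /=.
    rewrite in_itv/= => /andP[t0 td]; exists (Num.trunc (d / t)) => //.
    rewrite /J/= in_itv/= td andbT ler_pdivrMr// mulrC -ler_pdivrMr//.
    by have := ltW (truncnS_gt (d / t)); move/le_trans; apply; rewrite ler_nat.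
  by move=> [k _]; rewrite /J/= !in_itv/= => /andP[h ->]; rewrite (lt_le_trans (a0 k)).
have ndJ : {homo J : k m / (k <= m)%N >-> (k <= m)%O}.
  move=> k m km; apply/subsetPset => t; rewrite /J/= !in_itv/= => /andP[h ->].
  rewrite andbT; apply: le_trans h; rewrite ler_pM2l// lef_pV2 ?posrE//.
  by rewrite ler_nat !ltnS.
rewrite UJ; have cvJ := @ge0_nondecreasing_set_cvg_integral _ _ R J _ leb1 ndJ mJ
  (fun k => measurable_funTS mf) (fun k t _ => f0 t).
rewrite -(cvg_lim _ cvJ)//; apply: lime_le; first by apply/cvg_ex; eexists; exact: cvJ.
by apply: nearW.
Qed.

(** The integral of t^(q - 1) over ]0, 1] is 1/q; its power 1/q is the ratio between the quasi-norm
    of an indicator and the capacity of the set. *)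
Definition lorentz_const : R := q^-1 `^ q^-1.

Lemma lorentz_const_gt0 : 0 < lorentz_const.
Proof. by rewrite powR_gt0// invr_gt0. Qed.

(** The tail of f is at most C(E) for t <= d and is C of the empty set, that is 0, for t > d. *)
Lemma lorentz_norm_bounded f d (E : set V) : 0 < d -> (forall x, `|f x| <= d) ->
  (forall x, f x != 0 -> E x) -> (N f <= (d * lorentz_const)%:E * C E)%E.
Proof.
move=> d0 fd fE; have k0 := lorentz_const_gt0.
have [CE|] := ltP (C E) +oo%E; last first.
  by rewrite leye_eq => /eqP ->; rewrite gt0_muley ?leey// lte_fin mulr_gt0.
have CE0 := rcap_ge0 rC E; have Efin : C E \is a fin_num by rewrite ge0_fin_numE.
rewrite -(fineK Efin) in CE0 *; set c := fine (C E) in CE0 *; rewrite lee_fin in CE0.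
have mf : measurable_fun [set: RR] (fun t : RR => (t `^ (q - 1))%:E).
  by apply/measurable_EFinP; exact: measurable_powR.
have f0 (t : RR) : (0 <= (t `^ (q - 1))%:E)%E by rewrite lee_fin powR_ge0.
have cq0 : (0 <= (c `^ q)%:E)%E by rewrite lee_fin powR_ge0.
have mI : measurable (`]0%R, d] : set RR) by exact: measurable_itv.
have mD : measurable (`]0%R, +oo[ : set RR) by exact: measurable_itv.
pose g : RR -> \bar R := (fun t => (c `^ q)%:E * (t `^ (q - 1))%:E)%E \_ `]0%R, d].
have H : (lorentz_integral C q f <= (c `^ q * (d `^ q / q))%:E)%E.
  apply: (@le_trans _ _ (\int[leb1]_(t in `]0%R, +oo[) g t)%E).
    apply: ge0_le_integral => //.
    - by move=> t _; exact: lorentz_integrand_ge0.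
    - by apply: measurable_funTS; exact: measurable_lorentz_integrand.
    - apply/measurable_funTS; apply/(measurable_restrictT _ mI).
      by apply: measurable_funTS; exact: measurable_funeM.
    - move=> t /=; rewrite in_itv/= andbT => t0; rewrite /g patchE mem_setE in_itv/= t0/=.
      case: ifPn => [td|]; last (rewrite -ltNge => td).
        rewrite lee_wpmul2r// -poweR_EFin; apply: (gt0_ler_poweR (ltW q0)).
        + by rewrite in_itv/= cap_tail_ge0// leey.
        + by rewrite in_itv/= lee_fin CE0 leey.
        rewrite /c fineK//; apply: rcap_mono => // x /= tx; apply: fE.
        by rewrite -normr_gt0 (lt_trans t0).
      rewrite /lorentz_integrand /cap_tail (_ : [set x | _] = set0) ?rcap0// ?poweR0r ?mul0e//.
      by rewrite -subset0 => x /= tx; have := fd x; rewrite leNgt (lt_trans td).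
  rewrite /g -integral_mkcondr setIidr; last by move=> t /=; rewrite !in_itv/= => /andP[->].
  rewrite ge0_integralZl//; last by apply: measurable_funTS.
  rewrite EFinM; apply: lee_wpmul2l => //; exact: integral_powR_le.
rewrite lorentz_normE//.
apply: (@le_trans _ _ ((c `^ q * (d `^ q / q))%:E `^ q^-1)%E).
  apply: gt0_ler_poweR => //; rewrite ?invr_ge0 ?(ltW q0)// ?in_itv/= ?leey ?andbT.
  - exact: lorentz_integral_ge0.
  - by rewrite lee_fin mulr_ge0 ?powR_ge0// divr_ge0 ?powR_ge0// ltW.
rewrite poweR_EFin lee_fin powRM ?powR_ge0 ?divr_ge0 ?powR_ge0 ?(ltW q0)//.
rewrite [X in _ * X]powRM ?powR_ge0 ?invr_ge0 ?(ltW q0)// -!powRrM mulfV// !powRr1 ?(ltW d0)//.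
by rewrite mulrC.
Qed.

Lemma lorentz_norm0 : N (fun=> 0) = 0%E.
Proof.
apply/eqP; rewrite eq_le lorentz_norm_ge0 andbT.
apply: le_trans (@lorentz_norm_bounded _ 1 set0 _ _ _) _ => //; last by rewrite rcap0// mule0.
- by move=> x; rewrite normr0.
- by move=> x; rewrite eqxx.
Qed.

(** Substitution t -> t / |a|: the Jacobian |a| and the factor |a|^(q - 1) combine to |a|^q. The
    integrand is extended by zero to the whole line, where the affine change of variables is
    stated. *)
Lemma lorentz_normZ (a : R) f : N (fun x => a * f x) = (`|a|%:E * N f)%E.
Proof.
have [->|a0] := eqVneq a 0.
  by rewrite normr0 mul0e -lorentz_norm0; congr N; apply/funext => x; rewrite mul0r.
have na0 : 0 < `|a| by rewrite normr_gt0.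
rewrite !lorentz_normE//.
suff -> : lorentz_integral C q (fun x => a * f x) = ((`|a| `^ q)%:E * lorentz_integral C q f)%E.
  rewrite poweRM ?lee_fin ?powR_ge0 ?lorentz_integral_ge0//.
  by rewrite poweR_EFin -powRrM mulfV// powRr1.
pose G : RR -> \bar R := lorentz_integrand C q f \_ `]0%R, +oo[.
have mD : measurable (`]0%R, +oo[ : set RR) by exact: measurable_itv.
have mG : measurable_fun [set: RR] G.
  by apply/(measurable_restrictT _ mD); apply: measurable_funTS; exact: measurable_lorentz_integrand.
have G0 t : (0 <= G t)%E by rewrite /G patchE; case: ifP => // _; exact: lorentz_integrand_ge0.
rewrite /lorentz_integral integral_mkcond [in RHS]integral_mkcond -/G.
transitivity (\int[leb1]_t ((`|a| `^ (q - 1))%:E * G (0 + `|a|^-1 * t)%R))%E.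
  apply: eq_integral => t _; rewrite /G !patchE !mem_setE !in_itv/= !andbT add0r.
  rewrite pmulr_rgt0 ?invr_gt0//; case: ifPn => [t0|_]; last by rewrite mule0.
  rewrite /lorentz_integrand /cap_tail muleCA.
  rewrite (_ : [set x | t < `|a * f x|] = [set x | `|a|^-1 * t < `|f x|]); last first.
    by apply/seteqP; split => x /=; rewrite normrM ltr_pdivrMl.
  congr (_ * _)%E; rewrite -EFinM; congr EFin.
  by rewrite -powRM ?mulr_ge0 ?invr_ge0 ?(ltW t0)// mulVKf// gt_eqF.
have an0 : `|a|^-1 != 0 by rewrite invr_eq0 gt_eqF.
have p0 : (0 <= (`|a| `^ (q - 1))%:E)%E by rewrite lee_fin powR_ge0.
have mGa : measurable_fun [set: RR] (fun t : RR => G (0 + `|a|^-1 * t)%R).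
  by apply: (measurableT_comp mG); exact: measurable_affine.
rewrite (ge0_integralZl leb1 measurableT mGa (fun t _ => G0 _) p0).
rewrite (ge0_integral_affine _ an0 mG G0) muleA -EFinM normrV ?unitfE ?gt_eqF// invrK normr_id.
congr (_%:E * _)%E; rewrite -[X in _ * X](powRr1 (ltW na0)) -powRD ?subrK//.
by rewrite (gt_eqF na0) implybT.
Qed.

End lorentz_estimates.

(** * Duality *)

Section duality.
Context {R : realType} {n : nat}.
Local Notation V := 'rV[R]_n.
Local Notation C0 := (Cc R n).
Variables (C : set V -> \bar R) (q : R).
Hypotheses (rC : regular_capacity C) (q0 : 0 < q) (q1 : q <= 1).
Implicit Types (mu : C0 -> R) (phi psi : C0) (f g : V -> R) (L : (V -> R) -> R).
Local Notation N := (lorentz_norm C 1 q).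
Local Notation K := (lorentz_const q).
Local Notation K' := (expR (1 : R) * 2 `^ q^-1).

Lemma lorentz_norm_Cc phi : (N phi < +oo)%E.
Proof.
have [M M0 HM] := Cc_bounded phi.
apply: le_lt_trans (lorentz_norm_bounded rC q0 (E := fun_supp phi) M0 HM _) _.
  by move=> x px; exact: subset_closure.
have := rcap_compact rC (Cc_supp_compact (phi := phi)).
have := rcap_ge0 rC (fun_supp phi); case: (C _) => // c _ _.
by rewrite -EFinM ltry.
Qed.

Lemma lorentz_closure_Cc phi : lorentz_closure C 1 q phi.
Proof.
split=> [|e e0]; first exact: lorentz_norm_Cc.
exists phi; rewrite (_ : (fun x => _) = (fun=> 0)); last by apply/funext => x; rewrite subrr.
by rewrite (lorentz_norm0 rC q0) lte_fin.
Qed.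

Lemma norm_frakM_le_dual mu (D : R) : is_radon mu -> 0 <= D ->
  (forall phi, (N phi <= 1)%E -> `|mu phi| <= D) ->
  (norm_frakM C mu <= (D * K)%:E)%E.
Proof.
move=> mu_radon D0 muD; have K0 : 0 < K by exact: lorentz_const_gt0.
have muN phi : (`|mu phi|%:E <= D%:E * N phi)%E.
  have := lorentz_norm_Cc phi; have := lorentz_norm_ge0 C q phi.
  case E : (N phi) => [r| |]// + _; rewrite lee_fin -EFinM lee_fin => r0.
  have scale_le (a : R) : 0 < a -> a * r <= 1 -> a * `|mu phi| <= D.
    move=> a0 ar; have := muD (a *: phi).
    have -> : (a *: phi : V -> R) = (fun x => a * phi x) by [].
    rewrite (lorentz_normZ rC q0) E -EFinM lee_fin gtr0_norm// => /(_ ar).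
    by rewrite (radonZ mu_radon) normrM gtr0_norm.
  move: r0; rewrite le_eqVlt => /orP[/eqP r0|r0]; last first.
    have := scale_le r^-1; rewrite invr_gt0 mulVf ?gt_eqF// => /(_ r0 (lexx _)).
    by rewrite ler_pdivrMl// mulrC.
  (* If phi has quasi-norm 0, all its multiples stay in the unit ball, and the multiple by (D + 1) /
     e forces |mu phi| <= e. *)
  rewrite -r0 mulr0; apply/ler_addgt0Pr => e e0; rewrite add0r.
  have D1 : 0 < D + 1 by rewrite ltr_wpDl.
  have := scale_le ((D + 1) / e); rewrite -r0 mulr0 divr_gt0// => /(_ isT ler01).
  rewrite mulrAC ler_pdivrMr// => h; rewrite -(ler_pM2l D1) (le_trans h)//.
  by rewrite ler_wpM2r ?(ltW e0)// lerDl.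
have open_le G : open G -> (tv_open mu G <= (D * K)%:E * C G)%E.
  move=> oG; apply: ge_ereal_sup => _ [phi /= pG <-]; apply: ge_ereal_sup => _ [psi /= pp <-].
  apply: (le_trans (muN psi)); rewrite EFinM -muleA; apply: lee_wpmul2l; first by rewrite lee_fin.
  rewrite -[X in (_ <= X%:E * _)%E]mul1r; apply: (lorentz_norm_bounded rC q0) => // x.
    apply: (le_trans (pp x)); have [_] := pG x; rewrite lee_fin => /le_trans; apply.
    by rewrite indicE; case: (_ \in _).
  move=> px; apply: contrapT => Gx; have [_] := pG x; rewrite indicE memNset// lee_fin => p0.
  by move/eqP: px; apply; apply/eqP; rewrite -normr_le0 (le_trans (pp x)).
apply/lee_addgt0Pr => e e0; rewrite -EFinD.
(* [D] may be 0, and passing from open sets to arbitrary ones requires a positive constant. *)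
have b0 : 0 < D * K + e by rewrite ltr_wpDl// mulr_ge0// ltW.
apply: norm_frakM_le => // E; apply: tv_outer_le_of_open => // G oG.
apply: (le_trans (open_le _ oG)); apply: lee_wpmul2r; first exact: rcap_ge0.
by rewrite lee_fin lerDl ltW.
Qed.

Section radon_functional.
Variables (mu : C0 -> R) (mu_radon : is_radon mu) (a : R).
Hypotheses (a0 : 0 < a) (mua : (norm_frakM C mu <= a%:E)%E).
Local Notation U := (tv_upper_integral mu).

Lemma uint_le_lorentz_norm f : (U (fun x => `|f x|%:E) <= (a * K')%:E * N f)%E.
Proof. by apply: uint_le_lorentz => // G oG; exact: tv_open_le. Qed.

Let aK0 : 0 < a * K'.
Proof. by rewrite mulr_gt0// mulr_gt0 ?expR_gt0// powR_gt0. Qed.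

Lemma uint_small f (e : R) : 0 < e -> (N f < (e / (a * K'))%:E)%E ->
  (U (fun x => `|f x|%:E) < e%:E)%E.
Proof.
move=> e0 Nf; apply: (le_lt_trans (uint_le_lorentz_norm f)).
by rewrite -lte_pdivlMl// -EFinM mulrC.
Qed.

Lemma lorentz_closure_has_integral f : lorentz_closure C 1 q f ->
  exists v, has_integral mu f v.
Proof.
move=> [_ Hf]; apply: has_integral_ex => // e e0.
have [|phi Nphi] := Hf (e / (a * K')); first by rewrite divr_gt0.
by exists phi; exact: uint_small.
Qed.

Lemma has_integral_lorentz_le f v : has_integral mu f v ->
  (`|v|%:E <= (a * K')%:E * N f)%E.
Proof. by move=> /(has_integral_le mu_radon)/le_trans; apply; exact: uint_le_lorentz_norm. Qed.

(** L g - L f is the integral of g - f, so it is bounded by the upper integral of |g - f| and hence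
    by the quasi-norm of g - f. *)
Lemma is_dual_integral L : (forall f, lorentz_closure C 1 q f -> has_integral mu f (L f)) ->
  (forall b f g, lorentz_closure C 1 q f -> lorentz_closure C 1 q g ->
     L (fun x => b * f x + g x) = b * L f + L g) -> is_dual C 1 q L.
Proof.
move=> repL linL; split => // f cf e e0; exists (e / (a * K')); first by rewrite divr_gt0.
move=> g cg Ngf.
have fg : has_integral mu (fun x => g x - f x) (L g - L f).
  have := has_integral_lin mu_radon (-1) (repL _ cf) (repL _ cg).
  rewrite mulN1r addrC; congr (has_integral _ _ _).
  by apply/funext => x; rewrite mulN1r addrC.
rewrite -lte_fin; apply: le_lt_trans (uint_small e0 Ngf).
exact: has_integral_le.
Qed.

End radon_functional.

Lemma frakM_fin mu : frakM C mu -> exists2 a : R, 0 <= a & norm_frakM C mu = a%:E.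
Proof.
move=> [mu_radon]; have := norm_frakM_ge0 rC mu_radon.
by case: (norm_frakM C mu) => // a a0 _; exists a.
Qed.

Lemma represents_Cc mu L phi : is_radon mu -> represents C 1 q mu L -> mu phi = L phi.
Proof.
move=> mu_radon rep; apply: (has_integral_unique mu_radon (has_integral_Cc mu_radon phi)).
exact/rep/lorentz_closure_Cc.
Qed.

(** Functions supported in a fixed compact set and uniformly small have small quasi-norm, so
    continuity for the quasi-norm implies continuity for the inductive limit topology. *)
Lemma dual_restriction L : is_dual C 1 q L ->
  is_radon (fun phi : C0 => L phi) /\ exists2 D : R, 0 <= D &
    forall phi, (N phi <= 1)%E -> `|L phi| <= D.
Proof.
move=> [linL contL].
have linC (b : R) phi psi : L (b *: phi + psi : C0) = b * L phi + L psi.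
  by rewrite -linL//; exact: lorentz_closure_Cc.
have L0 : L (0 : C0) = 0.
  by have := linC 1 0 0; rewrite scaler0 addr0 mul1r => h; lra.
have LZ (b : R) phi : L (b *: phi : C0) = b * L phi.
  by have := linC b phi 0; rewrite addr0 L0 addr0.
have cont0 (e : R) : 0 < e -> exists2 d : R, 0 < d & forall phi, (N phi < d%:E)%E -> `|L phi| < e.
  move=> e0; have [d d0 H] := contL _ (lorentz_closure_Cc 0) e e0.
  exists d => // phi Np; have := H _ (lorentz_closure_Cc phi); rewrite L0 subr0; apply.
  by rewrite (_ : (fun x => _) = phi)//; apply/funext => x; rewrite [X in _ - X](_ : _ = 0)// subr0.
split; last first.
  have [d d0 H] := cont0 1 ltr01; exists (2 / d); first by rewrite divr_ge0// ltW.
  move=> phi Np; have d2 : 0 < d / 2 by rewrite divr_gt0.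
  have : `|L ((d / 2) *: phi : C0)| < 1.
    apply: H; have -> : ((d / 2) *: phi : V -> R) = (fun x => d / 2 * phi x) by [].
    rewrite (lorentz_normZ rC q0) gtr0_norm//.
    apply: (@le_lt_trans _ _ ((d / 2)%:E * 1)%E); first by rewrite lee_wpmul2l// lee_fin ltW.
    by rewrite mule1 lte_fin; lra.
  rewrite LZ normrM gtr0_norm// -ltr_pdivlMl// mulr1 invf_div.
  exact: ltW.
split; first by move=> b phi psi; exact: linC.
(* The sublevel set of |L| is itself absolutely convex. *)
move=> e e0; exists [set phi | `|L phi| < e]; split => //.
  move=> b c phi psi bc pe qe.
  have E : L (b *: phi + c *: psi : C0) = b * L phi + c * L psi by rewrite linC LZ.
  rewrite /mkset E; move: pe qe; rewrite /mkset => pe qe.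
  apply: (le_lt_trans (ler_normD _ _)); rewrite !normrM.
  pose m := Num.max `|L phi| `|L psi|.
  have m0 : 0 <= m by rewrite le_max normr_ge0.
  have me : m < e by rewrite gt_max pe qe.
  apply: le_lt_trans me; apply: (@le_trans _ _ ((`|b| + `|c|) * m)); last by rewrite ler_piMl.
  by rewrite mulrDl lerD// ler_wpM2l// le_max lexx ?orbT.
move=> H cH; have [d d0 Hd] := cont0 e e0.
have K0 : 0 < K by exact: lorentz_const_gt0.
have CH0 := rcap_ge0 rC H; have CHy := rcap_compact rC cH.
have Hfin : C H \is a fin_num by rewrite ge0_fin_numE.
pose c := fine (C H); have c0 : 0 <= c by rewrite -lee_fin fineK.
(* A function supported in [H] and bounded by this number has quasi-norm at most d / 2 times c / (c
   + 1), which is less than d; c + 1 replaces c because the capacity of [H] may be 0. *)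
have dd0 : 0 < d / (2 * (K * (c + 1))) by rewrite divr_gt0// mulr_gt0// mulr_gt0// ltr_wpDl.
exists (d / (2 * (K * (c + 1)))) => // phi sH pd; apply: Hd.
apply: (le_lt_trans (lorentz_norm_bounded rC q0 (E := H) dd0 pd _)).
  by move=> x px; apply: sH; exact: subset_closure.
rewrite -(fineK Hfin) -/c -EFinM lte_fin.
have c1 : 0 < c + 1 by rewrite ltr_wpDl.
have -> : d / (2 * (K * (c + 1))) * K * c = d / 2 * (c / (c + 1)) by field; rewrite !gt_eqF.
have cc : c / (c + 1) <= 1 by rewrite ler_pdivrMr// mul1r lerDl.
have := ler_wpM2l (ltW (divr_gt0 d0 (ltr0Sn R 1))) cc; lra.
Qed.

(** A [phi] close to f in quasi-norm meets both requirements of the integral: [L phi] is close to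
    [L f] by continuity, and the upper integral of |f - phi| is small by the capacitary estimate.
    Uniqueness holds because the values of mu on C_0 are those of [L]. *)
Lemma dual_represented L : is_dual C 1 q L ->
  exists! mu : C0 -> R, frakM C mu /\ represents C 1 q mu L.
Proof.
move=> dL; have [mu_radon [D D0 muD]] := dual_restriction dL.
set mu : C0 -> R := fun phi => L phi.
have nmu := norm_frakM_le_dual mu_radon D0 muD.
have fmu : frakM C mu by split => //; apply: le_lt_trans nmu _; rewrite ltry.
exists mu; split; last first.
  by move=> nu [[nu_radon _] rnu]; apply/funext => phi; rewrite (represents_Cc phi nu_radon rnu).
split => // f cf e e0.
have a0 : 0 < D * K + 1 by rewrite ltr_wpDl// mulr_ge0// ltW// lorentz_const_gt0.
have na : (norm_frakM C mu <= (D * K + 1)%:E)%E by apply: (le_trans nmu); rewrite lee_fin lerDl.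
set a := D * K + 1 in a0 na *.
have [d d0 Hd] := dL.2 _ cf e e0.
have aK0 : 0 < a * K' by rewrite mulr_gt0// mulr_gt0 ?expR_gt0// powR_gt0.
have m0 : 0 < Num.min d (e / (a * K')) by rewrite lt_min d0 divr_gt0.
have [phi Nphi] := cf.2 _ m0; exists phi; split.
  apply: (uint_small mu_radon a0 na e0 (f := fun x => f x - phi x)).
  by apply: (lt_le_trans Nphi); rewrite lee_fin ge_min lexx orbT.
apply: Hd; first exact: lorentz_closure_Cc.
rewrite (@lorentz_norm_abs _ _ _ _ _ (fun x => f x - phi x)); last by move=> x; rewrite distrC.
by apply: (lt_le_trans Nphi); rewrite lee_fin ge_min lexx.
Qed.

Lemma frakM_represents mu : frakM C mu -> exists L, is_dual C 1 q L /\ represents C 1 q mu L.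
Proof.
move=> fmu; have [mu_radon _] := fmu; have [r r0 rE] := frakM_fin fmu.
have a0 : 0 < r + 1 by rewrite ltr_wpDl.
have na : (norm_frakM C mu <= (r + 1)%:E)%E by rewrite rE lee_fin lerDl.
(* A functional has to be defined on all functions; the value 0 is reserved for those that are not
   integrable, and on the closure the integral exists. *)
pose L f := xget 0 [set v | has_integral mu f v].
have hL f v : has_integral mu f v -> L f = v.
  by move=> fv; apply: xget_unique => // w fw; exact: (has_integral_unique mu_radon fw fv).
have rep : represents C 1 q mu L.
  move=> f /(lorentz_closure_has_integral mu_radon a0 na)[v fv].
  by rewrite (hL _ _ fv).
exists L; split => //; apply: (is_dual_integral mu_radon a0 na) => // b f g cf cg.
by apply: hL; apply: has_integral_lin => //; exact: rep.
Qed.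

Lemma dual_norm_frakM L mu : is_dual C 1 q L -> frakM C mu -> represents C 1 q mu L ->
  (norm_frakM C mu <= K%:E * dual_norm C 1 q L)%E /\
  (dual_norm C 1 q L <= K'%:E * norm_frakM C mu)%E.
Proof.
move=> dL fmu rep; have [mu_radon _] := fmu; have K0 : 0 < K by exact: lorentz_const_gt0.
have K'0 : 0 < K' by rewrite mulr_gt0 ?expR_gt0// powR_gt0.
have muL phi : (N phi <= 1)%E -> (`|mu phi|%:E <= dual_norm C 1 q L)%E.
  move=> Np; rewrite (represents_Cc phi mu_radon rep); apply: ereal_sup_ubound.
  by exists phi => //; split => //; exact: lorentz_closure_Cc.
split.
  have : (0 <= dual_norm C 1 q L)%E.
    apply: le_trans (muL 0 _); first by rewrite lee_fin.
    rewrite (_ : ((0 : C0) : V -> R) = (fun=> 0))//.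
    by rewrite (lorentz_norm0 rC q0).
  case E : (dual_norm C 1 q L) => [D| |]//; last by rewrite gt0_muley ?leey.
  rewrite lee_fin => D0; rewrite -EFinM mulrC; apply: norm_frakM_le_dual => // phi /muL.
  by rewrite E lee_fin.
have [r r0 rE] := frakM_fin fmu; apply: ge_ereal_sup => _ [f [cf Nf] <-].
(* The estimate asks for a positive bound of the norm; after multiplication by K' the slack e / K'
   costs only e. *)
apply/lee_addgt0Pr => e e0; have b0 : 0 < r + e / K' by rewrite ltr_wpDl// divr_gt0.
have na : (norm_frakM C mu <= (r + e / K')%:E)%E by rewrite rE lee_fin lerDl divr_ge0// ltW.
apply: (le_trans (has_integral_lorentz_le mu_radon b0 na (rep _ cf))).
apply: (@le_trans _ _ (((r + e / K') * K')%:E * 1)%E).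
  by rewrite lee_wpmul2l// lee_fin mulr_ge0// ltW.
by rewrite mule1 rE -EFinM -EFinD lee_fin mulrDl divfK ?gt_eqF// mulrC.
Qed.

Lemma dual_is_frakM_regular_capacity : dual_is_frakM C 1 q.
Proof.
have K0 : 0 < K by exact: lorentz_const_gt0.
have K'0 : 0 < K' by rewrite mulr_gt0 ?expR_gt0// powR_gt0.
split; [exact: dual_represented|exact: frakM_represents|].
(* K serves the lower estimate and K' the upper one. *)
exists (K + K'); first by rewrite addr_gt0.
move=> L mu dL fmu rep; have [h1 h2] := dual_norm_frakM dL fmu rep.
have KK : 0 < K + K' by rewrite addr_gt0.
have D0 : (0 <= dual_norm C 1 q L)%E.
  have := le_trans (norm_frakM_ge0 rC fmu.1) h1.
  by rewrite pmule_rge0.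
split.
  rewrite lee_pdivrMl//; apply: (le_trans h1); apply: lee_wpmul2r => //.
  by rewrite lee_fin lerDl ltW.
apply: (le_trans h2); apply: lee_wpmul2r; first exact: norm_frakM_ge0 fmu.1.
by rewrite lee_fin lerDr ltW.
Qed.

End duality.

Lemma regular_bessel_capacity (R : realType) (n : nat) (alpha s : R) :
  0 < alpha -> 1 < s -> regular_capacity (@capacity R n alpha s).
Proof.
move=> alpha0 s1; split.
- exact: capacity_ge0.
- exact: capacity_mono.
- exact: capacity0.
- exact: capacity_outer_regular.
- exact: capacity_compact_fin.
- exact: capacity_gt0.
Qed.

Theorem theorem1p10 (R : realType) (n : nat) (alpha s q : R)
    (alpha_gt0 : 0 < alpha) (s_gt1 : 1 < s) (s_le : s <= n%:R / alpha)
    (q_gt0 : 0 < q) (q_le1 : q <= 1) :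
  dual_is_frakM (@capacity R n alpha s) 1 q /\
  forall mu : Cc R n -> R, is_radon mu ->
    norm_frakM (@capacity R n alpha s) mu =
    ereal_inf [set a%:E | a in [set a : R | 0 < a /\
      forall E : set 'rV[R]_n,
        (tv_outer mu E <= a%:E * capacity alpha s E)%E]].
Proof.
have rC : regular_capacity (@capacity R n alpha s) by exact: regular_bessel_capacity.
by split; [exact: dual_is_frakM_regular_capacity|move=> mu; exact: norm_frakM_inf].
Qed.
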